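(* Let $a\in\{2,4,8\}$, let $x$ be a point of the closed orbit $Y_a^4$ of $Y_a$, and let $H_x\subset\mathbb P(U_a)$ denote its polar hyperplane. Then $Y_a\setminus (Y_a\cap H_x)\simeq\mathbf C^{3a}$.
   Context: For $a=1,2,4,8$, $\mathbb A$ is the complexification of $\mathbf R,\mathbf C,\mathbf H,\mathbf O$ respectively: a complex composition algebra of dimension $a$ with conjugation $x\mapsto\bar x$ and quadratic form $q$, $x\bar x=q(x)1$. $\mathcal J_3(\mathbb A)$ is the complex vector space (dimension $3a+3$) of $3\times3$ $\mathbb A$-Hermitian matrices (diagonal entries in $\mathbf C$, off-diagonal entries in $\mathbb A$), a Jordan algebra for $A\circ B=\frac12(AB+BA)$. $\mathcal J_3(\mathbb A)_0$ is the subspace of traceless matrices, with the nondegenerate quadratic form $Q(X)=\operatorname{trace}(X^2)$ and associated bilinear form $Q(X,Y)$. $SO_3(\mathbb A):=\operatorname{Aut}(\mathcal J_3(\mathbb A))$, $\mathfrak{so}_3(\mathbb A)=\operatorname{Der}(\mathcal J_3(\mathbb A))$. The Severi variety is $X_a=\{[X]: X^2=\operatorname{trace}(X)X\}\subset\mathbb P\mathcal J_3(\mathbb A)$. $I$ is the identity matrix. $G(2,V)$ is the Grassmannian of $2$-dimensional subspaces of $V$ (lines in $\mathbb P(V)$), in its Plücker embedding. A plane is simply $3$-secant to $X_a$ if it meets $X_a$ in exactly three points, each a simple contact. The variety of reductions $Y_a\subset G(2,\mathcal J_3(\mathbb A)_0)$ is the Zariski closure of the set of lines that are images, under the projection $X\mapsto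 X-\frac13\operatorname{trace}(X)I$ from $[I]$, of planes through $[I]$ which are simply $3$-secant to $X_a$. For $a>1$ it is the union of four $SO_3(\mathbb A)$-orbits of codimensions $0,1,2,4$; $Y_a^4$ denotes the one of codimension $4$, which is closed. $U_a\subset\wedge^2\mathcal J_3(\mathbb A)_0$ is the kernel of the map $\wedge^2\mathcal J_3(\mathbb A)_0\to\mathfrak{so}_3(\mathbb A)^*$, $X\wedge Y\mapsto(u\mapsto Q(X,uY))$; one has $Y_a=G(2,\mathcal J_3(\mathbb A)_0)\cap\mathbb P(U_a)$. The form $Q$ induces the invariant bilinear form $\langle A\wedge B,C\wedge D\rangle=Q(A,C)Q(B,D)-Q(A,D)Q(B,C)$ on $\wedge^2\mathcal J_3(\mathbb A)_0$, whose restriction to $U_a$ is nondegenerate; the polar hyperplane $H_x$ of $x\in\mathbb P(U_a)$ is the orthogonal of $x$ in $\mathbb P(U_a)$ with respect to it. *)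

(* Defs.v *)
From HB Require Import structures.
From mathcomp Require Import all_boot all_order all_algebra.
From mathcomp Require Import boolp classical_sets functions reals.
From mathcomp Require Import complex.
From mathcomp Require Import mpoly ring.
Set Implicit Arguments.
Unset Strict Implicit.
Unset Printing Implicit Defensive.

Import GRing.Theory.
Local Open Scope ring_scope.
Local Open Scope classical_set_scope.

(* Points of P(V) are the [L : {vspace V}] with [\dim L = 1]; the value at [L]
   of a notion homogeneous in v is read off on the vectors v of [L]. *)
Section ProjectiveSpace.
Variables (F : fieldType) (V : vectType F).

Definition peval (p : {mpoly F[\dim {:V}]}) (v : V) : F :=
  p.@[fun i => coord (vbasis {:V}) i v].

Definition pzeros (S : set {mpoly F[\dim {:V}]}) : set {vspace V} :=
  [set L | \dim L = 1%N /\ forall p, S p -> {in L, forall v, peval p v = 0}].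

Definition pclosed (Z : set {vspace V}) : Prop :=
  exists2 S : set {mpoly F[\dim {:V}]},
    (forall p, S p -> exists d : nat, p \is d.-homog) & Z = pzeros S.

Definition pclosure (A : set {vspace V}) : set {vspace V} :=
  [set L | forall Z, pclosed Z -> A `<=` Z -> Z L].

Definition pirreducible (Z : set {vspace V}) : Prop :=
  Z !=set0 /\
  forall A B, pclosed A -> pclosed B -> Z `<=` A `|` B -> Z `<=` A \/ Z `<=` B.

(* Z 0 < Z 1 < ... < Z n, irreducible and closed in S. *)
Definition irreducible_chain (S : set {vspace V}) (n : nat) : Prop :=
  exists Z : nat -> set {vspace V},
    (forall i, (i <= n)%N ->
       pirreducible (Z i) /\ exists2 C, pclosed C & Z i = S `&` C) /\
    (forall i, (i < n)%N -> Z i `<` Z i.+1).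

(* S has Krull dimension n. *)
Definition has_dim (S : set {vspace V}) (n : nat) : Prop :=
  irreducible_chain S n /\ ~ irreducible_chain S n.+1.

End ProjectiveSpace.

(* A topological space with a sheaf of F-valued functions, supported on the
   subset [carrier] of [pt]. For U open, [regular U f] only concerns f on U. *)
Record space (F : fieldType) := Space {
  pt : Type;
  carrier : set pt;
  zopen : set pt -> Prop;
  regular : set pt -> (pt -> F) -> Prop }.

Arguments pt {F} s.
Arguments carrier {F} s.
Arguments zopen {F} s U : rename.
Arguments regular {F} s U f : rename.

Definition morphism (F : fieldType) (X Y : space F) (f : pt X -> pt Y) : Prop :=
  carrier X `<=` f @^-1` carrier Y /\
  forall U, zopen Y U ->
    zopen X (carrier X `&` f @^-1` U) /\
    forall h, regular Y U h -> regular X (carrier X `&` f @^-1` U) (h \o f).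

Definition isomorphic (F : fieldType) (X Y : space F) : Prop :=
  exists (f : pt X -> pt Y) (g : pt Y -> pt X),
    [/\ morphism f, morphism g,
        (forall x, carrier X x -> g (f x) = x) &
        (forall y, carrier Y y -> f (g y) = y)].

(* A subset S of P(V), with the induced topology and the functions that are
   locally quotients of homogeneous polynomials of the same degree; this is the
   usual structure when S is locally closed. *)
Definition quasiproj (F : fieldType) (V : vectType F) (S : set {vspace V}) :
    space F :=
  {| pt := {vspace V};
     carrier := S;
     zopen := fun U => exists2 C, pclosed C & U = S `\` C;
     regular := fun U f => forall L, U L ->
       exists C (d : nat) (p q : {mpoly F[\dim {:V}]}),
         [/\ pclosed C, ~ C L, p \is d.-homog, q \is d.-homog &
             forall M, (U `\` C) M -> forall v, v \in M -> v != 0 ->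
               peval q v != 0 /\ f M = peval p v / peval q v] |}.

Definition affine_closed (F : fieldType) (n : nat) (Z : set 'rV[F]_n) : Prop :=
  exists S : set {mpoly F[n]}, Z = [set v | forall p, S p -> p.@[v 0] = 0].

Definition affine_space (F : fieldType) (n : nat) : space F :=
  {| pt := 'rV[F]_n;
     carrier := setT;
     zopen := fun U => exists2 C, affine_closed C & U = ~` C;
     regular := fun U f => forall v, U v ->
       exists C (p q : {mpoly F[n]}),
         [/\ affine_closed C, ~ C v &
             forall w, (U `\` C) w ->
               q.@[w 0] != 0 /\ f w = p.@[w 0] / q.@[w 0]] |}.

(* Lambda^2 V is realised inside V (x) V = 'M_(dim V), in coordinates with
   respect to [vbasis {:V}], as the space of alternating tensors, with
   X /\ Y := X (x) Y - Y (x) X. *)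
Section ExteriorSquare.
Variables (F : fieldType) (V : vectType F).

Definition coords (v : V) : 'rV[F]_(\dim {:V}) :=
  \row_i coord (vbasis {:V}) i v.

Definition wedge (v w : V) : 'M[F]_(\dim {:V}) :=
  (coords v)^T *m coords w - (coords w)^T *m coords v.

(* The subspace Lambda^2 L of Lambda^2 V. For \dim L = 2 it is a line: the
   image of L under the Pluecker embedding. *)
Definition ext2 (L : {vspace V}) : {vspace 'M[F]_(\dim {:V})} :=
  <<[seq wedge v w | v <- vbasis L, w <- vbasis L]>>%VS.

End ExteriorSquare.

(* The Cayley-Dickson algebra of dimension 2^k over F, with all parameters -1.
   For F = R[i] and k = 0, 1, 2, 3 it is the complexification of the reals,
   the complex numbers, the quaternions and the octonions. *)
Fixpoint CD (F : fieldType) (k : nat) : vectType F :=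
  if k is k'.+1 then (CD F k' * CD F k')%type : vectType F
  else F^o : vectType F.

Section CayleyDickson.
Variable F : fieldType.

Fixpoint cdconj (k : nat) : CD F k -> CD F k :=
  if k is k'.+1 return CD F k -> CD F k then
    fun x => (cdconj x.1, - x.2)
  else fun x => x.

Fixpoint cdmul (k : nat) : CD F k -> CD F k -> CD F k :=
  if k is k'.+1 return CD F k -> CD F k -> CD F k then
    fun x y => (cdmul x.1 y.1 - cdmul (cdconj y.2) x.2,
                cdmul y.2 x.1 + cdmul x.2 (cdconj y.1))
  else fun x y => (x : F) * (y : F).

(* The embedding of the scalars, c |-> c 1. *)
Fixpoint cdscal (k : nat) (c : F) : CD F k :=
  if k is k'.+1 return CD F k then (cdscal k' c, 0) else c.

(* The linear form that is the identity on scalars and 0 on elements x with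
   cdconj x = - x. *)
Fixpoint cdre (k : nat) : CD F k -> F :=
  if k is k'.+1 return CD F k -> F then fun x => cdre x.1 else fun x => x.

End CayleyDickson.

(* Hermitian 3 x 3 matrices over CD F k, given by their diagonal (r1, r2, r3)
   and their entries (x1, x2, x3) at positions (2,3), (3,1), (1,2). *)
Definition J3 (F : fieldType) (k : nat) : vectType F :=
  (F^o * F^o * F^o * (CD F k * CD F k * CD F k))%type.

Section Jordan.
Variables (F : fieldType) (k : nat).
Local Notation A := (CD F k).
Local Notation J := (J3 F k).
Local Notation N := (\dim {:J}).

Definition hmx (X : J) : 'M[A]_3 :=
  let: (r1, r2, r3, (x1, x2, x3)) := X in
  \matrix_(i, j) nth 0 (nth [::]
    [:: [:: @cdscal F k r1;     x3;              cdconj x2];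
        [:: cdconj x3;       @cdscal F k r2;     x1];
        [:: x2;              cdconj x1;       @cdscal F k r3]] i) j.

(* The inverse of hmx on Hermitian matrices. *)
Definition of_hmx (M : 'M[A]_3) : J :=
  (cdre (M 0 0), cdre (M 1 1), cdre (M (2 : 'I_3) (2 : 'I_3)),
   (M 1 (2 : 'I_3), M (2 : 'I_3) 0, M 0 1)).

(* [*m] needs a ring of coefficients; A is not associative in general. *)
Definition amulmx (M P : 'M[A]_3) : 'M[A]_3 :=
  \matrix_(i, j) \sum_l cdmul (M i l) (P l j).

Definition jmul (X Y : J) : J :=
  2%:R^-1 *: of_hmx (amulmx (hmx X) (hmx Y) + amulmx (hmx Y) (hmx X)).

Definition jone : J := (1, 1, 1, (0, 0, 0)).

Definition jtr (X : J) : F^o :=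
  let: (r1, r2, r3, _) := X in r1 + r2 + r3.

Arguments jmul : simpl never.
Arguments jtr : simpl never.

(* The bilinear form Q(X, Y), with Q(X) = trace (X^2). *)
Definition jQ (X Y : J) : F := jtr (jmul X Y).

Definition J30 : {vspace J} := lker (linfun jtr).

(* The projection from [I]. *)
Definition jproj (X : J) : J := X - (3%:R^-1 * jtr X) *: jone.

(* so_3(A) and SO_3(A). *)
Definition jder (u : 'End(J)) : Prop :=
  forall X Y, u (jmul X Y) = jmul (u X) Y + jmul X (u Y).

Definition jaut (g : 'End(J)) : Prop :=
  lker g = 0%VS /\ forall X Y, g (jmul X Y) = jmul (g X) (g Y).

Definition severi : set {vspace J} :=
  [set L | \dim L = 1%N /\ {in L, forall X, jmul X X = jtr X *: X}].

(* The affine tangent space, along the line L, to the cone X^2 = trace(X) X. *)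
Definition severi_tangent (L : {vspace J}) : set J :=
  [set Z | {in L, forall X, jmul X Z *+ 2 = jtr X *: Z + jtr Z *: X}].

(* The scheme P(W) \cap X_a is reduced, of dimension 0, at L: its Zariski
   tangent space there, (severi_tangent L \cap W) / L, is zero. *)
Definition simple_contact (W L : {vspace J}) : Prop :=
  forall Z, Z \in W -> severi_tangent L Z -> Z \in L.

Definition simply_3_secant (W : {vspace J}) : Prop :=
  [/\ \dim W = 3%N,
      (exists2 p : 'I_3 -> {vspace J}, injective p &
         [set L | severi L /\ (L <= W)%VS] = range p) &
      (forall L, severi L -> (L <= W)%VS -> simple_contact W L)].

Definition lines : set {vspace J} :=
  [set L | \dim L = 2%N /\ (L <= J30)%VS].

Definition secant_lines : set {vspace J} :=
  [set L : {vspace J} | exists W : {vspace J},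
     [/\ jone \in W, simply_3_secant W & [set` L] = jproj @` [set` W]]].

(* Y_a: the closure is taken in G(2, J_3(A)_0), i.e. after the Pluecker
   embedding [ext2]. *)
Definition reductions : set {vspace J} :=
  [set L | lines L /\ pclosure [set ext2 M | M in secant_lines] (ext2 L)].

(* The closed orbit of codimension 4 (it is unique). *)
Definition reductions4 : set {vspace J} :=
  [set x | exists O : set {vspace J},
     [/\ O x /\ O `<=` reductions,
         O = [set (g @: x)%VS | g in jaut],
         pclosed [set ext2 L | L in O] &
         exists d, has_dim [set ext2 L | L in O] d /\
                   has_dim [set ext2 L | L in reductions] (d + 4)]].

Local Notation e i := ((vbasis {:J})`_(i : 'I_N)).

(* w |-> (u |-> Q(w', u w'')), the linear map whose value at X /\ Y is
   u |-> (Q(X, u Y) - Q(Y, u X)) / 2; this is Q(X, u Y) since derivations are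
   skew for Q. *)
Definition moment (w : 'M[F]_N) (u : 'End(J)) : F :=
  2%:R^-1 * \sum_i \sum_j w i j * jQ (e i) (u (e j)).

Definition Ua : set 'M[F]_N :=
  [set w | w \in ext2 J30 /\ forall u, jder u -> moment w u = 0].

(* The factor 1/2 makes this the determinant of the values of Q on
   decomposable bivectors: see [wedge_form_wedge]. *)
Definition wedge_form (w z : 'M[F]_N) : F :=
  2%:R^-1 * \sum_i \sum_j \sum_l \sum_m
    w i j * z l m * (jQ (e i) (e l) * jQ (e j) (e m)).

(* H_x, a set of points of P(Ua). *)
Definition polar_hyperplane (x : {vspace J}) : set {vspace 'M[F]_N} :=
  [set p : {vspace 'M[F]_N} | [/\ \dim p = 1%N, [set` p] `<=` Ua &
      {in ext2 x & p, forall z w, wedge_form z w = 0}]].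

End Jordan.

Section CayleyDicksonFacts.
Variable F : fieldType.

Lemma cdconj_linear k : linear (@cdconj F k).
Proof.
by elim: k => [|k IHk] c x y //=; congr pair;
  rewrite ?IHk //= opprD scalerN.
Qed.

Lemma cdmul_linear k : (forall y : CD F k, linear (fun x => cdmul x y)) /\
                       (forall x : CD F k, linear (cdmul x)).
Proof.
elim: k => [|k [IHl IHr]]; first split=> z c x1 x2 /=.
- by rewrite mulrDl -mulrA.
- by rewrite mulrDr mulrCA.
have El y c x1 x2 := IHl y c x1 x2; have Er y c x1 x2 := IHr y c x1 x2.
rewrite /= in El Er.
split=> z c x1 x2 /=; congr pair;
  rewrite ?cdconj_linear !El !Er /= 1?scalerBr 1?scalerDr ?opprD addrACA //.
Qed.

Lemma cdscal_linear k : linear (@cdscal F k : F^o -> CD F k).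
Proof.
by elim: k => [|k IHk] c x y //=; rewrite IHk; congr pair;
  rewrite /= scaler0 addr0.
Qed.

Lemma cdre_linear k : linear (@cdre F k : CD F k -> F^o).
Proof. by elim: k => [|k IHk] c x y //=; rewrite IHk. Qed.

Lemma cdscalK k : cancel (@cdscal F k) (@cdre F k).
Proof. by elim: k. Qed.

Lemma cdconjK k : involutive (@cdconj F k).
Proof. by elim: k => //= k IHk [x y] /=; rewrite IHk opprK. Qed.

Lemma cdconj_scal k c : cdconj (@cdscal F k c) = cdscal k c.
Proof. by elim: k => //= k ->; rewrite oppr0. Qed.


HB.instance Definition _ k :=
  GRing.isLinear.Build F (CD F k) (CD F k) _ (@cdconj F k) (@cdconj_linear k).
HB.instance Definition _ k (x : CD F k) :=
  GRing.isLinear.Build F (CD F k) (CD F k) _ (cdmul x) ((@cdmul_linear k).2 x).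
HB.instance Definition _ k :=
  GRing.isLinear.Build F F^o (CD F k) _ (@cdscal F k) (@cdscal_linear k).
HB.instance Definition _ k :=
  GRing.isLinear.Build F (CD F k) F^o _ (@cdre F k) (@cdre_linear k).

Lemma cdmulDl k (x y z : CD F k) : cdmul (x + y) z = cdmul x z + cdmul y z.
Proof. by have := (cdmul_linear k).1 z 1 x y; rewrite !scale1r. Qed.

Lemma cdmulZl k c (x z : CD F k) : cdmul (c *: x) z = c *: cdmul x z.
Proof.
have H0 : cdmul 0 z = 0.
  by apply: (addrI (cdmul 0 z)); rewrite -cdmulDl !addr0.
by have := (cdmul_linear k).1 z c x 0; rewrite addr0 H0 addr0.
Qed.

Lemma cdmulNl k (x z : CD F k) : cdmul (- x) z = - cdmul x z.
Proof. by rewrite -scaleN1r cdmulZl scaleN1r. Qed.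

Lemma cdconjM k (x y : CD F k) :
  cdconj (cdmul x y) = cdmul (cdconj y) (cdconj x).
Proof.
elim: k x y => [|k IHk] x y /=; first by rewrite mulrC.
rewrite !raddfB /= !IHk !cdconjK !raddfN /= !cdmulNl raddfN opprK.
by congr pair; rewrite opprD addrC.
Qed.

Lemma cdre_conj_id k (x : CD F k) :
  2%:R != 0 :> F -> cdconj x = x -> cdscal k (cdre x) = x.
Proof.
move=> nz2; elim: k x => //= k IHk [x y] /= [cx cy]; rewrite IHk //.
congr pair; have: 2%:R *: y = 0 by rewrite scaler_nat mulr2n -{1}cy addNr.
by move/eqP; rewrite scaler_eq0 (negbTE nz2) => /eqP.
Qed.

Lemma dim_CD k : \dim {:CD F k} = (2 ^ k)%N.
Proof.
by rewrite dimvf; elim: k => //= k IHk; rewrite /dim /= IHk expnS mul2n addnn.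
Qed.

Lemma dim_J3 k : \dim {:J3 F k} = (3 * 2 ^ k + 3)%N.
Proof.
have := dim_CD k; rewrite !dimvf => <-.
rewrite mulSn mulSn mul1n addnA addnC; reflexivity.
Qed.

End CayleyDicksonFacts.

Section JordanFacts.
Variables (F : fieldType) (k : nat).
Local Notation A := (CD F k).
Local Notation J := (J3 F k).

Definition is_hermitian (M : 'M[A]_3) := forall i j, cdconj (M j i) = M i j.

Let ord3P (P : 'I_3 -> Prop) : P 0 -> P 1 -> P 2%:R -> forall i, P i.
Proof.
move=> P0 P1 P2; case=> [[|[|[|//]]] lti].
- by have -> : Ordinal lti = 0 by apply: val_inj.
- by have -> : Ordinal lti = 1 by apply: val_inj.
- by have -> : Ordinal lti = 2%:R by apply: val_inj.
Qed.

Lemma hmx_hermitian (X : J) : is_hermitian (hmx X).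
Proof.
case: X => [[[r1 r2] r3] [[x1 x2] x3]] i j; rewrite !mxE.
by move: i j; do 2!apply: ord3P; rewrite /= ?cdconj_scal ?cdconjK.
Qed.

Lemma of_hmxK (M : 'M[A]_3) :
  2%:R != 0 :> F -> is_hermitian M -> hmx (of_hmx M) = M.
Proof.
move=> nz2 hM; apply/matrixP=> i j; rewrite !mxE.
by move: i j; do 2!apply: ord3P; rewrite /= ?cdre_conj_id ?hM.
Qed.

Lemma hmxK (X : J) : of_hmx (hmx X) = X.
Proof.
by case: X => [[[r1 r2] r3] [[x1 x2] x3]]; rewrite /of_hmx !mxE /= !cdscalK.
Qed.

Lemma hmx_linear (X Y : J) c i j :
  hmx (c *: X + Y) i j = c *: hmx X i j + hmx Y i j.
Proof.
case: X Y => [[[r1 r2] r3] [[x1 x2] x3]] [[[s1 s2] s3] [[y1 y2] y3]].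
rewrite !mxE /=.
move: i j; do 2!apply: ord3P; rewrite /= ?linearP //; exact: cdscal_linear.
Qed.

Lemma of_hmx_linear c (M P : 'M[A]_3) :
  of_hmx (\matrix_(i, j) (c *: M i j + P i j)) = c *: of_hmx M + of_hmx P.
Proof. by rewrite /of_hmx !mxE !cdre_linear. Qed.

Lemma conj_amulmx (X Y : J) i j :
  cdconj (amulmx (hmx X) (hmx Y) j i) = amulmx (hmx Y) (hmx X) i j.
Proof.
rewrite !mxE raddf_sum; apply: eq_bigr => l _.
by rewrite /= cdconjM !hmx_hermitian.
Qed.

(* [jmul] is indeed (XY + YX)/2. *)
Lemma hmx_jmul (X Y : J) i j : 2%:R != 0 :> F ->
  hmx (jmul X Y) i j = 2%:R^-1 *: (amulmx (hmx X) (hmx Y) +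
                                   amulmx (hmx Y) (hmx X)) i j.
Proof.
move=> nz2; rewrite /jmul -[X in hmx X]addr0 hmx_linear.
have -> : hmx (0 : J) i j = 0.
  by have := hmx_linear 0 0 (-1) i j; rewrite scaler0 addr0 scaleN1r addNr.
rewrite addr0 of_hmxK // => {}i {}j.
by rewrite [in LHS]mxE [RHS]mxE raddfD addrC /= !conj_amulmx.
Qed.

Lemma jmulC (X Y : J) : jmul X Y = jmul Y X.
Proof. by rewrite /jmul addrC. Qed.

Lemma jmul_linear (X : J) : linear (jmul X).
Proof.
move=> c Y Z; rewrite /jmul scalerA mulrC -scalerA -scalerDr -of_hmx_linear.
congr (_ *: of_hmx _); apply/matrixP => i j; rewrite !mxE.
rewrite -!big_split /= scaler_sumr -big_split /=; apply: eq_bigr => l _.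
rewrite !hmx_linear linearP cdmulDl cdmulZl scalerDr /=.
by rewrite addrACA.
Qed.

Lemma jtr_linear : linear (@jtr F k).
Proof.
move=> c [[[r1 r2] r3] x] [[[s1 s2] s3] y]; rewrite /jtr /=.
rewrite !scalerDr.
by rewrite (addrACA (c *: r1) s1) (addrACA (_ + _) (s1 + s2)).
Qed.

HB.instance Definition _ (X : J) :=
  GRing.isLinear.Build F J J _ (jmul X) (jmul_linear X).
HB.instance Definition _ :=
  GRing.isLinear.Build F J F^o _ (@jtr F k) jtr_linear.

Lemma memJ30 (X : J) : (X \in J30 F k) = (jtr X == 0).
Proof. by rewrite memv_ker lfunE. Qed.

Lemma jQC (X Y : J) : jQ X Y = jQ Y X.
Proof. by rewrite /jQ jmulC. Qed.

Local Notation e i := ((vbasis {:J})`_i).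

Lemma jQ_sumr (X : J) n (c : 'I_n -> F) (v : 'I_n -> J) :
  jQ X (\sum_i c i *: v i) = \sum_i c i * jQ X (v i).
Proof.
rewrite /jQ; have -> : jmul X (\sum_i c i *: v i) = \sum_i c i *: jmul X (v i).
  by rewrite linear_sum; apply: eq_bigr => i _; exact: linearZ_LR.
by rewrite linear_sum; apply: eq_bigr => i _; exact: linearZ_LR.
Qed.

Lemma jQ_coords (X Y : J) :
  jQ X Y = \sum_i \sum_l coords X 0 i * coords Y 0 l * jQ (e i) (e l).
Proof.
rewrite {1}(coord_vbasis (memvf X)) {1}(coord_vbasis (memvf Y)).
rewrite jQC jQ_sumr; apply: eq_bigr => i _.
rewrite jQC jQ_sumr mulr_sumr; apply: eq_bigr => l _.
by rewrite !mxE mulrA.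
Qed.

Lemma wedge_form_wedge (X Y Z T : J) : 2%:R != 0 :> F ->
  wedge_form (wedge X Y) (wedge Z T) = jQ X Z * jQ Y T - jQ X T * jQ Y Z.
Proof.
move=> nz2; have E (a b c d : J) :
    \sum_i \sum_j \sum_l \sum_m coords a 0 i * coords b 0 j *
      (coords c 0 l * coords d 0 m) * (jQ (e i) (e l) * jQ (e j) (e m)) =
    jQ a c * jQ b d.
  rewrite (jQ_coords a c) (jQ_coords b d) mulr_suml; apply: eq_bigr => i _.
  rewrite mulr_sumr; apply: eq_bigr => j _.
  rewrite mulr_suml; apply: eq_bigr => l _.
  rewrite mulr_sumr; apply: eq_bigr => m _.
  by ring.
apply: (mulfI nz2); rewrite /wedge_form mulrA mulfV // mul1r.
have -> : 2%:R * (jQ X Z * jQ Y T - jQ X T * jQ Y Z) =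
    jQ X Z * jQ Y T - jQ X T * jQ Y Z - jQ Y Z * jQ X T + jQ Y T * jQ X Z.
  by ring.
rewrite -!E.
do 4!(rewrite -?sumrN -?big_split /=; apply: eq_bigr => ? _).
rewrite !mxE !big_ord1 !mxE; ring.
Qed.
End JordanFacts.

Section ExteriorFacts.
Variables (F : fieldType) (V : vectType F).

Lemma coords_linear : linear (@coords F V).
Proof. by move=> c v w; apply/rowP=> i; rewrite !mxE linearP. Qed.

HB.instance Definition _ :=
  GRing.isLinear.Build F V 'rV[F]_(\dim {:V}) _ (@coords F V) coords_linear.

Lemma wedge_linear (v : V) : linear (wedge v).
Proof.
move=> c w1 w2; apply/matrixP=> i j; rewrite /wedge coords_linear.
by rewrite !(mxE, big_ord1); ring.
Qed.

HB.instance Definition _ (v : V) :=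
  GRing.isLinear.Build F V 'M[F]_(\dim {:V}) _ (wedge v) (wedge_linear v).

Lemma wedgeC (v w : V) : wedge v w = - wedge w v.
Proof. by rewrite /wedge opprB. Qed.

Lemma wedgevv (v : V) : wedge v v = 0.
Proof. by rewrite /wedge subrr. Qed.

Lemma wedge_ext2 (L : {vspace V}) v w :
  v \in L -> w \in L -> wedge v w \in ext2 L.
Proof.
move=> vL wL; rewrite (coord_vbasis wL) linear_sum; apply: memv_suml => j _.
rewrite linearZ memvZ //= wedgeC memvN.
rewrite (coord_vbasis vL) linear_sum; apply: memv_suml => i _.
rewrite linearZ memvZ //= wedgeC memvN memv_span //.
by apply/allpairsP; exists ((vbasis L)`_i, (vbasis L)`_j);
   rewrite !mem_nth ?size_tuple.
Qed.

Lemma ext2_line (v w : V) : ext2 (<[v]> + <[w]>)%VS = <[wedge v w]>%VS.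
Proof.
apply/eqP; rewrite eqEsubv; apply/andP; split.
  apply/span_subvP => _ /allpairsP[[x y] /= [/vbasis_mem xL /vbasis_mem yL ->]].
  have /memv_addP[_ /vlineP[a ->] [_ /vlineP[b ->] ->]] := xL.
  have /memv_addP[_ /vlineP[c ->] [_ /vlineP[d ->] ->]] := yL.
  have -> : wedge (a *: v + b *: w) (c *: v + d *: w) =
      (a * d - b * c) *: wedge v w.
    apply/matrixP=> i j; rewrite /wedge !coords_linear !linearZ /=.
    by rewrite !(mxE, big_ord1); ring.
  by rewrite memvZ ?memv_line.
rewrite -memvE wedge_ext2 //.
  by rewrite (subvP (addvSl _ _) v) ?memv_line.
by rewrite (subvP (addvSr _ _) w) ?memv_line.
Qed.

End ExteriorFacts.

(* Main.v *)
(* Fix complementary isotropic idempotents e, e' of the composition algebra.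
   Let l0 be the line spanned by e at (1,2) and e' at (3,1).  If a translate of x
   is not orthogonal to l0, then a one-parameter torus contracts it to a translate
   of l0, which thus lies in the closed orbit.  Such a translate exists: since
   [L_B, L_C] = 0 for a line <B, C> of Y_a, applying root automorphisms to the
   orthogonality relations shows that B /\ C = 0 if they all hold.  Hence x may be
   taken to be l0.

   A line of Y_a off the polar hyperplane of l0 has a unique basis (X, Y) in
   which the two entries paired with l0 form an identity matrix.  Unipotent
   automorphisms translate six of the components of (X, Y) in the off-diagonal
   Peirce spaces of e, which have dimension a/2 - 1, so that these can be made
   zero by a polynomial change of coordinates.  Commutation of L_X and L_Y then
   forces X and Y to come from two commuting 3 x 3 matrices with first columns
   (0,1,0) and (0,0,1), up to scalars.  Such a pair is polynomial in its six
   remaining parameters, and it does lie on Y_a: for a matrix with three distinct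
   eigenvalues the Lagrange idempotents span a 3-secant plane, and the other
   pairs are limits of these.  In all there are 6 (a/2 - 1) + 6 = 3a parameters. *)

(* [reductions] is given only as a closure, so the properties of its lines that are used,
   commutation of the multiplications and vanishing of the moment, are written as linear equations
   in the bivector and checked on secant lines alone. For this the secant planes are made explicit:
   they are spanned by three orthogonal idempotents of trace 1 with sum I, and the commutation of
   their multiplications comes out of the Cayley-Hamilton identity.

   Identities in the algebra are proved by pairing both sides with an arbitrary element and using
   the polarised multiplicativity of the norm. Automorphisms are written entry by entry: triality by
   a unit, and exponentials of nilpotent derivations.

   In the search for a non-orthogonal translate, commutation enters through a trace over an
   orthonormal basis of the algebra. Hence the dimension a appears as a coefficient, and the
   resulting linear systems are regular because a, a - 1 and a + 4 are nonzero. *)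
Require Import Defs.
From HB Require Import structures.
From mathcomp Require Import all_boot all_order all_algebra.
From mathcomp Require Import boolp classical_sets functions reals.
From mathcomp Require Import complex.
From mathcomp Require Import mpoly ring.
Set Implicit Arguments.
Unset Strict Implicit.
Unset Printing Implicit Defensive.

Import Order.TTheory GRing.Theory Num.Theory.
Local Open Scope ring_scope.
Local Open Scope classical_set_scope.

(** * Linear identities in modules *)

(* A reflexive normaliser: both sides are expanded over the atoms in [env] and
   the coefficients are compared by a scalar tactic. *)
Section LinearNormalisation.
Variables (R : comPzRingType) (V : lmodType R).

Inductive lexp :=
  | LVar of nat | LZero | LAdd of lexp & lexp | LOpp of lexp
  | LScale of R & lexp | LMuln of lexp & nat.

Fixpoint leval (env : seq V) e : V :=
  match e with
  | LVar i => nth 0 env i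
  | LZero => 0
  | LAdd a b => leval env a + leval env b
  | LOpp a => - leval env a
  | LScale c a => c *: leval env a
  | LMuln a n => leval env a *+ n
  end.

Fixpoint lcoef (i : nat) e : R :=
  match e with
  | LVar j => if Nat.eqb i j then 1 else 0
  | LZero => 0
  | LAdd a b => lcoef i a + lcoef i b
  | LOpp a => - lcoef i a
  | LScale c a => c * lcoef i a
  | LMuln a n => lcoef i a *+ n
  end.

Lemma leval_sum env e :
  leval env e = \sum_(i < size env) lcoef i e *: nth 0 env i.
Proof.
elim: e => /= [j||a -> b ->|a ->|c a ->|a -> n].
- have E i : Nat.eqb i j = (i == j).
    by apply/idP/eqP => [/PeanoNat.Nat.eqb_eq|/PeanoNat.Nat.eqb_eq].
  under eq_bigr do rewrite E.
  case: (ltnP j (size env)) => lj.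
    rewrite (bigD1 (Ordinal lj)) //= eqxx scale1r big1 ?addr0 // => i ni.
    by rewrite -val_eqE /= in ni; rewrite (negbTE ni) scale0r.
  rewrite nth_default // big1 // => i _.
  have -> : (i == j :> nat) = false by rewrite ltn_eqF // (leq_trans _ lj).
  by rewrite scale0r.
- by rewrite big1 // => i _; rewrite scale0r.
- by rewrite -big_split; apply: eq_bigr => i _; rewrite scalerDl.
- by rewrite -sumrN; apply: eq_bigr => i _; rewrite scaleNr.
- by rewrite scaler_sumr; apply: eq_bigr => i _; rewrite scalerA.
- by rewrite -sumrMnl; apply: eq_bigr => i _; rewrite scalerMnl.
Qed.

Fixpoint lall n e1 e2 : Prop :=
  if n is m.+1 then lcoef m e1 = lcoef m e2 /\ lall m e1 e2 else True.

Lemma lmoduleP env e1 e2 :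
  lall (size env) e1 e2 -> leval env e1 = leval env e2.
Proof.
rewrite !leval_sum => H; apply: eq_bigr => i _; congr (_ *: _).
move: (nat_of_ord i) (ltn_ord i) => {i}.
elim: (size env) H => // n IHn [H0 H1] j.
by rewrite ltnS leq_eqVlt => /orP[/eqP -> //|]; apply: IHn.
Qed.

(** The way a hypothesis enters a linear computation: [c] is the multiplier of a certificate, and
    what remains is an identity without hypotheses, left to the normaliser. [lincomb1] and
    [lincomb2] do the same for scalars, with [ring] or [field]. *)
Lemma eq_from (c : R) (a b u v : V) : a = b -> u - v = c *: (a - b) -> u = v.
Proof. by move=> ->; rewrite subrr scaler0 => /subr0_eq. Qed.

End LinearNormalisation.

Lemma lincomb1 (R : comPzRingType) (c a b x y : R) :
  a = b -> x - y = c * (a - b) -> x = y.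
Proof. by move=> ->; rewrite subrr mulr0 => /subr0_eq. Qed.
Lemma lincomb2 (R : comPzRingType) (c a b d a' b' x y : R) :
  a = b -> a' = b' -> x - y = c * (a - b) + d * (a' - b') -> x = y.
Proof. by move=> -> ->; rewrite !subrr !mulr0 addr0 => /subr0_eq. Qed.

Ltac lenv_add x env :=
  let rec mem l :=
    lazymatch l with
    | nil => constr:(false)
    | cons x _ => constr:(true)
    | cons _ ?l' => mem l'
    end in
  lazymatch mem env with true => env | false => constr:(cons x env) end.

Ltac latoms t env :=
  lazymatch t with
  | (?a + ?b)%R => let e := latoms a env in latoms b e
  | (- ?a)%R => latoms a env
  | (_ *: ?a)%R => latoms a env
  | (?a *+ _)%R => latoms a env
  | 0%R => env
  | _ => lenv_add t env
  end.

Ltac lindex x env :=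
  lazymatch env with
  | cons x _ => constr:(O)
  | cons _ ?l => let n := lindex x l in constr:(S n)
  end.

Ltac lreify R t env :=
  lazymatch t with
  | (?a + ?b)%R =>
    let x := lreify R a env in let y := lreify R b env in constr:(@LAdd R x y)
  | (- ?a)%R => let x := lreify R a env in constr:(@LOpp R x)
  | (?c *: ?a)%R => let x := lreify R a env in constr:(@LScale R c x)
  | (?a *+ ?n)%R => let x := lreify R a env in constr:(@LMuln R x n)
  | 0%R => constr:(@LZero R)
  | _ => let i := lindex t env in constr:(@LVar R i)
  end.

Ltac lmodule_over R V tac :=
  lazymatch goal with
  | |- @eq ?T ?s ?t =>
    let e := latoms s constr:(@nil T) in
    let e := latoms t e in
    let x := lreify R s e in
    let y := lreify R t e in
    refine (@lmoduleP R V e x y _);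
    cbv [lall lcoef Nat.eqb size]; repeat split; tac
  end.

(** * Cayley-Dickson algebras *)

Ltac cdmodule_with tac :=
  lazymatch goal with
  | |- context [CD ?F ?k] => lmodule_over F (CD F k) tac
  end.
Ltac cdmodule := cdmodule_with ltac:(ring).

Declare Scope cd_scope.
Delimit Scope cd_scope with cd.
Notation "x ** y" := (cdmul x y) (at level 40, left associativity) : cd_scope.
Notation cj := (@cdconj _ _).
Local Open Scope cd_scope.

Definition cddot (F : fieldType) k (x y : CD F k) : F := cdre (x ** cj y).
Definition cdq (F : fieldType) k (x : CD F k) : F := cddot x x.
Notation cd1 := (cdscal _ 1).

Section CayleyDicksonTheory.
Variable F : fieldType.
Implicit Type k : nat.

Lemma cdmulBl k (x y z : CD F k) : (x - y) ** z = x ** z - y ** z.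
Proof. by rewrite cdmulDl cdmulNl. Qed.
Lemma cdmul0l k (z : CD F k) : 0 ** z = 0.
Proof. by have := cdmulZl 0 0 z; rewrite !scale0r. Qed.
Lemma cdmulDr k (z x y : CD F k) : z ** (x + y) = z ** x + z ** y.
Proof. exact: linearD. Qed.
Lemma cdmulBr k (z x y : CD F k) : z ** (x - y) = z ** x - z ** y.
Proof. exact: linearB. Qed.
Lemma cdmulNr k (z x : CD F k) : z ** (- x) = - (z ** x).
Proof. exact: linearN. Qed.
Lemma cdmulZr k c (z x : CD F k) : z ** (c *: x) = c *: (z ** x).
Proof. exact: linearZ_LR. Qed.
Lemma cdmul0r k (z : CD F k) : z ** 0 = 0.
Proof. exact: linear0. Qed.

Lemma cdconjD k (x y : CD F k) : cj (x + y) = cj x + cj y.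
Proof. exact: linearD. Qed.
Lemma cdconjB k (x y : CD F k) : cj (x - y) = cj x - cj y.
Proof. exact: linearB. Qed.
Lemma cdconjN k (x : CD F k) : cj (- x) = - cj x.
Proof. exact: linearN. Qed.
Lemma cdconjZ k c (x : CD F k) : cj (c *: x) = c *: cj x.
Proof. exact: linearZ_LR. Qed.
Lemma cdconj0 k : cj (0 : CD F k) = 0.
Proof. exact: linear0. Qed.

Lemma cdreD k (x y : CD F k) : cdre (x + y) = cdre x + cdre y.
Proof. exact: linearD. Qed.
Lemma cdreB k (x y : CD F k) : cdre (x - y) = cdre x - cdre y.
Proof. exact: linearB. Qed.
Lemma cdreN k (x : CD F k) : cdre (- x) = - cdre x.
Proof. exact: linearN. Qed.
Lemma cdreZ k c (x : CD F k) : cdre (c *: x) = c * cdre x.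
Proof. exact: linearZ_LR. Qed.
Lemma cdre0 k : cdre (0 : CD F k) = 0.
Proof. exact: linear0. Qed.

Lemma cdre_conj k (x : CD F k) : cdre (cj x) = cdre x.
Proof. by elim: k x => //= k IHk x; rewrite IHk. Qed.

Lemma cdmul_scal k c (x : CD F k) :
  cdscal k c ** x = c *: x /\ x ** cdscal k c = c *: x.
Proof.
elim: k c x => [|k IHk] c; first by move=> x /=; split => //; exact: mulrC.
move=> [x y] /=; rewrite cdconj0 cdmul0l cdmul0r cdmul0l cdconj_scal.
by rewrite cdmul0l !(proj1 (IHk _ _)) !(proj2 (IHk _ _)) !subr0 ?add0r ?addr0.
Qed.

Lemma cdmul1l k (x : CD F k) : cd1 ** x = x.
Proof. by rewrite (proj1 (cdmul_scal _ _)) scale1r. Qed.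
Lemma cdmul1r k (x : CD F k) : x ** cd1 = x.
Proof. by rewrite (proj2 (cdmul_scal _ _)) scale1r. Qed.
Lemma cdscalE k c : cdscal k c = c *: (cd1 : CD F k).
Proof. by rewrite -[in LHS](cdmul1r (cdscal k c)) (proj1 (cdmul_scal _ _)). Qed.
Lemma cdre1 k : cdre (cd1 : CD F k) = 1.
Proof. exact: cdscalK. Qed.
Lemma cdconj1 k : cj (cd1 : CD F k) = cd1.
Proof. exact: cdconj_scal. Qed.

Lemma cdre_mulC k (x y : CD F k) : cdre (x ** y) = cdre (y ** x).
Proof.
elim: k x y => [|k IHk] x y /=; first exact: mulrC.
rewrite !cdreB IHk -(cdre_conj (cj y.2 ** x.2)) cdconjM cdconjK.
by rewrite (IHk (cj x.2)).
Qed.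

(** The trace form is associative at every level of the doubling, although the product is not.
    Together with [cdre_mulC] it lets a triple product under [cdre] be rebracketed and cycled. *)
Lemma cdre_mulA k (x y z : CD F k) : cdre (x ** (y ** z)) = cdre (x ** y ** z).
Proof.
elim: k x y z => [|k IHk] x y z /=; first by rewrite mulrA.
rewrite !cdmulBr !cdmulBl !cdmulDr cdconjD !cdmulDl !cdconjM !cdconjK.
rewrite !(cdreB, cdreD) IHk.
have cyc (a b c : CD F k) : cdre (a ** (b ** c)) = cdre (b ** (c ** a)).
  by rewrite cdre_mulC IHk.
rewrite (cyc x.1) (cyc (cj z.2) x.2) (cdre_mulC (cj y.1 ** cj z.2)).
rewrite (cdre_mulC (z.1 ** cj y.2)) (cdre_mulC (cj y.2 ** x.2)) (cyc z.1).
by rewrite (cyc (cj y.2)); ring.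
Qed.

Lemma cddotC k (x y : CD F k) : cddot x y = cddot y x.
Proof. by rewrite /cddot -cdre_conj cdconjM cdconjK. Qed.
Lemma cddotDr k (x y z : CD F k) : cddot x (y + z) = cddot x y + cddot x z.
Proof. by rewrite /cddot cdconjD cdmulDr cdreD. Qed.
Lemma cddotBr k (x y z : CD F k) : cddot x (y - z) = cddot x y - cddot x z.
Proof. by rewrite /cddot cdconjB cdmulBr cdreB. Qed.
Lemma cddotNr k (x y : CD F k) : cddot x (- y) = - cddot x y.
Proof. by rewrite /cddot cdconjN cdmulNr cdreN. Qed.
Lemma cddotZr k c (x y : CD F k) : cddot x (c *: y) = c * cddot x y.
Proof. by rewrite /cddot cdconjZ cdmulZr cdreZ. Qed.
Lemma cddot0r k (x : CD F k) : cddot x 0 = 0.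
Proof. by rewrite /cddot cdconj0 cdmul0r cdre0. Qed.
Lemma cddotDl k (x y z : CD F k) : cddot (x + y) z = cddot x z + cddot y z.
Proof. by rewrite !(cddotC _ z) cddotDr. Qed.
Lemma cddotBl k (x y z : CD F k) : cddot (x - y) z = cddot x z - cddot y z.
Proof. by rewrite !(cddotC _ z) cddotBr. Qed.
Lemma cddotNl k (x z : CD F k) : cddot (- x) z = - cddot x z.
Proof. by rewrite !(cddotC _ z) cddotNr. Qed.
Lemma cddotZl k c (x z : CD F k) : cddot (c *: x) z = c * cddot x z.
Proof. by rewrite !(cddotC _ z) cddotZr. Qed.
Lemma cddot0l k (x : CD F k) : cddot 0 x = 0.
Proof. by rewrite cddotC cddot0r. Qed.
Lemma cddot_conj k (x y : CD F k) : cddot (cj x) (cj y) = cddot x y.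
Proof. by rewrite /cddot cdconjK cdre_mulC -/(cddot y x) cddotC. Qed.
Lemma cddotJr k (x y : CD F k) : cddot x (cj y) = cddot (cj x) y.
Proof. by rewrite -{1}[x]cdconjK cddot_conj. Qed.
Lemma cddot1r k (x : CD F k) : cddot x cd1 = cdre x.
Proof. by rewrite /cddot cdconj1 cdmul1r. Qed.
Lemma cddot1l k (x : CD F k) : cddot cd1 x = cdre x.
Proof. by rewrite cddotC cddot1r. Qed.
Lemma cdre_mul k (x y : CD F k) : cdre (x ** y) = cddot x (cj y).
Proof. by rewrite /cddot cdconjK. Qed.

Lemma cdqD k (x y : CD F k) : cdq (x + y) = cdq x + cdq y + 2%:R * cddot x y.
Proof. by rewrite /cdq !(cddotDl, cddotDr) (cddotC y x); ring. Qed.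
Lemma cdqN k (x : CD F k) : cdq (- x) = cdq x.
Proof. by rewrite /cdq cddotNl cddotNr opprK. Qed.
Lemma cdqB k (x y : CD F k) : cdq (x - y) = cdq x + cdq y - 2%:R * cddot x y.
Proof. by rewrite cdqD cdqN cddotNr mulrN. Qed.
Lemma cdqZ k c (x : CD F k) : cdq (c *: x) = c ^+ 2 * cdq x.
Proof. by rewrite /cdq cddotZl cddotZr; ring. Qed.
Lemma cdq_conj k (x : CD F k) : cdq (cj x) = cdq x.
Proof. exact: cddot_conj. Qed.
Lemma cdq1 k : cdq (cd1 : CD F k) = 1.
Proof. by rewrite /cdq cddot1r cdre1. Qed.
Lemma cdq0 k : cdq (0 : CD F k) = 0.
Proof. exact: cddot0l. Qed.

Lemma cddot_mull k (x y z : CD F k) : cddot (x ** y) z = cddot y (cj x ** z).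
Proof.
by rewrite /cddot cdconjM cdconjK cdre_mulA -!(cdre_mulC x) -!cdre_mulA.
Qed.
Lemma cddot_mulr k (x y z : CD F k) : cddot (x ** y) z = cddot x (z ** cj y).
Proof. by rewrite -cddot_conj cdconjM cddot_mull -cddotJr cdconjK cdconjM cdconjK. Qed.
Lemma cddot_trilinear k (x y z : CD F k) :
  cddot (cj (x ** y)) z = cdre (x ** (y ** z)).
Proof. by rewrite -cddotJr -cdre_mul cdre_mulA. Qed.
Lemma cdre_cycle k (x y z : CD F k) :
  cdre (x ** (y ** z)) = cdre (y ** (z ** x)).
Proof. by rewrite cdre_mulC cdre_mulA. Qed.
Lemma cddot_pair k (x y : CD F k.+1) :
  cddot x y = cddot x.1 y.1 + cddot x.2 y.2.
Proof.
rewrite /cddot /= cdconjN cdmulNl opprK cdreD; congr (_ + _).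
by rewrite cdre_mulC.
Qed.

Lemma cddot_nondeg k (x : CD F k) : (forall y, cddot x y = 0) -> x = 0.
Proof.
elim: k x => [|k IHk] x H; first by have := H 1; rewrite /cddot /= mulr1.
rewrite [x]surjective_pairing; congr pair; apply: IHk => y.
  by have := H (y, 0); rewrite cddot_pair /= cddot0r addr0.
by have := H (0, y); rewrite cddot_pair /= cddot0r add0r.
Qed.

Lemma cddot_inj k (x y : CD F k) : (forall z, cddot x z = cddot y z) -> x = y.
Proof.
by move=> H; apply/subr0_eq/cddot_nondeg => z; rewrite cddotBl H subrr.
Qed.

Lemma cdconjE k (x : CD F k) : cj x = (2%:R * cdre x) *: cd1 - x.
Proof.
elim: k x => [|k IHk] x /=; first by rewrite /GRing.scale /= mulr1; ring.
by congr pair; rewrite ?IHk //= scaler0 sub0r.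
Qed.

Lemma cdmul_conj k (x : CD F k) : x ** cj x = cdq x *: cd1.
Proof.
elim: k x => [|k IHk] x /=; first by rewrite /GRing.scale /= mulr1.
rewrite cdconjK cdconjN cdmulNl cdmulNl opprK addNr.
rewrite IHk -{2}[x.2]cdconjK IHk cdq_conj -scalerDl /cdq cddot_pair.
by congr pair; rewrite /= scaler0.
Qed.

Lemma cdconj_mul k (x : CD F k) : cj x ** x = cdq x *: cd1.
Proof. by rewrite -{2}[x]cdconjK cdmul_conj cdq_conj. Qed.

Lemma cdmulC k (x y : CD F k) : (k <= 1)%N -> x ** y = y ** x.
Proof.
case: k x y => [|[|k]] x y //= _; first exact: mulrC.
rewrite (mulrC x.1) (mulrC y.2 x.2).
by congr pair; rewrite addrC.
Qed.

(** Doubling a commutative associative algebra gives an associative one; commutativity one level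
    below, in the form of [Ca] and [Lc], brings both sides to the same monomials. *)
Lemma cdmulA k (x y z : CD F k) : (k <= 2)%N -> x ** (y ** z) = x ** y ** z.
Proof.
elim: k x y z => [|k IHk] x y z k2; first exact: mulrA.
have Ca (a b : CD F k) : a ** b = b ** a by apply: cdmulC.
have As (a b c : CD F k) : a ** (b ** c) = a ** b ** c.
  by apply: IHk; exact: ltnW.
have Lc (a b c : CD F k) : a ** (b ** c) = b ** (a ** c).
  by rewrite !As (Ca a).
rewrite /= ?(cdconjD, cdconjB) !(cdmulBr, cdmulBl, cdmulDl, cdmulDr).
rewrite !(cdconjN, cdmulNr, cdmulNl, cdconjM, cdconjK) -!As; congr pair.
  rewrite (Ca x.2 z.1) (Lc (cj y.2)) (Ca y.2 x.1) (Lc (cj z.2) x.1).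
  rewrite (Ca x.2 (cj y.1)) (Lc (cj z.2) (cj y.1)).
  by cdmodule.
rewrite (Ca x.1 y.1) (Ca x.1 (cj z.1)) (Ca (cj y.1) (cj z.1)).
by rewrite (Lc x.2 (cj y.2)) (Lc z.2 (cj y.2)) (Ca x.2 z.2); cdmodule.
Qed.

(* The Cayley-Dickson double of an associative algebra is alternative. *)
Lemma cdconj_mulKl k (x y : CD F k) : (k <= 3)%N ->
  cj x ** (x ** y) = cdq x *: y.
Proof.
case: k x y => [|k] x y k3.
  by rewrite /= mulrA; congr (_ * _); rewrite /cdq /cddot.
have As (a b c : CD F k) : a ** (b ** c) = a ** b ** c by apply: cdmulA.
rewrite /cdq cddot_pair; case: x y => [x1 x2] [y1 y2].
rewrite /= !(cdconjM, cdconjD, cdconjB, cdconjK, cdconjN).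
rewrite !(cdmulBr, cdmulBl, cdmulDl, cdmulDr, cdmulNl, cdmulNr).
rewrite !As cdconj_mul -!As cdconj_mul.
rewrite !(cdconj_mul, cdmul_conj, cdmulZr, cdmulZl, cdmul1l, cdmul1r, As).
rewrite -/(cdq x1) -/(cdq x2); congr pair => /=; first by cdmodule.
by rewrite -(As y2) cdmul_conj cdmulZr cdmul1r; cdmodule.
Qed.

End CayleyDicksonTheory.

(** * The exchange law and the Moufang identities *)

Section Alternative.
Variables (F : fieldType) (k : nat).
Hypothesis k3 : (k <= 3)%N.
Local Notation A := (CD F k).
Implicit Types a b c d x y z : A.

Lemma cdmulKl x y : cj x ** (x ** y) = cdq x *: y.
Proof. exact: cdconj_mulKl. Qed.
Lemma cdmulVl x y : x ** (cj x ** y) = cdq x *: y.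
Proof. by rewrite -{1}[x]cdconjK cdmulKl cdq_conj. Qed.
Lemma cdmulKr x y : y ** x ** cj x = cdq x *: y.
Proof.
by apply: (can_inj (@cdconjK F k)); rewrite !cdconjM cdconjK cdmulVl cdconjZ.
Qed.
Lemma cdmulVr x y : y ** cj x ** x = cdq x *: y.
Proof. by rewrite -{2}[x]cdconjK cdmulKr cdq_conj. Qed.

Lemma cdmul_lin x z y :
  cj x ** (z ** y) + cj z ** (x ** y) = (2%:R * cddot x z) *: y.
Proof.
have := cdmulKl (x + z) y.
rewrite cdconjD !(cdmulDl, cdmulDr, cdmulKl) cdqD => H.
by apply: (eq_from (c := 1) H); cdmodule.
Qed.

(** The multiplicativity of the norm, polarised in both factors. Up to dimension 8 it takes over the
    role of associativity. *)
Lemma cddot_exch a b c d :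
  cddot (a ** b) (c ** d) + cddot (c ** b) (a ** d) =
  2%:R * cddot a c * cddot b d.
Proof.
by rewrite !cddot_mull -cddotDr cdmul_lin cddotZr.
Qed.

Lemma cdqM x y : cdq (x ** y) = cdq x * cdq y.
Proof. by rewrite /cdq cddot_mull cdmulKl cddotZr. Qed.

(* The Moufang identities all follow from [cddot_exch] by pairing with [z]. *)
Lemma moufang_mid a x y : (a ** x) ** (y ** a) = a ** ((x ** y) ** a).
Proof.
apply: cddot_inj => z; rewrite cddot_mull [RHS]cddot_mull.
have := cddot_exch y a (cj (a ** x)) z.
have := cddot_exch (x ** y) a (cj a) z.
rewrite {2}(cdconjM a x) cdmulVr cdconj_mul !cddotZl.
have -> : cddot cd1 (x ** y ** z) = cddot (cj x) (y ** z).
  by rewrite cddot1l -cdre_mulA cdre_mul cddotJr.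
have -> : cddot (x ** y) (cj a) = cddot y (cj (a ** x)).
  by rewrite cddot_mull cdconjM.
by move=> <- /addIr.
Qed.

Lemma moufang_l a x y : (a ** (x ** a)) ** y = a ** (x ** (a ** y)).
Proof.
apply: cddot_inj => z; rewrite cddot_mulr cddot_mull [RHS]cddot_mull.
have := cddot_exch x a (cj a) (z ** cj y).
have := cddot_exch x (a ** y) (cj a) z.
rewrite cdmulKl cdconj_mul !cddotZl.
have -> : cddot cd1 (x ** (z ** cj y)) = cddot y (x ** z).
  by rewrite cddot1l cdre_mulA cddotC.
by rewrite -(cddot_mulr a) => <- /addIr.
Qed.

Lemma cd_flex a x : (a ** x) ** a = a ** (x ** a).
Proof. by have := moufang_mid a x cd1; rewrite cdmul1l cdmul1r. Qed.

Lemma moufang_r a x y : y ** (a ** (x ** a)) = ((y ** a) ** x) ** a.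
Proof.
apply: (can_inj (@cdconjK F k)).
by rewrite -cd_flex !cdconjM moufang_l.
Qed.

Lemma cd_altl x y : x ** (x ** y) = (x ** x) ** y.
Proof. by have := moufang_l x cd1 y; rewrite !cdmul1l. Qed.
Lemma cd_altr x y : y ** x ** x = y ** (x ** x).
Proof. by have := moufang_r x cd1 y; rewrite cdmul1r cdmul1l. Qed.

Lemma cdmul_linr x z y :
  y ** z ** cj x + y ** x ** cj z = (2%:R * cddot x z) *: y.
Proof.
apply: (can_inj (@cdconjK F k)); rewrite cdconjD cdconjZ !cdconjM !cdconjK.
have := cdmul_lin (cj x) (cj z) (cj y); rewrite !cdconjK cddot_conj => <-.
by [].
Qed.

End Alternative.

Definition cd_zero := (mulr0, mul0r, addr0, add0r, subr0, oppr0, scaler0, scale0r,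
  @cddot0l, @cddot0r, @cdmul0l, @cdmul0r, @cdconj0).

(** * The Jordan algebra in coordinates *)

Ltac jmodule_with tac :=
  lazymatch goal with
  | |- context [J3 ?F ?k] => lmodule_over F (J3 F k) tac
  end.
Ltac jmodule := jmodule_with ltac:(ring).

(* Locked, so that the product of the lmodule structures is never unfolded. *)
HB.lock Definition jmk (F : fieldType) k (d1 d2 d3 : F) (x1 x2 x3 : CD F k) :
  J3 F k := (d1, d2, d3, (x1, x2, x3)).

(* Locked, because [jmul] is itself of the form [_ *: _]. *)
HB.lock Definition jm (F : fieldType) k (X Y : J3 F k) : J3 F k := jmul X Y.

Section JordanCoordinates.
Variables (F : numClosedFieldType) (k : nat).
Hypothesis k3 : (k <= 3)%N.
Local Notation A := (CD F k).
Local Notation J := (J3 F k).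
Local Notation jmk := (@jmk F k).
Implicit Types (a b d : F) (x y z : A) (X Y Z : J).

Lemma two_neq0 : 2%:R != 0 :> F. Proof. by rewrite pnatr_eq0. Qed.
Lemma three_neq0 : 3%:R != 0 :> F. Proof. by rewrite pnatr_eq0. Qed.

Variant jmk_spec : J -> Prop :=
  JmkSpec d1 d2 d3 x1 x2 x3 : jmk_spec (jmk d1 d2 d3 x1 x2 x3).
Lemma jmkP X : jmk_spec X.
Proof.
by case: X => [[[d1 d2] d3] [[x1 x2] x3]];
  have := JmkSpec d1 d2 d3 x1 x2 x3; rewrite unlock.
Qed.

Lemma jmkD a1 a2 a3 b1 b2 b3 x1 x2 x3 y1 y2 y3 :
  jmk a1 a2 a3 x1 x2 x3 + jmk b1 b2 b3 y1 y2 y3 =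
  jmk (a1 + b1) (a2 + b2) (a3 + b3) (x1 + y1) (x2 + y2) (x3 + y3).
Proof. by rewrite unlock. Qed.
Lemma jmkB a1 a2 a3 b1 b2 b3 x1 x2 x3 y1 y2 y3 :
  jmk a1 a2 a3 x1 x2 x3 - jmk b1 b2 b3 y1 y2 y3 =
  jmk (a1 - b1) (a2 - b2) (a3 - b3) (x1 - y1) (x2 - y2) (x3 - y3).
Proof. by rewrite unlock. Qed.
Lemma jmkZ c a1 a2 a3 x1 x2 x3 :
  c *: jmk a1 a2 a3 x1 x2 x3 =
  jmk (c * a1) (c * a2) (c * a3) (c *: x1) (c *: x2) (c *: x3).
Proof. by rewrite unlock. Qed.
Lemma jmk0 : 0 = jmk 0 0 0 0 0 0. Proof. by rewrite unlock. Qed.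
Lemma jone_jmk : jone F k = jmk 1 1 1 0 0 0. Proof. by rewrite unlock. Qed.
Lemma jmk_inj a1 a2 a3 b1 b2 b3 x1 x2 x3 y1 y2 y3 :
  jmk a1 a2 a3 x1 x2 x3 = jmk b1 b2 b3 y1 y2 y3 ->
  [/\ a1 = b1, a2 = b2 & a3 = b3] /\ [/\ x1 = y1, x2 = y2 & x3 = y3].
Proof. by rewrite unlock => -[-> -> -> -> -> ->]. Qed.
Lemma jmk_eq a1 a2 a3 b1 b2 b3 x1 x2 x3 y1 y2 y3 :
  a1 = b1 -> a2 = b2 -> a3 = b3 -> x1 = y1 -> x2 = y2 -> x3 = y3 ->
  jmk a1 a2 a3 x1 x2 x3 = jmk b1 b2 b3 y1 y2 y3.
Proof. by move=> -> -> -> -> -> ->. Qed.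
Lemma jtr_jmk a1 a2 a3 x1 x2 x3 : jtr (jmk a1 a2 a3 x1 x2 x3) = a1 + a2 + a3.
Proof. by rewrite unlock. Qed.

Lemma jmul_jmk a1 a2 a3 b1 b2 b3 x1 x2 x3 y1 y2 y3 :
  jmul (jmk a1 a2 a3 x1 x2 x3) (jmk b1 b2 b3 y1 y2 y3) =
  jmk (a1 * b1 + cddot x2 y2 + cddot x3 y3)
      (a2 * b2 + cddot x3 y3 + cddot x1 y1)
      (a3 * b3 + cddot x1 y1 + cddot x2 y2)
      (2%:R^-1 *: ((a2 + a3) *: y1 + (b2 + b3) *: x1 +
                   cj (x2 ** y3) + cj (y2 ** x3)))
      (2%:R^-1 *: ((a3 + a1) *: y2 + (b3 + b1) *: x2 +
                   cj (x3 ** y1) + cj (y3 ** x1)))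
      (2%:R^-1 *: ((a1 + a2) *: y3 + (b1 + b2) *: x3 +
                   cj (x1 ** y2) + cj (y1 ** x2))).
Proof.
rewrite /jmul unlock /of_hmx !mxE !big_ord_recl !big_ord0 !mxE /= !addr0.
rewrite !cdreD !cdre_mul ?cdconjK !cddot_conj.
rewrite !(proj1 (cdmul_scal _ _)) !(proj2 (cdmul_scal _ _)).
rewrite -!(cddotC y1) -!(cddotC y2) -!(cddotC y3).
have S (s t : F) : cddot (cdscal k s) (cj (cdscal k t)) = s * t.
  by rewrite cdconj_scal (cdscalE k s) (cdscalE k t) cddotZl cddotZr [cddot _ _]cdq1 mulr1.
have half (u v : F) : u = v *+ 2 -> 2%:R^-1 * u = v.
  by move=> ->; rewrite -[v *+ 2]mulr_natl mulKf ?two_neq0.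
rewrite !S !cdconjM.
congr (_, _, _, (_, _, _)).
- by apply: half => /=; ring.
- by apply: half => /=; ring.
- by apply: half => /=; ring.
- by rewrite /=; congr (_ *: _); cdmodule.
- by rewrite /=; congr (_ *: _); cdmodule.
- by rewrite /=; congr (_ *: _); cdmodule.
Qed.

Lemma jmE X Y : jm X Y = jmul X Y. Proof. by rewrite unlock. Qed.

Lemma jm_jmk a1 a2 a3 b1 b2 b3 x1 x2 x3 y1 y2 y3 :
  jm (jmk a1 a2 a3 x1 x2 x3) (jmk b1 b2 b3 y1 y2 y3) =
  jmk (a1 * b1 + cddot x2 y2 + cddot x3 y3)
      (a2 * b2 + cddot x3 y3 + cddot x1 y1)
      (a3 * b3 + cddot x1 y1 + cddot x2 y2)
      (2%:R^-1 *: ((a2 + a3) *: y1 + (b2 + b3) *: x1 +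
                   cj (x2 ** y3) + cj (y2 ** x3)))
      (2%:R^-1 *: ((a3 + a1) *: y2 + (b3 + b1) *: x2 +
                   cj (x3 ** y1) + cj (y3 ** x1)))
      (2%:R^-1 *: ((a1 + a2) *: y3 + (b1 + b2) *: x3 +
                   cj (x1 ** y2) + cj (y1 ** x2))).
Proof. by rewrite jmE jmul_jmk. Qed.

Lemma jQE X Y : jQ X Y = jtr (jm X Y). Proof. by rewrite jmE. Qed.

Lemma jmC X Y : jm X Y = jm Y X. Proof. by rewrite !jmE jmulC. Qed.

Lemma jQ_jmk a1 a2 a3 b1 b2 b3 x1 x2 x3 y1 y2 y3 :
  jQ (jmk a1 a2 a3 x1 x2 x3) (jmk b1 b2 b3 y1 y2 y3) =
  a1 * b1 + a2 * b2 + a3 * b3 +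
  2%:R * (cddot x1 y1 + cddot x2 y2 + cddot x3 y3).
Proof. by rewrite jQE jm_jmk jtr_jmk; ring. Qed.

Lemma jQ_nondeg X : (forall Y, jQ X Y = 0) -> X = 0.
Proof.
case: (jmkP X) => d1 d2 d3 x1 x2 x3 H; rewrite jmk0.
have z x : (forall y, 2%:R * cddot x y = 0) -> x = 0.
  move=> Hx; apply: cddot_nondeg => y.
  by have /eqP := Hx y; rewrite mulf_eq0 (negbTE two_neq0) => /eqP.
have simp0 := (cddot0r, mulr0, mulr1, addr0, add0r).
apply: jmk_eq.
- by have := H (jmk 1 0 0 0 0 0); rewrite jQ_jmk !simp0.
- by have := H (jmk 0 1 0 0 0 0); rewrite jQ_jmk !simp0.
- by have := H (jmk 0 0 1 0 0 0); rewrite jQ_jmk !simp0.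
- by apply: z => y; have := H (jmk 0 0 0 y 0 0); rewrite jQ_jmk !simp0.
- by apply: z => y; have := H (jmk 0 0 0 0 y 0); rewrite jQ_jmk !simp0.
- by apply: z => y; have := H (jmk 0 0 0 0 0 y); rewrite jQ_jmk !simp0.
Qed.

Lemma jmDr X Y Z : jm X (Y + Z) = jm X Y + jm X Z.
Proof. by rewrite ?jmE; apply: linearD. Qed.
Lemma jmBr X Y Z : jm X (Y - Z) = jm X Y - jm X Z.
Proof. by rewrite ?jmE; apply: linearB. Qed.
Lemma jmNr X Y : jm X (- Y) = - jm X Y.
Proof. by rewrite ?jmE; apply: linearN. Qed.
Lemma jmZr c X Y : jm X (c *: Y) = c *: jm X Y.
Proof. by rewrite ?jmE; apply: linearZ_LR. Qed.
Lemma jm0r X : jm X 0 = 0. Proof. by rewrite ?jmE; apply: linear0. Qed.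
Lemma jmDl X Y Z : jm (Y + Z) X = jm Y X + jm Z X.
Proof. by rewrite !(jmC _ X) jmDr. Qed.
Lemma jmBl X Y Z : jm (Y - Z) X = jm Y X - jm Z X.
Proof. by rewrite !(jmC _ X) jmBr. Qed.
Lemma jmNl X Y : jm (- Y) X = - jm Y X.
Proof. by rewrite !(jmC _ X) jmNr. Qed.
Lemma jmZl c X Y : jm (c *: Y) X = c *: jm Y X.
Proof. by rewrite !(jmC _ X) jmZr. Qed.
Lemma jm0l X : jm 0 X = 0. Proof. by rewrite jmC jm0r. Qed.
Lemma jtrD X Y : jtr (X + Y) = jtr X + jtr Y. Proof. by rewrite ?jmE; apply: linearD. Qed.
Lemma jtrB X Y : jtr (X - Y) = jtr X - jtr Y. Proof. by rewrite ?jmE; apply: linearB. Qed.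
Lemma jtrN X : jtr (- X) = - jtr X. Proof. by apply: linearN. Qed.
Lemma jtrZ c X : jtr (c *: X) = c * jtr X. Proof. by rewrite ?jmE; apply: linearZ_LR. Qed.
Lemma jtr0 : jtr (0 : J) = 0. Proof. by rewrite ?jmE; apply: linear0. Qed.
Lemma jQDr X Y Z : jQ X (Y + Z) = jQ X Y + jQ X Z.
Proof. by rewrite !jQE jmDr jtrD. Qed.
Lemma jQBr X Y Z : jQ X (Y - Z) = jQ X Y - jQ X Z.
Proof. by rewrite !jQE jmBr jtrB. Qed.
Lemma jQNr X Y : jQ X (- Y) = - jQ X Y.
Proof. by rewrite !jQE jmNr jtrN. Qed.
Lemma jQZr c X Y : jQ X (c *: Y) = c * jQ X Y.
Proof. by rewrite !jQE jmZr jtrZ. Qed.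
Lemma jQDl X Y Z : jQ (Y + Z) X = jQ Y X + jQ Z X.
Proof. by rewrite !(jQC _ X) jQDr. Qed.
Lemma jQBl X Y Z : jQ (Y - Z) X = jQ Y X - jQ Z X.
Proof. by rewrite !(jQC _ X) jQBr. Qed.
Lemma jQNl X Y : jQ (- Y) X = - jQ Y X.
Proof. by rewrite !(jQC _ X) jQNr. Qed.
Lemma jQZl c X Y : jQ (c *: Y) X = c * jQ Y X.
Proof. by rewrite !(jQC _ X) jQZr. Qed.
Lemma jQ0l X : jQ 0 X = 0. Proof. by rewrite !jQE jm0l jtr0. Qed.
Lemma jQ0r X : jQ X 0 = 0. Proof. by rewrite jQC jQ0l. Qed.

Lemma jm1l X : jm (jone F k) X = X.
Proof.
case: (jmkP X) => d1 d2 d3 x1 x2 x3; rewrite jone_jmk jm_jmk.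
apply: jmk_eq; rewrite ?cddot0l ?cdmul0l ?cdmul0r ?cdconj0; try ring;
  by cdmodule_with ltac:(field).
Qed.
Lemma jm1r X : jm X (jone F k) = X. Proof. by rewrite jmC jm1l. Qed.
Lemma jtr1 : jtr (jone F k) = 3%:R. Proof. by rewrite jone_jmk jtr_jmk; ring. Qed.
Lemma jQ1r X : jQ X (jone F k) = jtr X. Proof. by rewrite !jQE jm1r. Qed.

(** Apart from terms with a diagonal entry, both sides consist of real parts of products of one
    first, one second and one third off-diagonal entry. These are invariant under cyclic shifts, and
    the rewriting moves each to a common starting factor. *)
Lemma jQ_mA X Y Z : jQ (jm X Y) Z = jQ X (jm Y Z).
Proof.
case: (jmkP X) => a1 a2 a3 x1 x2 x3; case: (jmkP Y) => b1 b2 b3 y1 y2 y3.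
case: (jmkP Z) => c1 c2 c3 z1 z2 z3; rewrite !jm_jmk !jQ_jmk.
rewrite !(cddotZl, cddotZr, cddotDl, cddotDr).
rewrite !cddot_trilinear !(cddotC _ (cj _)) !cddot_trilinear.
rewrite (cdre_cycle y2 x3) (cdre_cycle y3 x1) (cdre_cycle y1 x2).
rewrite -(cdre_cycle x1 y2 z3) -(cdre_cycle x1 z2 y3).
rewrite -(cdre_cycle x2 y3 z1) -(cdre_cycle x2 z3) -(cdre_cycle x3 y1).
rewrite -(cdre_cycle x3 z1).
by field.
Qed.

(** Cayley-Hamilton. The constant [n] is the determinant; it can stay existential because [rank1_U],
    which uses this identity, eliminates it by taking a trace. *)
Lemma jcubic X : exists n, jm X (jm X X) - jtr X *: jm X X +
  (2%:R^-1 * (jtr X ^+ 2 - jQ X X)) *: X = n *: jone F k.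
Proof.
case: (jmkP X) => a1 a2 a3 x1 x2 x3.
exists (a1 * a2 * a3 - a1 * cdq x1 - a2 * cdq x2 - a3 * cdq x3 +
        2%:R * cdre (x1 ** (x2 ** x3))).
rewrite !jm_jmk jQ_jmk jtr_jmk jone_jmk !jmkZ !jmkB !jmkD.
rewrite !(cddotZl, cddotZr, cddotDl, cddotDr) !(cddotC _ (cj _)).
rewrite !cddot_trilinear !(cdre_cycle x3 x1 x2) -!(cdre_cycle x1 x2 x3).
have bil := (cdmulZr, cdmulZl, cdmulDr, cdmulDl, cdconjD, cdconjZ, cdconjM).
apply: jmk_eq; rewrite ?scaler0 ?bil ?cdconjK ?cdmulKl // ?cdmulKr // /cdq.
- by field.
- by field.
- by field.
- by cdmodule_with ltac:(by field).
- by cdmodule_with ltac:(by field).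
- by cdmodule_with ltac:(by field).
Qed.

End JordanCoordinates.

(** * Frames and secant lines *)

Section Frames.
Variables (F : numClosedFieldType) (k : nat).
Hypothesis k3 : (k <= 3)%N.
Local Notation J := (J3 F k).
Local Notation one := (jone F k).
Implicit Types X Y Z e f g : J.

(* The linearisation at a point of the cone of [jcubic]. *)
Lemma rank1_U X Y : jm X X = jtr X *: X ->
  2%:R *: jm X (jm X Y) = jtr X *: jm X Y + jQ X Y *: X.
Proof.
move=> sX; have [n1 H1] := jcubic k3 (X + Y); have [n2 H2] := jcubic k3 (X - Y).
have [n3 H3] := jcubic k3 Y.
have sQ : jQ X X = jtr X * jtr X by rewrite jQE sX jtrZ.
(* Half the difference of the cubic identities at X + Y and X - Y keeps the terms odd in Y, and
   subtracting the identity at Y leaves those linear in Y. The outcome is a multiple of [one], and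
   the trace shows that the multiple is 0. *)
pose m := 2%:R^-1 * (n1 - n2) - n3.
have E : 2%:R *: jm X (jm X Y) - jtr X *: jm X Y - jQ X Y *: X = m *: one.
  have E0 : 2%:R^-1 *: (n1 *: one - n2 *: one) - n3 *: one = m *: one.
    by rewrite /m; jmodule.
  rewrite -E0 -H1 -H2 -H3 !(jtrD, jtrN, jQDl, jQNl, jQDr, jQNr).
  rewrite !(jmDl, jmNl, jmDr, jmNr) sX !(jmZr, jmZl).
  rewrite (jmC Y X) (jQC Y X) sQ.
  by jmodule_with ltac:(by field).
have m0 : m = 0.
  have /eqP := congr1 (@jtr F k) E; rewrite !(jtrB, jtrZ) jtr1.
  have -> : jtr (jm X (jm X Y)) = jtr X * jQ X Y.
    by rewrite -jQE -jQ_mA // sX jQZl.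
  rewrite -jQE.
  have -> : 2%:R * (jtr X * jQ X Y) - jtr X * jQ X Y - jQ X Y * jtr X = 0 by ring.
  by rewrite eq_sym mulf_eq0 (negbTE (three_neq0 F)) orbF => /eqP.
move: E; rewrite m0 scale0r => E.
by apply: (eq_from (c := 1) E); jmodule.
Qed.

(** With trace 1, idempotency becomes the equation of the cone over the Severi variety, so a frame
    consists of three points of that variety. *)
Definition frame e f g : Prop :=
  [/\ [/\ jm e e = e, jm f f = f & jm g g = g],
      [/\ jm e f = 0, jm e g = 0 & jm f g = 0],
      [/\ jtr e = 1, jtr f = 1 & jtr g = 1] & e + f + g = one].

(* [rank1_U] for [g = 1 - e - f] determines the anticommutator of the
   multiplications by e and f; commuting it with the multiplication by e then
   shows that they commute. *)
Lemma frame_commute e f g Z : frame e f g ->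
  jm e (jm f Z) = jm f (jm e Z).
Proof.
case=> -[ee ff gg] [ef eg fg] [te tf tg] s1.
have Ue Y : 2%:R *: jm e (jm e Y) = jm e Y + jQ e Y *: e.
  by rewrite rank1_U ?te ?scale1r.
have Uf Y : 2%:R *: jm f (jm f Y) = jm f Y + jQ f Y *: f.
  by rewrite rank1_U ?tf ?scale1r.
have Ug Y : 2%:R *: jm g (jm g Y) = jm g Y + jQ g Y *: g.
  by rewrite rank1_U ?tg ?scale1r.
have gE : g = one - e - f by rewrite -s1; jmodule.
have AC Y : 2%:R *: (jm e (jm f Y) + jm f (jm e Y)) =
    - Y + 2%:R *: jm e Y + 2%:R *: jm f Y +
    (jQ g Y *: g - jQ e Y *: e - jQ f Y *: f).
  have gY V : jm g V = V - jm e V - jm f V.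
    by rewrite gE !jmBl jm1l.
  have := Ug Y; rewrite !gY !jmBr !scalerBr !scalerDr => H.
  have := Ue Y; have := Uf Y => H1 H2.
  have HH : 2%:R *: (Y - jm e Y - jm f Y) -
     (2%:R *: jm e Y - 2%:R *: jm e (jm e Y) - 2%:R *: jm e (jm f Y)) -
     (2%:R *: jm f Y - 2%:R *: jm f (jm e Y) - 2%:R *: jm f (jm f Y)) =
     Y - jm e Y - jm f Y + jQ g Y *: g.
    by rewrite -H; jmodule.
  move: HH; rewrite H1 H2 => HH.
  by apply: (eq_from (c := 1) HH); jmodule.
have Qm Y V : jm Y V = 0 -> jQ Y (jm V Z) = 0 by move=> h; rewrite -jQ_mA h jQ0l.
have H0 := congr1 (jm e) (AC Z); have H0' := AC (jm e Z).
have H1 := Ue (jm f Z); have H2 := congr1 (jm f) (Ue Z).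
rewrite Qm // scale0r addr0 in H1.
rewrite !(jmDr, jmZr) (jmC f e) ef scaler0 addr0 in H2.
rewrite !(jmDr, jmBr, jmNr, jmZr) ee ef eg in H0.
rewrite (Qm f e) ?(jmC f e) // (Qm g e) ?(jmC g e) // -jQ_mA ee in H0'.
have := f_equal2 (fun u v => u - v) H0 H0'.
rewrite /= !scalerDr H1 H2 => H.
by apply: (eq_from (c := - 1) H); jmodule.
Qed.

Lemma frame_indep e f g (a b c : F) : frame e f g ->
  a *: e + b *: f + c *: g = 0 -> [/\ a = 0, b = 0 & c = 0].
Proof.
case=> -[ee ff gg] [ef eg fg] [te tf tg] s1 H; split.
- have := congr1 (jQ e) H; rewrite !(jQDr, jQZr) jQ0r !jQE ee ef eg te jtr0.
  by rewrite mulr1 !mulr0 !addr0.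
- have := congr1 (jQ f) H; rewrite !(jQDr, jQZr) jQ0r !jQE ff (jmC f) ef fg.
  by rewrite tf jtr0 mulr1 !mulr0 addr0 add0r.
- have := congr1 (jQ g) H; rewrite !(jQDr, jQZr) jQ0r !jQE gg !(jmC g) eg fg.
  by rewrite tg jtr0 mulr1 !mulr0 !add0r.
Qed.

Lemma line_vpick (V : vectType F) (L : {vspace V}) :
  \dim L = 1%N -> exists2 v, v != 0 & L = <[v]>%VS.
Proof.
move=> dL; have L0 : L != 0%VS by rewrite -dimv_eq0 dL.
exists (vpick L); first by rewrite vpick0.
by apply/esym/eqP; rewrite eqEdim dim_vline dL vpick0 L0 -memvE memv_pick.
Qed.

Lemma vlineZ (V : vectType F) c (v : V) : c != 0 -> <[c *: v]>%VS = <[v]>%VS.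
Proof.
move=> c0; apply/eqP; rewrite eqEsubv -!memvE memvZ ?memv_line //=.
by rewrite -{1}[v](scalerK c0) memvZ ?memv_line.
Qed.

Lemma vline_eqP (V : vectType F) (v w : V) : v != 0 ->
  <[v]>%VS = <[w]>%VS -> exists2 c, c != 0 & w = c *: v.
Proof.
move=> v0 E; have : w \in <[v]>%VS by rewrite E memv_line.
case/vlineP=> c wE; exists c => //; apply/eqP => c0; move: E.
rewrite wE c0 scale0r => /(congr1 (fun L : {vspace V} => \dim L)).
by rewrite !dim_vline v0 eqxx.
Qed.

(* The cone of [severi] contains the plane spanned by X and Y as soon as it
   contains a third line of that plane. *)
Lemma severi_line X Y a b : jm X X = jtr X *: X -> jm Y Y = jtr Y *: Y ->
  jm (a *: X + b *: Y) (a *: X + b *: Y) =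
    jtr (a *: X + b *: Y) *: (a *: X + b *: Y) ->
  a != 0 -> b != 0 -> 2%:R *: jm X Y = jtr Y *: X + jtr X *: Y.
Proof.
move=> sX sY; rewrite !(jmDl, jmDr, jmZl, jmZr) (jmC Y X) sX sY jtrD !jtrZ.
move=> H a0 b0; apply: (eq_from (c := (a * b)^-1) H).
by jmodule_with ltac:(by field; rewrite a0 b0).
Qed.

Lemma dim_span3 (V : vectType F) (x y z : V) :
  (forall a b c : F, a *: x + b *: y + c *: z = 0 -> [/\ a = 0, b = 0 & c = 0]) ->
  \dim (<[x]> + <[y]> + <[z]>)%VS = 3%N.
Proof.
move=> ind; have fr : free [:: x; y; z].
  apply/freeP => c; rewrite !big_ord_recl big_ord0 /= addr0 addrA => /ind[c0 c1 c2].
  case=> -[|[|[|//]]] lti; [move: c0|move: c1|move: c2];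
    by move=> <-; congr (c _); apply: val_inj.
have -> : (<[x]> + <[y]> + <[z]>)%VS = <<[:: x; y; z]>>%VS.
  by rewrite !span_cons span_nil addv0 addvA.
exact: eqP fr.
Qed.

Lemma memv_span3 (V : vectType F) (W : {vspace V}) (x y z : V) :
  \dim W = 3%N -> x \in W -> y \in W -> z \in W ->
  (forall a b c : F, a *: x + b *: y + c *: z = 0 -> [/\ a = 0, b = 0 & c = 0]) ->
  W = (<[x]> + <[y]> + <[z]>)%VS.
Proof.
move=> dW xW yW zW ind; apply/esym/eqP; rewrite eqEdim dW dim_span3 // andbT.
by rewrite !subv_add -!memvE xW yW zW.
Qed.

Lemma memv_span3P (V : vectType F) (x y z v : V) :
  v \in (<[x]> + <[y]> + <[z]>)%VS ->
  exists a b c : F, v = a *: x + b *: y + c *: z.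
Proof.
case/memv_addP=> _ /memv_addP[_ /vlineP[a ->] [_ /vlineP[b ->] ->]].
by case=> _ /vlineP[c ->] ->; exists a, b, c.
Qed.

End Frames.

Section SecantLines.
Variables (F : numClosedFieldType) (k : nat).
Hypothesis k3 : (k <= 3)%N.
Local Notation J := (J3 F k).
Local Notation one := (jone F k).
Implicit Types X Y Z e f g : J.

Lemma severi_vline X : X != 0 ->
  severi <[X]>%VS <-> jm X X = jtr X *: X.
Proof.
move=> X0; split=> [[_ H]|H].
  by rewrite jmE; apply: H; rewrite memv_line.
split; first by rewrite dim_vline X0.
move=> _ /vlineP[c ->]; rewrite -jmE jmZl jmZr H jtrZ.
by jmodule.
Qed.

Lemma ord3_cases (P : 'I_3 -> Prop) :
  P 0 -> P 1 -> P (inord 2) -> forall i, P i.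
Proof.
move=> P0 P1 P2; case=> -[|[|[|//]]] lti; [move: P0|move: P1|move: P2];
  by congr P; apply: val_inj; rewrite /= ?inordK.
Qed.

(* With Y_i of trace 1 - a_i, the relations Y_i 1 = Y_i give
   Y_1 Y_2 = (a_1 Y_1 + a_2 Y_2 - a_3 Y_3) / 2; [rank1_U] then forces
   a_i Y_i = 0. *)
Lemma three_points_frame (Y1 Y2 Y3 : J) :
  jm Y1 Y1 = jtr Y1 *: Y1 -> jm Y2 Y2 = jtr Y2 *: Y2 ->
  jm Y3 Y3 = jtr Y3 *: Y3 ->
  (forall a b c : F, a *: Y1 + b *: Y2 + c *: Y3 = 0 ->
     [/\ a *: Y1 = 0, b *: Y2 = 0 & c *: Y3 = 0]) ->
  Y1 + Y2 + Y3 = one -> frame Y1 Y2 Y3.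
Proof.
move=> sY1 sY2 sY3 ind s1'.
have tr3 : jtr Y1 + jtr Y2 + jtr Y3 = 3%:R by rewrite -!jtrD s1' jtr1.
pose a1 := 1 - jtr Y1; pose a2 := 1 - jtr Y2; pose a3 := 1 - jtr Y3.
have R1 := jm1r Y1; have R2 := jm1r Y2; have R3 := jm1r Y3.
rewrite -s1' !jmDr ?sY1 ?sY2 ?sY3 in R1 R2 R3.
rewrite (jmC Y2 Y1) in R2; rewrite (jmC Y3 Y1) (jmC Y3 Y2) in R3.
have P12 : jm Y1 Y2 = 2%:R^-1 *: (a1 *: Y1 + a2 *: Y2 - a3 *: Y3).
  have E := f_equal2 (fun u v => u - v) (f_equal2 (fun u v => u + v) R1 R2) R3.
  apply: (eq_from (c := 2%:R^-1) E); rewrite /a1 /a2 /a3.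
  by jmodule_with ltac:(by field).
have P13 : jm Y1 Y3 = 2%:R^-1 *: (a1 *: Y1 + a3 *: Y3 - a2 *: Y2).
  have E := f_equal2 (fun u v => u - v) (f_equal2 (fun u v => u + v) R1 R3) R2.
  apply: (eq_from (c := 2%:R^-1) E); rewrite /a1 /a2 /a3.
  by jmodule_with ltac:(by field).
have P23 : jm Y2 Y3 = 2%:R^-1 *: (a2 *: Y2 + a3 *: Y3 - a1 *: Y1).
  have E := f_equal2 (fun u v => u - v) (f_equal2 (fun u v => u + v) R2 R3) R1.
  apply: (eq_from (c := 2%:R^-1) E); rewrite /a1 /a2 /a3.
  by jmodule_with ltac:(by field).
have a3E : a3 = - a1 - a2.
  by apply/eqP; rewrite -subr_eq0 /a1 /a2 /a3; apply/eqP;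
    rewrite -[RHS](subrr (3%:R : F)) -{2}tr3; ring.
have Z c X : c *: X = 0 -> X = 0 \/ c = 0.
  by move/eqP; rewrite scaler_eq0 => /orP[/eqP|/eqP]; [right|left].
have H1 := rank1_U k3 Y2 sY1; have H2 := rank1_U k3 Y1 sY2.
rewrite (jmC Y2 Y1) (jQC Y2) in H2.
rewrite P12 !(jmZr, jmDr, jmNr) sY1 P12 P13 in H1.
rewrite P12 !(jmZr, jmDr, jmNr) (jmC Y2 Y1) P12 sY2 P23 in H2.

have t1 : jtr Y1 = 1 - a1 by rewrite /a1; ring.
have t2 : jtr Y2 = 1 - a2 by rewrite /a2; ring.
have K1 : exists m, m *: Y1 + a2 *: Y2 - a3 *: Y3 = 0.
  exists (2%:R * jQ Y1 Y2 - a1 * (jtr Y1 + a2 - a3)).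
  by apply: (eq_from (c := - 2%:R) H1); rewrite t1 a3E;
    jmodule_with ltac:(by field).
have K2 : exists m, m *: Y2 + a1 *: Y1 - a3 *: Y3 = 0.
  exists (2%:R * jQ Y1 Y2 - a2 * (jtr Y2 + a1 - a3)).
  by apply: (eq_from (c := - 2%:R) H2); rewrite t2 a3E;
    jmodule_with ltac:(by field).
have [z2 z3] : a2 *: Y2 = 0 /\ a3 *: Y3 = 0.
  have [m Hm] := K1; move: Hm; rewrite -scaleNr => /ind[_ h2 /eqP].
  by rewrite scaleNr oppr_eq0 => /eqP.
have z1 : a1 *: Y1 = 0.
  have [m Hm] := K2; move: Hm; rewrite -scaleNr (addrC (m *: _)) => /ind[h1 _ _].
  exact: h1.
have tE a Y : a = 1 - jtr Y -> a *: Y = 0 -> jtr Y = 1 \/ jtr Y = 0.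
  move=> -> /eqP; rewrite scaler_eq0 subr_eq0 => /orP[/eqP <-|/eqP ->].
    by left.
  by right; rewrite jtr0.
have ne (m n : nat) : m != n -> m%:R = n%:R :> F -> False.
  by move=> mn /eqP; rewrite eqr_nat (negbTE mn).
(* Each trace is 1, or else 0 because the vector itself vanishes. The three add up to 3 in
   characteristic 0, so all are 1. *)
have [T1 T2 T3] : [/\ jtr Y1 = 1, jtr Y2 = 1 & jtr Y3 = 1].
  move: tr3.
  case: (tE a1 Y1 erefl z1) (tE a2 Y2 erefl z2) (tE a3 Y3 erefl z3)
    => -> [] -> [] -> // H; exfalso;
  first [by apply: (@ne 2 3) => //; rewrite -H; ring
        |by apply: (@ne 1 3) => //; rewrite -H; ring
        |by apply: (@ne 0 3) => //; rewrite -H; ring].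
have [A1 A2 A3] : [/\ a1 = 0, a2 = 0 & a3 = 0].
  by rewrite /a1 /a2 /a3 T1 T2 T3 subrr.
rewrite A1 A2 A3 !scale0r !addr0 subr0 scaler0 in P12 P13 P23.
by rewrite /frame sY1 sY2 sY3 T1 T2 T3 !scale1r.
Qed.

(** The three points are not collinear, so they span the plane and [one] is a combination of them.
    The cone is stable under scaling, so the coefficients are absorbed into the vectors and
    [three_points_frame] applies. *)
Lemma secant_frame (W : {vspace J}) : one \in W -> simply_3_secant W ->
  exists e f g, frame e f g /\ W = (<[e]> + <[f]> + <[g]>)%VS.
Proof.
move=> oW [dW [p pinj pE] _].
have pP i : severi (p i) /\ (p i <= W)%VS.
  by have : range p (p i) by []; rewrite -pE.
have [X1 X10 p0E] := line_vpick (proj1 (proj1 (pP 0))).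
have [X2 X20 p1E] := line_vpick (proj1 (proj1 (pP 1))).
have [X3 X30 p2E] := line_vpick (proj1 (proj1 (pP (inord 2)))).
have vec i X : X != 0 -> p i = <[X]>%VS -> jm X X = jtr X *: X /\ X \in W.
  by move=> X0 piE; have [s sub] := pP i; rewrite piE in s sub; rewrite memvE -severi_vline.
have [sX1 X1W] := vec _ _ X10 p0E; have [sX2 X2W] := vec _ _ X20 p1E.
have [sX3 X3W] := vec _ _ X30 p2E.
have pne i j : i != j -> p i <> p j by move=> /eqP ij /pinj.
have indep2 X Y (a b : F) : X != 0 -> Y != 0 -> <[X]>%VS <> <[Y]>%VS ->
    a *: X + b *: Y = 0 -> a = 0 /\ b = 0.
  move=> X0 Y0 XY H.
  have a0 : a = 0.
    apply/eqP/negPn/negP => a0.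
    have b0 : b != 0.
      apply/eqP => b0; move: H; rewrite b0 scale0r addr0 => /eqP.
      by rewrite scaler_eq0 (negbTE a0) (negbTE X0).
    apply: XY; have -> : X = (- a^-1 * b) *: Y.
      by apply: (eq_from (c := a^-1) H); jmodule_with ltac:(by field).
    by rewrite vlineZ // mulf_neq0 ?oppr_eq0 ?invr_eq0.
  split=> //; move: H; rewrite a0 scale0r add0r => /eqP.
  by rewrite scaler_eq0 (negbTE Y0) orbF => /eqP.
have i12 : <[X1]>%VS <> <[X2]>%VS by rewrite -p0E -p1E; exact: pne.
have i13 : <[X1]>%VS <> <[X3]>%VS.
  by rewrite -p0E -p2E; apply: pne; rewrite -val_eqE /= inordK.
have i23 : <[X2]>%VS <> <[X3]>%VS.
  by rewrite -p1E -p2E; apply: pne; rewrite -val_eqE /= inordK.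
(* If the three points were collinear, the whole line through X1 and X2 would
   lie on the Severi variety. *)
have ind a b c : a *: X1 + b *: X2 + c *: X3 = 0 -> [/\ a = 0, b = 0 & c = 0].
  move=> H; suff c0 : c = 0.
    move: H; rewrite c0 scale0r addr0 => H.
    by have [-> ->] := indep2 _ _ _ _ X10 X20 i12 H.
  apply/eqP/negPn/negP => c0.
  have X3E : X3 = (- c^-1 * a) *: X1 + (- c^-1 * b) *: X2.
    by apply: (eq_from (c := c^-1) H); jmodule_with ltac:(by field).
  have a0 : a != 0.
    apply/eqP => a0; apply: i23; rewrite X3E a0 mulr0 scale0r add0r vlineZ //.
    by apply/eqP => b0; move: X30; rewrite X3E a0 b0 mulr0 !scale0r addr0 eqxx.
  have b0 : b != 0.
    apply/eqP => b0; apply: i13; rewrite X3E b0 mulr0 scale0r addr0 vlineZ //.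
    by apply/eqP => a1; move: X30; rewrite X3E a1 b0 mulr0 !scale0r addr0 eqxx.
  have S12 : 2%:R *: jm X1 X2 = jtr X2 *: X1 + jtr X1 *: X2.
    apply: (severi_line sX1 sX2 (a := - c^-1 * a) (b := - c^-1 * b)).
    - by rewrite -X3E.
    - by rewrite mulf_neq0 ?oppr_eq0 ?invr_eq0.
    - by rewrite mulf_neq0 ?oppr_eq0 ?invr_eq0.
  have on t : exists i, p i = <[X1 + t *: X2]>%VS.
    have nz : X1 + t *: X2 != 0.
      apply/eqP; rewrite -[X1]scale1r => /(indep2 _ _ _ _ X10 X20 i12)[/eqP].
      by rewrite oner_eq0.
    have : [set L | severi L /\ (L <= W)%VS] <[X1 + t *: X2]>%VS.
      split; last by rewrite -memvE memvD ?memvZ.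
      apply/severi_vline => //.
      rewrite !(jmDl, jmDr, jmZl, jmZr) (jmC X2 X1) sX1 sX2 jtrD jtrZ.
      by apply: (eq_from (c := t) S12); jmodule.
    by rewrite pE => -[i _ <-]; exists i.
  (* The parameters 0, 1, 2, 3 give four distinct points of the line, while only three indices are
     available. *)
  have [h hE] := boolp.choice (fun i : 'I_4 => on (i : nat)%:R).
  have /leq_card : injective h; last by rewrite !card_ord.
  move=> i j hij; have := hE i; rewrite hij hE.
  have nz t : X1 + t *: X2 != 0.
    apply/eqP; rewrite -[X1]scale1r => /(indep2 _ _ _ _ X10 X20 i12)[/eqP].
    by rewrite oner_eq0.
  case/(vline_eqP (nz _)) => s s0 E.
  have : (1 - s) *: X1 + (i%:R - s * j%:R) *: X2 = 0.
    by apply: (eq_from (c := 1) E); jmodule.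
  case/(indep2 _ _ _ _ X10 X20 i12) => /subr0_eq <-; rewrite mul1r => /subr0_eq/eqP.
  by rewrite eqr_nat => /eqP/val_inj.
have WE := memv_span3 dW X1W X2W X3W ind.
have := oW; rewrite {1}WE => /memv_span3P[c1 [c2 [c3 s1]]].
have sev c X : jm X X = jtr X *: X -> jm (c *: X) (c *: X) = jtr (c *: X) *: (c *: X).
  by move=> sX; rewrite jmZl jmZr sX jtrZ; jmodule.
have fr : frame (c1 *: X1) (c2 *: X2) (c3 *: X3).
  apply: three_points_frame; try exact: sev; last by rewrite s1.
  move=> a b c; rewrite !scalerA => /ind[-> -> ->].
  by rewrite !scale0r.
exists (c1 *: X1), (c2 *: X2), (c3 *: X3); split=> //.
have [_ _ [t1 t2 t3] _] := fr.
have nz c X : jtr (c *: X) = 1 -> c != 0.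
  by move=> t; apply/eqP => c0; move: t; rewrite c0 scale0r jtr0 => /eqP;
    rewrite eq_sym oner_eq0.
by rewrite !vlineZ ?(nz _ _ t1) ?(nz _ _ t2) ?(nz _ _ t3).
Qed.

End SecantLines.

Section FrameLines.
Variables (F : numClosedFieldType) (k : nat).
Local Notation J := (J3 F k).
Implicit Types X Y Z e f g : J.

Lemma frame_secant e f g : frame e f g ->
  simply_3_secant (<[e]> + <[f]> + <[g]>)%VS.
Proof.
move=> fr; have [[ee ff gg] [ef eg fg] [te tf tg] s1] := fr.
set W := (_ + _)%VS.
have eW : e \in W by rewrite (subvP (subv_trans (addvSl _ _) (addvSl _ _))) ?memv_line.
have fW : f \in W.
  by rewrite (subvP (subv_trans (addvSr _ _) (addvSl _ _))) ?memv_line.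
have gW : g \in W by rewrite (subvP (addvSr _ _)) ?memv_line.
have ind a b c : a *: e + b *: f + c *: g = 0 -> [/\ a = 0, b = 0 & c = 0].
  exact: frame_indep.
have nz X : jtr X = 1 -> X != 0.
  by move=> t; apply/eqP => X0; move: t; rewrite X0 jtr0 => /eqP;
    rewrite eq_sym oner_eq0.
pose p (i : 'I_3) := if i == 0 then <[e]>%VS else if i == 1 then <[f]>%VS else <[g]>%VS.
have pE : [set L | severi L /\ (L <= W)%VS] = range p.
  apply/seteqP; split=> [L [sL LW]|_ [i _ <-]]; last first.
    have idem X : X \in W -> jm X X = X -> jtr X = 1 ->
        severi <[X]>%VS /\ (<[X]> <= W)%VS.
      move=> XW XX tX; split; last by rewrite -memvE.
      by apply/severi_vline; rewrite ?nz // tX scale1r.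
    by rewrite /p; case: ifP => _; [|case: ifP => _]; apply: idem.
  have [X X0 LE] := line_vpick (proj1 sL); subst L.
  have /(severi_vline X0) sX := sL.
  have [a [b [c XE]]] := memv_span3P (LW : (<[X]> <= W)%VS).
  have trX : jtr X = a + b + c.
    by rewrite XE !(jtrD, jtrZ) te tf tg !mulr1.
  move: sX; rewrite trX {1 2}XE !(jmDl, jmDr, jmZl, jmZr).
  rewrite (jmC f e) (jmC g e) (jmC g f) ee ff gg ef eg fg => sX.
  have : (a * (a - (a + b + c))) *: e + (b * (b - (a + b + c))) *: f +
         (c * (c - (a + b + c))) *: g = 0.
    by apply: (eq_from (c := 1) sX); rewrite XE; jmodule.
  case/ind=> /eqP ha /eqP hb /eqP hc; move: ha hb hc.
  (* Each coordinate is 0 or the sum s, and s is nonzero. Exactly one coordinate equals s: two or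
     three would make the sum 2 s or 3 s. *)
  rewrite !mulf_eq0 !subr_eq0.
  set s := a + b + c => ha hb hc.
  have s0 : s != 0.
    apply/eqP => s0; move: ha hb hc; rewrite s0 !orbb => /eqP a0 /eqP b0 /eqP c0.
    by move: X0; rewrite XE a0 b0 c0 !scale0r !addr0 eqxx.
  have two (u v : F) : u = s -> v = s -> u + v = s -> False.
    move=> -> -> /eqP; rewrite -subr_eq0 addrK.
    by rewrite (negbTE s0).
  have sE : s = a + b + c by [].
  have pt i u : u = s -> p i = <[u *: nth e [:: e; f; g] i]>%VS.
    move=> ->; rewrite vlineZ //; move: i; apply: ord3_cases => //.
    by rewrite /p -!val_eqE /= inordK.
  case/orP: ha => /eqP ha; case/orP: hb => /eqP hb; case/orP: hc => /eqP hc.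
  - by move: s0; rewrite sE ha hb hc !addr0 eqxx.
  - exists (inord 2) => //; rewrite (pt _ _ hc) XE ha hb !scale0r !add0r.
    by rewrite inordK.
  - by exists 1 => //; rewrite (pt _ _ hb) XE ha hc !scale0r add0r addr0.
  - by case: (two _ _ hb hc); rewrite sE ha add0r.
  - by exists 0 => //; rewrite (pt _ _ ha) XE hb hc !scale0r !addr0.
  - by case: (two _ _ ha hc); rewrite sE hb addr0.
  - by case: (two _ _ ha hb); rewrite sE hc addr0.
  - exfalso; have : s *+ 2 = 0.
      by move: sE; rewrite ha hb hc => E; apply: (addIr s); rewrite add0r [RHS]E; ring.
    by move/eqP; rewrite mulrn_eq0 (negbTE s0).
have pinj : injective p.
  have ne X Y : jm X Y = 0 -> jm X X = X -> jtr X = 1 -> <[X]>%VS <> <[Y]>%VS.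
    move=> XY XX tX /(vline_eqP (nz _ tX))[t t0 YE].
    move: XY; rewrite YE jmZr XX => /eqP.
    by rewrite scaler_eq0 (negbTE t0) (negbTE (nz _ tX)).
  have nef := ne _ _ ef ee te; have neg := ne _ _ eg ee te.
  have nfg := ne _ _ fg ff tf.
  have p2 : p (inord 2) = <[g]>%VS by rewrite /p -!val_eqE /= inordK.
  apply: ord3_cases; apply: ord3_cases => //; rewrite ?p2 /p //=.
  - by move/esym.
  - by move/esym.
  - by move/esym.
split; first exact: dim_span3.
  by exists p.
move=> L sL LW Z ZW ZT.
have : range p L by rewrite -pE.
have [a [b [c ZE]]] := memv_span3P ZW.
have trZ : jtr Z = a + b + c.
  by rewrite ZE !(jtrD, jtrZ) te tf tg !mulr1.
case=> i _ LE; subst L.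
have tan X : X \in p i -> jtr X = 1 -> jm X Z *+ 2 = Z + jtr Z *: X.
  by move=> XL tX; rewrite jmE ZT // tX scale1r.
have : p i = <[e]>%VS \/ p i = <[f]>%VS \/ p i = <[g]>%VS.
  by rewrite /p; case: ifP => _; [|case: ifP => _]; tauto.
case=> [|[]] E; rewrite E in tan *.
- have := tan e (memv_line _) te; rewrite trZ {1 2}ZE !(jmDr, jmZr) ee ef eg => H.
  have : (b + c) *: e + b *: f + c *: g = 0.
    by apply: (eq_from (c := - 1) H); jmodule.
  by case/ind=> _ b0 c0; rewrite ZE b0 c0 !scale0r !addr0 memvZ ?memv_line.
- have := tan f (memv_line _) tf.
  rewrite trZ {1 2}ZE !(jmDr, jmZr) (jmC f e) ff ef fg => H.
  have : a *: e + (a + c) *: f + c *: g = 0.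
    by apply: (eq_from (c := - 1) H); jmodule.
  by case/ind=> a0 _ c0; rewrite ZE a0 c0 !scale0r add0r addr0 memvZ ?memv_line.
- have := tan g (memv_line _) tg.
  rewrite trZ {1 2}ZE !(jmDr, jmZr) (jmC g e) (jmC g f) gg eg fg => H.
  have : a *: e + b *: f + (a + b) *: g = 0.
    by apply: (eq_from (c := - 1) H); jmodule.
  by case/ind=> a0 b0 _; rewrite ZE a0 b0 !scale0r !add0r memvZ ?memv_line.
Qed.

Lemma jproj_linear : linear (@jproj F k).
Proof.
by move=> c X Y; rewrite /jproj jtrD jtrZ; jmodule.
Qed.

(** Two idempotents suffice, since the projections of a frame add up to the projection of [one],
    which is 0. This gives explicit generators for the closure. *)
Lemma secant_linesP (L : {vspace J}) : (k <= 3)%N ->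
  secant_lines L <-> exists e f g, frame e f g /\
    L = (<[jproj e]> + <[jproj f]>)%VS.
Proof.
move=> k3; have comb e f g a b c : frame e f g ->
    jproj (a *: e + b *: f + c *: g) = (a - c) *: jproj e + (b - c) *: jproj f.
  case=> _ _ [te tf tg] s1; rewrite /jproj -s1 !(jtrD, jtrZ) te tf tg.
  by jmodule_with ltac:(by field).
split=> [[W [oW sW LE]]|[e [f [g [fr ->]]]]].
  have [e [f [g [fr WE]]]] := secant_frame k3 oW sW.
  exists e, f, g; split=> //; apply/vspaceP => X; apply/idP/idP => XL.
    have : [set` L] X by [].
    rewrite LE => -[Y /= YW <-]; rewrite WE in YW.
    have [a [b [c ->]]] := memv_span3P YW.
    by rewrite (comb _ _ _ _ _ _ fr) memv_add ?memvZ ?memv_line.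
  case/memv_addP: XL => _ /vlineP[a ->] [_ /vlineP[b ->] ->].
  suff : [set` L] (a *: jproj e + b *: jproj f) by [].
  rewrite LE; exists (a *: e + b *: f + 0 *: g).
    by rewrite /= WE !memv_add ?memvZ ?memv_line.
  by rewrite (comb _ _ _ _ _ _ fr) !subr0.
exists (<[e]> + <[f]> + <[g]>)%VS; split; last 1 first.
- apply/seteqP; split=> [X /= /memv_addP[_ /vlineP[a ->] [_ /vlineP[b ->] ->]]|].
    exists (a *: e + b *: f + 0 *: g).
      by rewrite /= !memv_add ?memvZ ?memv_line.
    by rewrite (comb _ _ _ _ _ _ fr) !subr0.
  move=> _ [Y /= /memv_span3P[a [b [c ->]]] <-].
  by rewrite (comb _ _ _ _ _ _ fr) memv_add ?memvZ ?memv_line.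
- have [_ _ _ <-] := fr.
  by rewrite !memv_add ?memv_line.
- exact: frame_secant.
Qed.

End FrameLines.

(** * Polynomial functions *)

Section PolynomialFunctions.
Variable F : fieldType.
Implicit Types V W U : vectType F.

Definition lform V (l : V -> F) := forall c v w, l (c *: v + w) = c * l v + l w.

Lemma lformD V l (v w : V) : lform l -> l (v + w) = l v + l w.
Proof. by move=> h; have := h 1 v w; rewrite scale1r mul1r. Qed.
Lemma lform0 V l : lform l -> l (0 : V) = 0.
Proof. by move=> h; apply: (addrI (l 0)); rewrite -lformD // !addr0. Qed.
Lemma lformZ V l c (v : V) : lform l -> l (c *: v) = c * l v.
Proof. by move=> h; have := h c v 0; rewrite lform0 // !addr0. Qed.
Lemma lform_sum V l (I : Type) (r : seq I) (f : I -> V) : lform l ->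
  l (\sum_(i <- r) f i) = \sum_(i <- r) l (f i).
Proof.
move=> h; elim: r => [|i r IHr]; first by rewrite !big_nil lform0.
by rewrite !big_cons lformD // IHr.
Qed.
Lemma lform_coord V n (X : n.-tuple V) i : lform (coord X i).
Proof. by move=> c v w; rewrite linearP. Qed.
Lemma lform_vbasis V l (v : V) : lform l ->
  l v = \sum_i coord (vbasis {:V}) i v * l (vbasis {:V})`_i.
Proof.
move=> h; rewrite {1}(coord_vbasis (memvf v)) lform_sum //.
by apply: eq_bigr => i _; rewrite lformZ.
Qed.

(** Generated by linear forms rather than defined by evaluation of [mpoly], so that maps between
    spaces without chosen coordinates are seen to be polynomial from their syntax alone, as
    [polysolve] does. *)
Inductive polyfun V : (V -> F) -> Prop :=
| polyfun_cst c : polyfun (fun=> c)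
| polyfun_lin l : lform l -> polyfun l
| polyfunD f g : polyfun f -> polyfun g -> polyfun (fun v => f v + g v)
| polyfunM f g : polyfun f -> polyfun g -> polyfun (fun v => f v * g v).

Inductive hpoly V : nat -> (V -> F) -> Prop :=
| hpoly_zero d : hpoly d (fun=> 0)
| hpoly_cst c : hpoly 0 (fun=> c)
| hpoly_lin l : lform l -> hpoly 1 l
| hpolyD d f g : hpoly d f -> hpoly d g -> hpoly d (fun v => f v + g v)
| hpolyM d e f g : hpoly d f -> hpoly e g -> hpoly (d + e) (fun v => f v * g v).

Definition polymap V W (f : V -> W) := forall l, lform l -> polyfun (l \o f).

Lemma eq_polyfun V (f g : V -> F) : f =1 g -> polyfun f -> polyfun g.
Proof. by move=> /funext ->. Qed.
Lemma eq_hpoly V d (f g : V -> F) : f =1 g -> hpoly d f -> hpoly d g.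
Proof. by move=> /funext ->. Qed.
Lemma eq_polymap V W (f g : V -> W) : f =1 g -> polymap f -> polymap g.
Proof. by move=> /funext ->. Qed.

Lemma polyfun_sum V (I : Type) (r : seq I) (f : I -> V -> F) :
  (forall i, polyfun (f i)) -> polyfun (fun v => \sum_(i <- r) f i v).
Proof.
move=> h; elim: r => [|i r IHr].
  by apply: (eq_polyfun _ (polyfun_cst V 0)) => v; rewrite big_nil.
by apply: (eq_polyfun _ (polyfunD (h i) IHr)) => v; rewrite big_cons.
Qed.
Lemma polyfun_prod V (I : Type) (r : seq I) (f : I -> V -> F) :
  (forall i, polyfun (f i)) -> polyfun (fun v => \prod_(i <- r) f i v).
Proof.
move=> h; elim: r => [|i r IHr].
  by apply: (eq_polyfun _ (polyfun_cst V 1)) => v; rewrite big_nil.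
by apply: (eq_polyfun _ (polyfunM (h i) IHr)) => v; rewrite big_cons.
Qed.
Lemma polyfunX V (f : V -> F) n : polyfun f -> polyfun (fun v => f v ^+ n).
Proof.
move=> h; elim: n => [|n IHn]; first exact: polyfun_cst.
by apply: (eq_polyfun _ (polyfunM h IHn)) => v; rewrite exprS.
Qed.
Lemma polyfunN V (f : V -> F) : polyfun f -> polyfun (fun v => - f v).
Proof.
move=> h; apply: (eq_polyfun _ (polyfunM (polyfun_cst V (-1)) h)) => v.
by rewrite mulN1r.
Qed.
Lemma polyfunB V (f g : V -> F) :
  polyfun f -> polyfun g -> polyfun (fun v => f v - g v).
Proof. by move=> hf hg; apply: polyfunD hf (polyfunN hg). Qed.

Lemma hpolyX V (f : V -> F) d n : hpoly d f -> hpoly (n * d) (fun v => f v ^+ n).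
Proof.
move=> h; elim: n => [|n IHn]; first exact: hpoly_cst.
by apply: (eq_hpoly _ (hpolyM h IHn)) => v; rewrite exprS.
Qed.

Lemma polyfun_comp V W (f : W -> F) (g : V -> W) :
  polyfun f -> polymap g -> polyfun (f \o g).
Proof.
move=> hf hg; elim: hf => [c|l|f1 f2 _ IH1 _ IH2|f1 f2 _ IH1 _ IH2].
- exact: polyfun_cst.
- exact: hg.
- exact: polyfunD IH1 IH2.
- exact: polyfunM IH1 IH2.
Qed.

Lemma hpoly_comp_lin V W (g : V -> W) d (f : W -> F) :
  linear g -> hpoly d f -> hpoly d (f \o g).
Proof.
move=> hg; elim=> {d f} [d|c|l hl|d f1 f2 _ IH1 _ IH2|d e f1 f2 _ IH1 _ IH2].
- exact: hpoly_zero.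
- exact: hpoly_cst.
- by apply: hpoly_lin => c v w /=; rewrite hg hl.
- exact: hpolyD IH1 IH2.
- exact: hpolyM IH1 IH2.
Qed.

Lemma hpoly_scale V d (f : V -> F) c v : hpoly d f -> f (c *: v) = c ^+ d * f v.
Proof.
elim=> {d f} [d|x|l hl|d f g _ IHf _ IHg|d e f g _ IHf _ IHg].
- by rewrite mulr0.
- by rewrite expr0 mul1r.
- by rewrite lformZ // expr1.
- by rewrite IHf IHg mulrDr.
- by rewrite IHf IHg exprD mulrACA.
Qed.

Lemma polymap_comp V W U (f : W -> U) (g : V -> W) :
  polymap f -> polymap g -> polymap (f \o g).
Proof. by move=> hf hg l hl; exact: (polyfun_comp (hf l hl) hg). Qed.
Lemma polymap_lin V W (f : V -> W) : linear f -> polymap f.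
Proof. by move=> hf l hl; apply: polyfun_lin => c v w /=; rewrite hf hl. Qed.
Lemma polymap_cst V W (w : W) : polymap (fun _ : V => w).
Proof. by move=> l hl; apply: polyfun_cst. Qed.
Lemma polymapD V W (f g : V -> W) :
  polymap f -> polymap g -> polymap (fun v => f v + g v).
Proof.
move=> hf hg l hl; apply: (eq_polyfun _ (polyfunD (hf l hl) (hg l hl))) => v.
by rewrite /= lformD.
Qed.
Lemma polymapZ V W (c : V -> F) (f : V -> W) :
  polyfun c -> polymap f -> polymap (fun v => c v *: f v).
Proof.
move=> hc hf l hl; apply: (eq_polyfun _ (polyfunM hc (hf l hl))) => v.
by rewrite /= lformZ.
Qed.
Lemma polymapN V W (f : V -> W) : polymap f -> polymap (fun v => - f v).
Proof.
move=> hf; apply: (eq_polymap _ (polymapZ (polyfun_cst V (-1)) hf)) => v.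
by rewrite scaleN1r.
Qed.
Lemma polymap_bilin V W1 W2 U (b : W1 -> W2 -> U) (f : V -> W1) (g : V -> W2) :
  (forall w, linear (b w)) -> (forall w, linear (b ^~ w)) ->
  polymap f -> polymap g -> polymap (fun v => b (f v) (g v)).
Proof.
move=> b2 b1 hf hg l hl.
have lb2 w : lform (l \o b w) by move=> c x y /=; rewrite b2 hl.
have lb1 w : lform (l \o b^~ w) by move=> c x y /=; rewrite b1 hl.
pose e1 := vbasis {:W1}; pose e2 := vbasis {:W2}.
apply: (eq_polyfun (f := fun v => \sum_i coord e1 i (f v) *
          (\sum_j coord e2 j (g v) * l (b e1`_i e2`_j)))).
  move=> v /=; rewrite [RHS](lform_vbasis (f v) (lb1 (g v))).
  by apply: eq_bigr => i _; rewrite [X in _ = _ * X](lform_vbasis (g v) (lb2 _)).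
apply: polyfun_sum => i; apply: polyfunM; first exact: hf (lform_coord _ _).
apply: polyfun_sum => j; apply: polyfunM; first exact: hg (lform_coord _ _).
exact: polyfun_cst.
Qed.

Lemma lform_fst V W (l : (V * W)%type -> F) : lform l -> lform (fun v => l (v, 0)).
Proof.
move=> h c v w; rewrite -h; congr l.
by congr pair; rewrite /= scaler0 addr0.
Qed.
Lemma lform_snd V W (l : (V * W)%type -> F) : lform l -> lform (fun v => l (0, v)).
Proof.
move=> h c v w; rewrite -h; congr l.
by congr pair; rewrite /= scaler0 addr0.
Qed.

Lemma polymap_pair V W U (f : V -> W) (g : V -> U) :
  polymap f -> polymap g -> polymap (fun v => (f v, g v) : (W * U)%type).
Proof.
move=> hf hg l hl.
have := polyfunD (hf _ (lform_fst hl)) (hg _ (lform_snd hl)).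
apply: eq_polyfun => v /=; rewrite -lformD //; congr l.
by congr pair; rewrite /= ?add0r ?addr0.
Qed.
Lemma polymap_fst V W U (f : V -> (W * U)%type) :
  polymap f -> polymap (fun v => (f v).1).
Proof.
by move=> hf; apply: (@polymap_comp _ _ _ fst) hf; apply: polymap_lin.
Qed.
Lemma polymap_snd V W U (f : V -> (W * U)%type) :
  polymap f -> polymap (fun v => (f v).2).
Proof.
by move=> hf; apply: (@polymap_comp _ _ _ snd) hf; apply: polymap_lin.
Qed.

Lemma peval_lform V l : lform l -> exists2 p : {mpoly F[\dim {:V}]},
  p \is 1.-homog & forall v : V, peval p v = l v.
Proof.
move=> hl; exists (\sum_(i < \dim {:V}) l (vbasis {:V})`_i *: 'X_i).
  by apply: rpred_sum => i _; rewrite rpredZ // dhomogX; apply/eqP; apply: mdeg1.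
move=> v; rewrite /peval raddf_sum (lform_vbasis v hl) /=.
by apply: eq_bigr => i _; rewrite mevalZ mevalXU mulrC.
Qed.

Lemma hpoly_mpoly V d (f : V -> F) : hpoly d f ->
  exists2 p : {mpoly F[\dim {:V}]}, p \is d.-homog & forall v, peval p v = f v.
Proof.
elim=> {d f} [d|x|l hl|d f g _ [p hp pE] _ [q hq qE]|d e f g _ [p hp pE] _ [q hq qE]].
- by exists 0; [exact: dhomog0|move=> v; rewrite /peval meval0].
- exists x%:MP; last by move=> v; rewrite /peval mevalC.
  by rewrite -[x]mulr1 mpolyCM mul_mpolyC rpredZ // mpolyC1 dhomog1.
- exact: peval_lform.
- by exists (p + q); [exact: dhomogD|move=> v; rewrite /peval mevalD -pE -qE].
- by exists (p * q); [exact: dhomogM|move=> v; rewrite /peval mevalM -pE -qE].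
Qed.

Lemma mpoly_hpoly V d (p : {mpoly F[\dim {:V}]}) :
  p \is d.-homog -> hpoly d (fun v : V => peval p v).
Proof.
move=> /dhomogP hp.
apply: (eq_hpoly (f := fun v => \sum_(m <- msupp p) p@_m *
            \prod_i coord (vbasis {:V}) i v ^+ m i)).
  by move=> v; rewrite /peval mevalE.
have mono m : hpoly (mdeg m) (fun v : V => \prod_i coord (vbasis {:V}) i v ^+ m i).
  rewrite mdegE; elim: (index_enum _) => [|i r IHr].
    by rewrite big_nil; apply: (eq_hpoly _ (hpoly_cst V 1)) => v; rewrite big_nil.
  rewrite big_cons; have hl := hpoly_lin (lform_coord (vbasis {:V}) i).
  have := hpolyM (hpolyX (m i) hl) IHr; rewrite muln1.
  by apply: eq_hpoly => v; rewrite big_cons.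
elim: (msupp p) hp => [|m r IHr] hp.
  by apply: (eq_hpoly _ (hpoly_zero V d)) => v; rewrite big_nil.
have hm : hpoly d (fun v : V => p@_m * \prod_i coord (vbasis {:V}) i v ^+ m i).
  have <- : mdeg m = d by apply: hp; exact: mem_head.
  exact: hpolyM (hpoly_cst _ _) (mono m).
have {}IHr := IHr (fun m' hm' => hp m' (mem_behead (s := m :: r) hm')).
by apply: (eq_hpoly _ (hpolyD hm IHr)) => v; rewrite big_cons.
Qed.

Lemma hpoly_polyfun V d (f : V -> F) : hpoly d f -> polyfun f.
Proof.
elim=> {d f} [d|x|l hl|d f g _ hf _ hg|d e f g _ hf _ hg].
- exact: polyfun_cst.
- exact: polyfun_cst.
- exact: polyfun_lin.
- exact: polyfunD.
- exact: polyfunM.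
Qed.

Lemma rV_polyfun_mpoly n (f : 'rV[F]_n -> F) : polyfun f ->
  exists p : {mpoly F[n]}, forall v : 'rV[F]_n, p.@[v 0] = f v.
Proof.
elim=> {f} [c|l hl|f g _ [p pE] _ [q qE]|f g _ [p pE] _ [q qE]].
- by exists c%:MP => v; rewrite mevalC.
- exists (\sum_(i < n) l (delta_mx 0 i) *: 'X_i) => v.
  rewrite raddf_sum [in RHS](row_sum_delta v) lform_sum //=.
  by apply: eq_bigr => i _; rewrite mevalZ mevalXU lformZ // mulrC.
- by exists (p + q) => v; rewrite mevalD pE qE.
- by exists (p * q) => v; rewrite mevalM pE qE.
Qed.

Lemma rV_mpoly_polyfun n (p : {mpoly F[n]}) : polyfun (fun v : 'rV[F]_n => p.@[v 0]).
Proof.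
apply: (eq_polyfun (f := fun v : 'rV[F]_n =>
    \sum_(m <- msupp p) p@_m * \prod_i v 0 i ^+ m i)).
  by move=> v; rewrite mevalE.
apply: polyfun_sum => m; apply: polyfunM; first exact: polyfun_cst.
apply: polyfun_prod => i; apply/polyfunX/polyfun_lin => c v w.
by rewrite !mxE.
Qed.

Lemma polyfun_poly (f : F^o -> F) : polyfun f ->
  exists p : {poly F}, forall t, p.[t] = f t.
Proof.
elim=> {f} [c|l hl|f g _ [p pE] _ [q qE]|f g _ [p pE] _ [q qE]].
- by exists c%:P => t; rewrite hornerC.
- exists (l 1 *: 'X) => t; rewrite hornerZ hornerX mulrC -lformZ //.
  by congr l; rewrite /GRing.scale /= mulr1.
- by exists (p + q) => t; rewrite hornerD pE qE.
- by exists (p * q) => t; rewrite hornerM pE qE.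
Qed.

End PolynomialFunctions.

(** * Closed sets and affine charts *)

Section ClosedSets.
Variable F : fieldType.
Implicit Types V W : vectType F.

Definition hzeros V (S : set (V -> F)) : set {vspace V} :=
  [set L : {vspace V} | \dim L = 1%N /\
     forall h, S h -> {in L, forall v, h v = 0}].
Definition all_hpoly V (S : set (V -> F)) :=
  forall h, S h -> exists d, hpoly d h.

Lemma pclosedP V (Z : set {vspace V}) :
  pclosed Z <-> exists2 S, all_hpoly S & Z = hzeros S.
Proof.
split=> -[S hS ->].
  exists [set (fun v => peval p v) | p in S].
    by move=> _ [p /hS[d hp] <-]; exists d; exact: mpoly_hpoly.
  apply/seteqP; split=> L [dL H]; split=> //.
    by move=> _ [p Sp <-] v vL; exact: H.
  by move=> p Sp v vL; apply: (H (fun v => peval p v)) => //; exists p.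
exists [set p : {mpoly F[\dim {:V}]} |
   (exists d, p \is d.-homog) /\ S (fun v => peval p v)].
  by move=> p [].
apply/seteqP; split=> L [dL H]; split=> //.
  by move=> p [_ Sp] v vL; exact: H Sp v vL.
move=> h Sh v vL; have [d /hpoly_mpoly[p hp pE]] := hS h Sh.
rewrite -pE; apply: (H p) => //; split; first by exists d.
by have -> : (fun v => peval p v) = h by apply: funext.
Qed.

Lemma hzeros_vline V (S : set (V -> F)) v : v != 0 -> all_hpoly S ->
  hzeros S <[v]>%VS <-> forall h, S h -> h v = 0.
Proof.
move=> v0 hS; split=> [[_ H] h Sh|H]; first by rewrite (H h Sh) ?memv_line.
split; first by rewrite dim_vline v0.
move=> h Sh _ /vlineP[c ->]; have [d hd] := hS h Sh.
by rewrite (hpoly_scale _ _ hd) H // mulr0.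
Qed.

Lemma pclosure_lform V (A : set {vspace V}) L (l : V -> F) : lform l ->
  (forall M, A M -> \dim M = 1%N /\ {in M, forall v, l v = 0}) ->
  pclosure A L -> \dim L = 1%N /\ {in L, forall v, l v = 0}.
Proof.
move=> hl AM cL; pose S := [set l].
have : hzeros S L.
  apply: cL.
    by apply/pclosedP; exists S => // h ->; exists 1%N; exact: hpoly_lin.
  by move=> M /AM[dM lM]; split=> // h ->.
by case=> dL H; split=> // v vL; exact: H.
Qed.

Lemma pclosed_preim V W (g : V -> W) (Z : set {vspace W}) : linear g ->
  pclosed Z -> exists2 Z' : set {vspace V}, pclosed Z' &
    forall v, v != 0 -> g v != 0 -> Z' <[v]>%VS <-> Z <[g v]>%VS.
Proof.
move=> lg /pclosedP[S hS ->]; pose S' := [set h \o g | h in S].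
have hS' : all_hpoly S'.
  by move=> _ [h /hS[d hd] <-]; exists d; exact: hpoly_comp_lin.
exists (hzeros S'); first by apply/pclosedP; exists S'.
move=> v v0 gv0; rewrite !hzeros_vline //; split=> H h.
  by move=> Sh; apply: (H (h \o g)); exists h.
by case=> h' Sh' <-; exact: H.
Qed.

End ClosedSets.

(** The product of the two polynomials vanishes at every natural number, hence is 0; this uses
    characteristic 0 only to have enough distinct points. *)
Lemma polyfun_eq0 (F : numFieldType) (f p : F^o -> F) : polyfun f -> polyfun p ->
  (exists t, p t != 0) -> (forall t, p t != 0 -> f t = 0) -> forall t, f t = 0.
Proof.
move=> /polyfun_poly[f' fE] /polyfun_poly[p' pE] [t0 pt0] H t.
suff f0 : f' = 0 by rewrite -fE f0 horner0.
have p0 : p' != 0 by apply/eqP => p0; move: pt0; rewrite -pE p0 horner0 eqxx.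
have : f' * p' = 0.
  apply: (@roots_geq_poly_eq0 _ _ [seq (i%:R : F) | i <- iota 0 (size (f' * p'))]).
  - apply/allP => _ /mapP[i _ ->]; apply/rootP; rewrite hornerM fE pE.
    by case: (eqVneq (p i%:R) 0) => [->|/H ->]; rewrite ?mulr0 ?mul0r.
  - rewrite map_inj_uniq ?iota_uniq // => i j /eqP.
    by rewrite eqr_nat => /eqP.
  - by rewrite size_map size_iota.
by move/eqP; rewrite mulf_eq0 (negbTE p0) orbF => /eqP.
Qed.

(** The form taken by limits in this proof: a polynomial curve of vectors that represents points of
    a closed set for generic parameters does so wherever the vector is nonzero. *)
Lemma pclosed_curve (F : numFieldType) (V : vectType F) (Z : set {vspace V})
    (c : F^o -> V) (p : F^o -> F) t1 :
  pclosed Z -> polymap c -> polyfun p -> (exists t, p t != 0) ->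
  (forall t, p t != 0 -> Z <[c t]>%VS) -> c t1 != 0 -> Z <[c t1]>%VS.
Proof.
move=> /pclosedP[S hS ->] hc hp pn0 H ct1; apply/hzeros_vline => // h Sh.
have [d hd] := hS h Sh.
apply: (polyfun_eq0 (f := h \o c) _ hp pn0).
  exact: polyfun_comp (hpoly_polyfun hd) hc.
by move=> t /H[_ /(_ h Sh)]; apply; rewrite memv_line.
Qed.

(** * Affine charts given by a polynomial section of the cone over a projective set *)

Section Chart.
Variables (F : fieldType) (V : vectType F) (S : set {vspace V}) (n : nat).
Variables (l : V -> F) (Th : V -> 'rV[F]_n) (Ps : 'rV[F]_n -> V).
Hypothesis lin_l : lform l.
Hypothesis poly_Th : polymap Th.
Hypothesis poly_Ps : polymap Ps.
Hypothesis l_Ps : forall t, l (Ps t) = 1.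
Hypothesis S_Ps : forall t, S <[Ps t]>%VS.
Hypothesis PsK : cancel Ps Th.
Hypothesis Ps_surj : forall L, S L -> exists t, L = <[Ps t]>%VS.

(** Dividing by [l] first makes the value independent of the vector picked on the line. *)
Let f (L : {vspace V}) := Th ((l (vpick L))^-1 *: vpick L).
Let g t := <[Ps t]>%VS.

Let Ps_neq0 t : Ps t != 0.
Proof.
apply/eqP => P0; have := l_Ps t; rewrite P0 lform0 // => /eqP.
by rewrite eq_sym oner_eq0.
Qed.

Let chart_vec t v : v \in <[Ps t]>%VS -> v != 0 ->
  [/\ l v != 0, v = l v *: Ps t & Th ((l v)^-1 *: v) = t].
Proof.
case/vlineP=> c ->; rewrite scaler_eq0 negb_or => /andP[c0 _].
by rewrite lformZ // l_Ps mulr1 scalerA mulVf // scale1r PsK.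
Qed.

Let fK t : f <[Ps t]>%VS = t.
Proof.
by case: (@chart_vec t (vpick <[Ps t]>%VS)) => //;
  rewrite ?memv_pick // vpick0 -dimv_eq0 dim_vline Ps_neq0.
Qed.

(** Homogenisation by powers of [l]. In a sum, each summand is multiplied by the power of [l] given
    by the degree of the other, so no least degree has to be found. *)
Let homogenize (h : V -> F) : polyfun h ->
  exists d (H : V -> F), hpoly d H /\
    forall v, l v != 0 -> H v = l v ^+ d * h ((l v)^-1 *: v).
Proof.
elim=> {h} [c|m hm|h1 h2 _ [d1 [H1 [p1 E1]]] _ [d2 [H2 [p2 E2]]]
           |h1 h2 _ [d1 [H1 [p1 E1]]] _ [d2 [H2 [p2 E2]]]].
- exists 0%N, (fun=> c); split; first exact: hpoly_cst.
  by move=> v _; rewrite expr0 mul1r.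
- exists 1%N, m; split; first exact: hpoly_lin.
  by move=> v lv; rewrite expr1 lformZ // mulVKf.
- exists (d1 + d2)%N, (fun v => H1 v * l v ^+ d2 + l v ^+ d1 * H2 v); split.
    have hl e : hpoly e (fun v => l v ^+ e).
      by have := hpolyX e (hpoly_lin lin_l); rewrite muln1.
    by apply: hpolyD; apply: hpolyM.
  by move=> v lv; rewrite E1 // E2 // exprD; ring.
- exists (d1 + d2)%N, (fun v => H1 v * H2 v); split; first exact: hpolyM.
  by move=> v lv; rewrite E1 // E2 // exprD; ring.
Qed.

Let pull (p : {mpoly F[n]}) : exists d (H : V -> F), hpoly d H /\
  forall (t : 'rV[F]_n) (c : F),
    c != 0 -> H (c *: Ps t) = c ^+ d * p.@[t 0].
Proof.
have [d [H [hH HE]]] := homogenize (polyfun_comp (rV_mpoly_polyfun p) poly_Th).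
exists d, H; split=> // t c c0; rewrite HE lformZ // l_Ps mulr1 //=.
by rewrite scalerA mulVf // scale1r PsK.
Qed.

Let pull_closed C : affine_closed C -> exists2 C', pclosed C' &
  forall t, C' <[Ps t]>%VS <-> C t.
Proof.
move=> [P ->]; pose S' := [set H : V -> F | exists2 p, P p & exists d,
  hpoly d H /\ forall (t : 'rV[F]_n) (c : F),
    c != 0 -> H (c *: Ps t) = c ^+ d * p.@[t 0]].
have hS' : all_hpoly S' by move=> H [p _ [d [hd _]]]; exists d.
exists (hzeros S'); first by apply/pclosedP; exists S'.
move=> t; rewrite hzeros_vline //; split=> [H p Pp|H h [p Pp [d [_ hE]]]].
  have [d [h [hd hE]]] := pull p.
  have := H h; rewrite -[Ps t]scale1r hE ?oner_eq0 // expr1n mul1r; apply.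
  by exists p => //; exists d.
by rewrite -[Ps t]scale1r hE ?oner_eq0 // H // mulr0.
Qed.

Let push_closed C : pclosed C -> affine_closed [set t : 'rV[F]_n | C <[Ps t]>%VS].
Proof.
move=> /pclosedP[P hP ->].
exists [set q : {mpoly F[n]} | exists2 h, P h & forall t : 'rV[F]_n, q.@[t 0] = h (Ps t)].
apply/seteqP; split=> t /=; rewrite hzeros_vline // => H.
  by move=> q [h Ph qE]; rewrite qE H.
move=> h Ph; have [d hd] := hP h Ph.
have [q qE] := rV_polyfun_mpoly (polyfun_comp (hpoly_polyfun hd) poly_Ps).
by have := H q; rewrite qE; apply; exists h.
Qed.

Lemma chart_isomorphic : isomorphic (quasiproj S) (affine_space F n).
Proof.
exists f, g; split=> [||L /Ps_surj[t ->]|t _]; last 2 first.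
- by rewrite /g fK.
- exact: fK.
- split=> // _ [C cC ->]; have [C' cC' CE] := pull_closed cC; split.
    exists C' => //; apply/seteqP; split=> L /= [/Ps_surj[t ->]]; rewrite fK.
      by move=> nC; split=> // /CE.
    by move=> nC; split=> // /CE.
  move=> h hreg _ [/= /Ps_surj[t ->]]; rewrite fK => /hreg.
  move=> [D [p [q [cD Dt pq]]]]; have [D' cD' DE] := pull_closed cD.
  have [dp [P [hP PE]]] := pull p; have [dq [Q [hQ QE]]] := pull q.
  have hl e : hpoly e (fun v => l v ^+ e).
    by have := hpolyX e (hpoly_lin lin_l); rewrite muln1.
  (* Crossing the two powers of [l] gives numerator and denominator the common degree dp + dq
     without changing their quotient on the cone. *)
  have [p' hp' p'E] := hpoly_mpoly (hpolyM hP (hl dq)).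
  have [q' hq' q'E] := hpoly_mpoly (hpolyM (hl dp) hQ).
  exists D', (dp + dq)%N, p', q'; split=> // [/DE //|].
  move=> _ [[/Ps_surj[w ->]]]; rewrite /= fK => nC nD v vL v0.
  have [lv vE _] := chart_vec vL v0.
  have [] := pq w; first by split=> // /DE.
  move=> qw ->; rewrite p'E q'E vE PE // QE // -vE.
  split; first by rewrite !mulf_neq0 ?expf_neq0.
  by field; rewrite ?qw ?expf_neq0.
- split=> [t _|_ [C cC ->]]; first exact: S_Ps.
  split.
    exists [set t : 'rV[F]_n | C <[Ps t]>%VS]; first exact: push_closed.
    apply/seteqP; split=> t /=; first by move=> [_ []].
    by move=> nC; split=> //; split=> //; exact: S_Ps.
  move=> h hreg t [_ [_ /= nCt]].
  have [D [d [p [q [cD nD hp hq pq]]]]] := hreg _ (conj (S_Ps t) nCt).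
  have [p' p'E] := rV_polyfun_mpoly
    (polyfun_comp (hpoly_polyfun (mpoly_hpoly hp)) poly_Ps).
  have [q' q'E] := rV_polyfun_mpoly
    (polyfun_comp (hpoly_polyfun (mpoly_hpoly hq)) poly_Ps).
  exists [set t : 'rV[F]_n | D <[Ps t]>%VS], p', q'; split=> //; first exact: push_closed.
  move=> w [[_ Uw] nDw]; rewrite p'E q'E.
  exact: (pq _ (conj Uw nDw) _ (memv_line _) (Ps_neq0 w)).
Qed.

End Chart.

(** * Bivectors *)

Section Bivectors.
Variables (F : fieldType) (V : vectType F).
Local Notation N := (\dim {:V}).
Local Notation e i := ((vbasis {:V})`_(i : 'I_N)).
Implicit Types (A B C D : V) (w : 'M[F]_N).

Lemma linear_0 (U W : lmodType F) (f : U -> W) : linear f -> f 0 = 0.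
Proof.
by move=> h; have := h (-1) 0 0; rewrite scaler0 addr0 scaleN1r addNr.
Qed.
Lemma linear_Z (U W : lmodType F) (f : U -> W) c u : linear f -> f (c *: u) = c *: f u.
Proof. by move=> h; have := h c u 0; rewrite (linear_0 h) !addr0. Qed.
Lemma linear_D (U W : lmodType F) (f : U -> W) u v : linear f -> f (u + v) = f u + f v.
Proof. by move=> h; have := h 1 u v; rewrite !scale1r. Qed.

(* The linear map that sends A /\ B to b(A, B) - b(B, A). *)
Lemma wedgeZ a b A B : wedge (a *: A) (b *: B) = (a * b) *: wedge A B.
Proof. by rewrite linearZ /= wedgeC linearZ /= -scalerN -wedgeC scalerA mulrC. Qed.
Lemma wedge_comb a b c d A B :
  wedge (a *: A + b *: B) (c *: A + d *: B) = (a * d - b * c) *: wedge A B.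
Proof.
have wedgeDr (X Y Z : V) : wedge Z (X + Y) = wedge Z X + wedge Z Y.
  by rewrite (linearD (wedge Z)).
have wedgeDl (X Y Z : V) : wedge (X + Y) Z = wedge X Z + wedge Y Z.
  by rewrite wedgeC wedgeDr opprD -!wedgeC.
rewrite wedgeDl !wedgeDr !wedgeZ !wedgevv !scaler0 add0r addr0 (wedgeC B A).
by rewrite scalerN -scalerBl.
Qed.

(** Since w is meant to be alternating, contracting it with an arbitrary bilinear map already
    antisymmetrises that map. Conditions on a pair of vectors thus become linear conditions on the
    Pluecker vector. *)
Definition walt (U : vectType F) (b : V -> V -> U) w : U :=
  \sum_i \sum_j w i j *: b (e i) (e j).

Lemma walt_linear U b : linear (@walt U b).
Proof.
move=> c w z; rewrite /walt scaler_sumr -big_split; apply: eq_bigr => i _ /=.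
rewrite scaler_sumr -big_split; apply: eq_bigr => j _ /=.
by rewrite !mxE scalerDl scalerA.
Qed.

Lemma walt_wedge U b A B : (forall v, linear (b v)) -> (forall v, linear (b ^~ v)) ->
  @walt U b (wedge A B) = b A B - b B A.
Proof.
move=> b2 b1; have E C D : \sum_i \sum_j (coords C 0 i * coords D 0 j) *: b (e i) (e j) =
    b C D.
  pose h2 v := GRing.isLinear.Build F V U _ (b v) (b2 v).
  pose f2 v : {linear V -> U} := HB.pack (b v) (h2 v).
  pose h1 v := GRing.isLinear.Build F V U _ (b ^~ v) (b1 v).
  pose f1 v : {linear V -> U} := HB.pack (b ^~ v) (h1 v).
  rewrite {2}(coord_vbasis (memvf C)) -[b _ D]/(f1 D _) linear_sum.
  apply: eq_bigr => i _; rewrite linearZ /= {2}(coord_vbasis (memvf D)).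
  rewrite -[b _ _]/(f2 (e i) _) linear_sum scaler_sumr.
  by apply: eq_bigr => j _; rewrite linearZ /= !mxE scalerA.
rewrite -!E /walt -sumrB; apply: eq_bigr => i _.
rewrite -sumrB; apply: eq_bigr => j _.
by rewrite -scalerBl /wedge !mxE !big_ord1 !mxE.
Qed.

(** The interior product with a linear form. It recovers vectors of a plane from its bivector, which
    inverts the Pluecker embedding. *)
Definition contr (l : V -> F) : 'M[F]_N -> V := walt (fun A B => l A *: B).
Lemma contr_linear l : linear (contr l). Proof. exact: walt_linear. Qed.
Lemma contr_wedge l A B : lform l -> contr l (wedge A B) = l A *: B - l B *: A.
Proof.
move=> hl; apply: walt_wedge => v c x y; first by rewrite scalerDr !scalerA mulrC.
by rewrite hl scalerDl scalerA.
Qed.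

Definition ext2_map (g : 'End(V)) : 'M[F]_N -> 'M[F]_N :=
  walt (fun A B => (coords (g A))^T *m coords (g B)).
Lemma ext2_map_linear g : linear (ext2_map g). Proof. exact: walt_linear. Qed.
Lemma ext2_map_wedge g A B : ext2_map g (wedge A B) = wedge (g A) (g B).
Proof.
rewrite /ext2_map walt_wedge // => v c x y.
  by rewrite /= !linearP.
by rewrite /= !linearP /= mulmxDl -scalemxAl.
Qed.

Lemma dim2P (L : {vspace V}) : \dim L = 2%N ->
  exists A B, L = (<[A]> + <[B]>)%VS.
Proof.
move=> dL; have [s sz ->] : exists2 s : seq V, size s = 2%N & L = <<s>>%VS.
  exists (vbasis L); first by rewrite size_tuple dL.
  exact/esym/span_basis/vbasisP.
case: s sz => [|A [|B [|//]]] // _; exists A, B.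
by rewrite !span_cons span_nil addv0.
Qed.

Lemma wedge_dual A B : \dim (<[A]> + <[B]>)%VS = 2%N ->
  exists l m, [/\ lform l, lform m & [/\ l A = 1, l B = 0, m A = 0 & m B = 1]].
Proof.
move=> dL; have fr : free [:: A; B].
  by rewrite /free !span_cons span_nil addv0 dL.
have c (i j : 'I_2) := coord_free i j (fr : free [tuple A; B]).
exists (coord [tuple A; B] 0), (coord [tuple A; B] 1).
split; try exact: lform_coord.
by split; [exact: (c 0 0)|exact: (c 1 0)|exact: (c 0 1)|exact: (c 1 1)].
Qed.

Lemma wedge_dim2 A B : \dim (<[A]> + <[B]>)%VS = 2%N <-> wedge A B != 0.
Proof.
split=> [/wedge_dual[l [m [hl hm [lA lB mA mB]]]]|w0].
  apply/eqP => w0; have := contr_wedge A B hl.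
  rewrite w0 lA lB scale1r scale0r subr0 => B0.
  have : m B = 0 by rewrite -B0 (linear_0 (contr_linear l)) lform0.
  by rewrite mB => /eqP; rewrite oner_eq0.
have A0 : A != 0.
  by apply: contraNneq w0 => ->; rewrite wedgeC linear0 oppr0.
have fr : free [:: A; B].
  apply/freeP => c; rewrite !big_ord_recl big_ord0 /= addr0 => H.
  have c1 : c (lift ord0 ord0) = 0.
    have := congr1 (wedge A) H; rewrite linearD !linearZ /= wedgevv scaler0 add0r.
    by rewrite linear0 => /eqP; rewrite scaler_eq0 (negbTE w0) orbF => /eqP.
  move: H; rewrite c1 scale0r addr0 => /eqP.
  rewrite scaler_eq0 (negbTE A0) orbF => /eqP c0.
  case=> -[|[|//]] lti; [move: c0|move: c1];
    by move=> <-; congr (c _); apply: val_inj.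
have -> : (<[A]> + <[B]>)%VS = <<[:: A; B]>>%VS.
  by rewrite !span_cons span_nil addv0.
exact: eqP fr.
Qed.

Lemma ext2_plane (L : {vspace V}) : \dim L = 2%N ->
  exists A B, [/\ L = (<[A]> + <[B]>)%VS, wedge A B != 0 & ext2 L = <[wedge A B]>%VS].
Proof.
move=> dL; have [A [B LE]] := dim2P dL; exists A, B; split=> //.
  by apply/wedge_dim2; rewrite -LE.
by rewrite LE ext2_line.
Qed.

Lemma limg_pair (g : 'End(V)) A B :
  (g @: (<[A]> + <[B]>))%VS = (<[g A]> + <[g B]>)%VS.
Proof. by rewrite limgD !limg_line. Qed.

(* The plane is spanned by the contractions of its bivector. *)
Lemma wedge_inj A B C D : wedge A B != 0 -> wedge A B = wedge C D ->
  (<[A]> + <[B]> = <[C]> + <[D]>)%VS.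
Proof.
move=> w0 E; have d1 := proj2 (wedge_dim2 A B) w0.
have d2 : \dim (<[C]> + <[D]>)%VS = 2%N by apply/wedge_dim2; rewrite -E.
have [l [m [hl hm [lA lB mA mB]]]] := wedge_dual d1.
apply/eqP; rewrite eqEdim d1 d2 andbT subv_add -!memvE; apply/andP; split.
  have := contr_wedge A B hm; rewrite E contr_wedge // mA mB scale0r scale1r sub0r.
  move=> /(congr1 -%R); rewrite opprK => <-.
  by rewrite opprB memvB ?memvZ // memvE ?addvSl ?addvSr.
have := contr_wedge A B hl; rewrite E contr_wedge // lA lB scale1r scale0r subr0.
by move=> <-; rewrite memvB ?memvZ // memvE ?addvSl ?addvSr.
Qed.

Lemma polymap_wedge (W : vectType F) (f g : W -> V) :
  polymap f -> polymap g -> polymap (fun t => wedge (f t) (g t)).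
Proof.
apply: polymap_bilin => v c x y; first exact: linearP.
by rewrite wedgeC linearP opprD -scalerN -!wedgeC.
Qed.

End Bivectors.

(** * Reductions and automorphisms *)

Section Reductions.
Variables (F : numClosedFieldType) (k : nat).
Hypothesis k3 : (k <= 3)%N.
Local Notation J := (J3 F k).
Local Notation one := (jone F k).
Local Notation N := (\dim {:J}).
Implicit Types (A B X Y Z e f g : J) (w : 'M[F]_N).

Lemma lfunDE (V W : vectType F) (g : 'Hom(V, W)) u v : g (u + v) = g u + g v.
Proof. exact: linearD. Qed.
Lemma lfunBE (V W : vectType F) (g : 'Hom(V, W)) u v : g (u - v) = g u - g v.
Proof. exact: linearB. Qed.
Lemma lfunZE (V W : vectType F) (g : 'Hom(V, W)) c u : g (c *: u) = c *: g u.
Proof. exact: linearZ_LR. Qed.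
Lemma lfun0E (V W : vectType F) (g : 'Hom(V, W)) : g 0 = 0.
Proof. exact: linear0. Qed.

Lemma secant_lines_dim2 (L : {vspace J}) : secant_lines L -> \dim L = 2%N.
Proof.
case/(secant_linesP _ k3) => e [f [g [fr ->]]].
suff fre : free [:: jproj e; jproj f].
  have -> : (<[jproj e]> + <[jproj f]>)%VS = <<[:: jproj e; jproj f]>>%VS.
    by rewrite !span_cons span_nil addv0.
  exact: eqP fre.
have [_ _ [te tf tg] s1] := fr.
apply/freeP => c; rewrite !big_ord_recl big_ord0 /= addr0 => H.
have : (c ord0 - 3%:R^-1 * (c ord0 + c (lift ord0 ord0))) *: e +
       (c (lift ord0 ord0) - 3%:R^-1 * (c ord0 + c (lift ord0 ord0))) *: f +
       (- 3%:R^-1 * (c ord0 + c (lift ord0 ord0))) *: g = 0.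
  rewrite -[RHS]H /jproj te tf -s1; jmodule.
case/(frame_indep fr) => h0 h1 h2.
have c0 : c ord0 = 0.
  have E := f_equal2 (fun u v => u - v) h0 h2.
  by transitivity (0 - 0 : F); [rewrite -E /=; ring|rewrite subrr].
have c1 : c (lift ord0 ord0) = 0.
  have E := f_equal2 (fun u v => u - v) h1 h2.
  by transitivity (0 - 0 : F); [rewrite -E /=; ring|rewrite subrr].
case=> -[|[|//]] lti; [move: c0|move: c1];
  by move=> <-; congr (c _); apply: val_inj.
Qed.

Lemma reductions_plane (L : {vspace J}) : reductions L ->
  exists A B, [/\ L = (<[A]> + <[B]>)%VS, wedge A B != 0,
    ext2 L = <[wedge A B]>%VS, jtr A = 0 & jtr B = 0].
Proof.
case=> -[dL LJ] _; have [A [B [LE w0 E2]]] := ext2_plane dL.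
exists A, B; split=> //; apply/eqP; rewrite -memJ30 (subvP LJ) // LE.
  by rewrite memvE addvSl.
by rewrite memvE addvSr.
Qed.

(** The zero set of a linear form is closed, so its equation spreads from the secant lines, which
    are known through frames, to their closure. *)
Lemma reductions_lform (l : 'M[F]_N -> F) A B : lform l ->
  (forall e f g, frame e f g -> l (wedge (jproj e) (jproj f)) = 0) ->
  reductions (<[A]> + <[B]>)%VS -> l (wedge A B) = 0.
Proof.
move=> hl H [_]; rewrite ext2_line => /(pclosure_lform hl) [].
  move=> _ [M sM <-]; have dM := secant_lines_dim2 sM.
  have /(secant_linesP _ k3)[e [f [g [fr ME]]]] := sM; rewrite ME ext2_line.
  have w0 : wedge (jproj e) (jproj f) != 0 by apply/wedge_dim2; rewrite -ME.
  split; first by rewrite dim_vline w0.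
  by move=> _ /vlineP[c ->]; rewrite lformZ // (H _ _ _ fr) mulr0.
by move=> _; apply; rewrite memv_line.
Qed.

(** For fixed Y and Z the number Q([L_A, L_B] Z, Y) is a linear form in the bivector, and it
    vanishes on frames by [frame_commute]. Nondegeneracy of Q then removes Y. *)
Lemma reductions_commute A B Z : reductions (<[A]> + <[B]>)%VS ->
  jm A (jm B Z) = jm B (jm A Z).
Proof.
move=> rAB; apply/subr0_eq/jQ_nondeg => Y; pose b X X' := jm X (jm X' Z).
have b2 v : linear (b v) by move=> c x y; rewrite /b jmDl jmZl jmDr jmZr.
have b1 v : linear (b ^~ v) by move=> c x y; rewrite /b /= jmDl jmZl.
have bE X X' : walt b (wedge X X') = b X X' - b X' X by exact: walt_wedge.
rewrite -[X in jQ X _](bE A B).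
apply: (reductions_lform (l := fun w => jQ (walt b w) Y)) rAB.
  by move=> c u v; rewrite walt_linear jQDl jQZl.
move=> e f g fr; rewrite bE /b /jproj; have [_ _ [-> -> _] _] := fr.
rewrite !(jmBl, jmBr, jmZl, jmZr, jm1l) (frame_commute k3 _ fr).
rewrite (_ : _ - _ = 0) ?jQ0l //; jmodule.
Qed.

Lemma lform_moment (u : 'End(J)) : lform (fun w => moment w u).
Proof.
have mE w : moment w u = 2%:R^-1 * walt (fun X Y => jQ X (u Y) : F^o) w by [].
by move=> c v w; rewrite !mE walt_linear /GRing.scale /=; ring.
Qed.

(** At an idempotent a derivation satisfies u e = 2 e (u e), so Q(e, u f) = 2 Q(e f, u f) = 0 for
    orthogonal idempotents. As u e and u f have trace 0, passing to the traceless parts of e and f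
    changes nothing. *)
Lemma jder_moment (u : 'End(J)) A B : jder u -> reductions (<[A]> + <[B]>)%VS ->
  moment (wedge A B) u = 0.
Proof.
move=> du rAB; pose b X Y : F^o := jQ X (u Y).
have b2 v : linear (b v) by move=> c x y; rewrite /b linearP jQDr jQZr.
have b1 v : linear (b ^~ v) by move=> c x y; rewrite /b /= jQDl jQZl.
have mE w : moment w u = 2%:R^-1 * walt b w.
  by [].
apply: (reductions_lform (l := fun w => moment w u)) rAB.
  exact: lform_moment.
move=> e f g fr; rewrite mE walt_wedge // /b.
have duE X Y : u (jm X Y) = jm (u X) Y + jm X (u Y) by rewrite !jmE du.
have u1 : u one = 0.
  have := duE one one; rewrite !jm1l jm1r => H.
  by apply: (eq_from (c := - 1) H); jmodule.
have idem X : jm X X = X -> jtr X = 1 -> u X = 2%:R *: jm X (u X) /\ jtr (u X) = 0.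
  move=> XX tX; have uX : u X = 2%:R *: jm X (u X).
    by rewrite -{1}XX duE (jmC (u X)); jmodule.
  split=> //.
  have H := @rank1_U _ _ k3 X (u X); rewrite tX !scale1r in H.
  have {}H := H XX; rewrite -jmZr -uX in H.
  have : jQ X (u X) *: X = 0 by apply: (eq_from (c := -1) H); jmodule.
  move/(congr1 (@jtr F k)); rewrite jtrZ tX jtr0 mulr1 => Q0.
  by rewrite uX jtrZ -jQE Q0 mulr0.
have [[ee ff _] [ef _ _] [te tf _] _] := fr.
have [ue te0] := idem e ee te; have [uf tf0] := idem f ff tf.
have uj X : u (jproj X) = u X by rewrite /jproj lfunBE lfunZE u1 scaler0 subr0.
have jQj X Y : jQ (jproj X) Y = jQ X Y - 3%:R^-1 * jtr X * jtr Y.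
  by rewrite /jproj jQBl jQZl jQC (jQC one) jQ1r.
rewrite !uj !jQj te0 tf0 !mulr0 !subr0 ue uf !jQZr -!jQ_mA (jmC f e) ef !jQ0l.
by rewrite mulr0 subrr mulr0.
Qed.

Lemma reductions_Ua A B w : reductions (<[A]> + <[B]>)%VS ->
  w \in <[wedge A B]>%VS -> Ua w.
Proof.
move=> rAB /vlineP[c ->]; split.
  have [[_ sub] _] := rAB.
  by apply/memvZ/wedge_ext2; apply: (subvP sub); rewrite memvE ?addvSl ?addvSr.
move=> u du; rewrite -[LHS]/((fun w => moment w u) _) lformZ; last exact: lform_moment.
by rewrite jder_moment // mulr0.
Qed.

(* The traceless elements are sums of associators, whose trace is 0. *)
Lemma jassoc_tr X Y Z : jtr (jm (jm X Y) Z - jm X (jm Y Z)) = 0.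
Proof. by rewrite jtrB -!jQE jQ_mA subrr. Qed.

Lemma jaut_m (g : 'End(J)) X Y : jaut g -> g (jm X Y) = jm (g X) (g Y).
Proof. by case=> _ h; rewrite !jmE h. Qed.

Lemma jaut_inv (g : 'End(J)) : jaut g ->
  exists h : 'End(J), [/\ jaut h, cancel g h & cancel h g].
Proof.
move=> ag; have [k0 h] := ag; exists (g^-1)%VF.
have k0' : lker g == 0%VS by rewrite k0.
have c1 : cancel g (g^-1)%VF by move=> X; rewrite -comp_lfunE lker0_compVf ?id_lfunE.
have c2 : cancel (g^-1)%VF g by move=> X; rewrite -comp_lfunE lker0_compfV ?id_lfunE.
split=> //; split; last by move=> X Y; apply: (can_inj c1); rewrite h !c2.
by apply/eqP/lker0P/(can_inj c2).
Qed.

Lemma jaut_comp (g h : 'End(J)) : jaut g -> jaut h -> jaut (g \o h)%VF.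
Proof.
move=> ag ah; have [g' [_ cg _]] := jaut_inv ag; have [h' [_ ch _]] := jaut_inv ah.
split; last by move=> X Y; rewrite !comp_lfunE -!jmE !jaut_m.
apply/eqP/lker0P => X Y; rewrite !comp_lfunE => /(can_inj cg).
by move/(can_inj ch).
Qed.

Lemma jaut1 (g : 'End(J)) : jaut g -> g one = one.
Proof.
move=> ag; have [h [ah c1 c2]] := jaut_inv ag.
by rewrite -[LHS]jm1r -{2}(c2 one) -(jaut_m _ _ ag) jm1l c2.
Qed.

Lemma jaut_tr (g : 'End(J)) X : jaut g -> jtr (g X) = jtr X.
Proof.
move=> ag; have gassoc U V W : jtr (g (jm (jm U V) W - jm U (jm V W))) = 0.
  by rewrite lfunBE !(jaut_m _ _ ag) jassoc_tr.
case: (jmkP X) => d1 d2 d3 x1 x2 x3.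
pose E1 : J := jmk 1 0 0 0 0 0; pose E2 : J := jmk 0 1 0 0 0 0.
pose E3 : J := jmk 0 0 1 0 0 0; pose asc (U V W : J) : J := jm (jm U V) W - jm U (jm V W).
pose u1 : J := jmk 0 0 0 cd1 0 0; pose u3 : J := jmk 0 0 0 0 0 cd1.
have asc1 : asc E2 E2 (jmk 0 0 0 x1 0 0) = 4%:R^-1 *: jmk 0 0 0 x1 0 0.
  rewrite /asc /E2 !(jm_jmk, cd_zero) jmkB jmkZ; apply: jmk_eq; try ring;
  by cdmodule_with ltac:(by field).
have asc2 : asc E3 E3 (jmk 0 0 0 0 x2 0) = 4%:R^-1 *: jmk 0 0 0 0 x2 0.
  rewrite /asc /E3 !(jm_jmk, cd_zero) jmkB jmkZ; apply: jmk_eq; try ring;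
  by cdmodule_with ltac:(by field).
have asc3 : asc E1 E1 (jmk 0 0 0 0 0 x3) = 4%:R^-1 *: jmk 0 0 0 0 0 x3.
  rewrite /asc /E1 !(jm_jmk, cd_zero) jmkB jmkZ; apply: jmk_eq; try ring;
  by cdmodule_with ltac:(by field).
have asc4 : asc u3 u3 E1 = 2%:R^-1 *: (E1 - E2).
  rewrite /asc /u3 /E1 /E2 !(jm_jmk, cd_zero) !jmkB jmkZ !(scale1r, mulr1, cddotZr) -/(cdq cd1)
    cdq1.
  apply: jmk_eq; try (by field); by cdmodule_with ltac:(by field).
have asc5 : asc u1 u1 E2 = 2%:R^-1 *: (E2 - E3).
  rewrite /asc /u1 /E2 /E3 !(jm_jmk, cd_zero) !jmkB jmkZ !(scale1r, mulr1, cddotZr) -/(cdq cd1)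
    cdq1.
  apply: jmk_eq; try (by field); by cdmodule_with ltac:(by field).
(* The scalar part carries the trace. The traceless diagonal is expanded in E1 - E2 and E2 - E3, and
   the coefficients compensate the factors 1/4 and 1/2 of the five associators. *)
have -> : jmk d1 d2 d3 x1 x2 x3 = (3%:R^-1 * (d1 + d2 + d3)) *: one +
    (4%:R *: asc E2 E2 (jmk 0 0 0 x1 0 0) + 4%:R *: asc E3 E3 (jmk 0 0 0 0 x2 0) +
     4%:R *: asc E1 E1 (jmk 0 0 0 0 0 x3) +
     (3%:R^-1 * 2%:R * (2%:R * d1 - d2 - d3)) *: asc u3 u3 E1 +
     (3%:R^-1 * 2%:R * (d1 + d2 - 2%:R * d3)) *: asc u1 u1 E2).
  rewrite asc1 asc2 asc3 asc4 asc5 /E1 /E2 /E3 jone_jmk !jmkB !jmkZ !jmkD.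
  by apply: jmk_eq; try (by field); by cdmodule_with ltac:(by field).
rewrite lfunDE [g (_ *: one)]lfunZE (jaut1 ag) !jtrD; congr (_ + _).
by rewrite !lfunDE !jtrD !lfunZE !jtrZ /asc !gassoc !jassoc_tr.
Qed.

Lemma jaut_jQ (g : 'End(J)) X Y : jaut g -> jQ (g X) (g Y) = jQ X Y.
Proof. by move=> ag; rewrite !jQE -jaut_m // jaut_tr. Qed.

Lemma jaut_frame (g : 'End(J)) e f h : jaut g -> frame e f h ->
  frame (g e) (g f) (g h).
Proof.
move=> ag [[ee ff hh] [ef eh fh] [te tf th] s1].
by split; [split|split|split|]; rewrite -?(jaut_m _ _ ag) ?jaut_tr -?lfunDE
  ?ee ?ff ?hh ?ef ?eh ?fh ?s1 ?lfun0E ?(jaut1 ag).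
Qed.

Lemma jaut_reductions (g : 'End(J)) (L : {vspace J}) : jaut g ->
  reductions L -> reductions (g @: L)%VS.
Proof.
move=> ag rL; have [A [B [LE w0 LE2 tA tB]]] := reductions_plane rL.
have [h [ah c1 c2]] := jaut_inv ag.
have wg C D : wedge C D != 0 -> wedge (g C) (g D) != 0.
  apply: contraNneq => w; rewrite -[C]c1 -[D]c1 -ext2_map_wedge w.
  by rewrite (linear_0 (ext2_map_linear h)).
have [_ cL] := rL; rewrite LE limg_pair; split.
  split; first exact/wedge_dim2/wg.
  by rewrite subv_add -!memvE !memJ30 !jaut_tr // tA tB eqxx.
rewrite ext2_line => Z cZ sZ.
have [Z' cZ' Z'E] := pclosed_preim (ext2_map_linear g) cZ.
rewrite -ext2_map_wedge; apply/Z'E => //; first by rewrite ext2_map_wedge wg.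
rewrite -LE2; apply: cL => // _ [M sM <-].
have dM := secant_lines_dim2 sM.
have /(secant_linesP _ k3)[e [f [f' [fr ME]]]] := sM; rewrite ME ext2_line.
have we0 : wedge (jproj e) (jproj f) != 0 by apply/wedge_dim2; rewrite -ME.
apply/Z'E => //; rewrite ext2_map_wedge; first exact: wg.
apply: sZ; exists (<[g (jproj e)]> + <[g (jproj f)]>)%VS; last exact: ext2_line.
apply/secant_linesP => //; exists (g e), (g f), (g f').
split; first exact: jaut_frame.
have gj X : g (jproj X) = jproj (g X).
  by rewrite /jproj lfunBE lfunZE (jaut1 ag) jaut_tr.
by rewrite !gj.
Qed.

End Reductions.


(** Lets a map be given by its effect on the six entries while all computation goes through the
    locked constructor, by [jcaseE]. *)
Definition jcase (F : fieldType) k (T : Type)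
    (h : F -> F -> F -> CD F k -> CD F k -> CD F k -> T) (X : J3 F k) : T :=
  let: (d1, d2, d3, (x1, x2, x3)) := X in h d1 d2 d3 x1 x2 x3.

(** * Explicit automorphisms: permutations, triality, exponentials of nilpotent derivations *)

Section Automorphisms.
Variables (F : numClosedFieldType) (k : nat).
Hypothesis k3 : (k <= 3)%N.
Local Notation A := (CD F k).
Local Notation J := (J3 F k).
Implicit Types (a b c x y : A) (X Y : J).

Lemma jcaseE T (h : F -> F -> F -> A -> A -> A -> T) d1 d2 d3 x1 x2 x3 :
  jcase h (jmk d1 d2 d3 x1 x2 x3) = h d1 d2 d3 x1 x2 x3.
Proof. by rewrite unlock. Qed.

Lemma jm_sq (d1 d2 d3 : F) x1 x2 x3 :
  jm (jmk d1 d2 d3 x1 x2 x3) (jmk d1 d2 d3 x1 x2 x3) =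
  jmk (d1 * d1 + cdq x2 + cdq x3) (d2 * d2 + cdq x3 + cdq x1)
      (d3 * d3 + cdq x1 + cdq x2) ((d2 + d3) *: x1 + cj (x2 ** x3))
      ((d3 + d1) *: x2 + cj (x3 ** x1)) ((d1 + d2) *: x3 + cj (x1 ** x2)).
Proof. by rewrite jm_jmk; apply: jmk_eq; rewrite // /cdq; cdmodule_with ltac:(by field). Qed.

(** Obtained by writing y c as twice its real part minus its conjugate. For isotropic [c] only the
    first term remains, so sandwiching by [c] maps into the line of [c]. *)
Lemma cd_sandwich c y :
  c ** (y ** c) = (2%:R * cddot c (cj y)) *: c - cdq c *: cj y.
Proof.
rewrite -[y ** c]cdconjK cdconjE cdmulBr cdmulZr cdmul1r cdconjM (cdmulVl k3).
by rewrite -cdconjM cdre_conj -cdre_mul cdre_mulC.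
Qed.

(** Squares suffice by polarisation, and the trace gives injectivity: if f X = 0 then Q(X, Y) = tr
    f(X Y) = 0 for every Y. *)
Lemma mk_jaut (f : J -> J) : linear f ->
  (forall X, f (jm X X) = jm (f X) (f X)) -> (forall X, jtr (f X) = jtr X) ->
  exists g : 'End(J), jaut g /\ forall X, g X = f X.
Proof.
move=> lf sf tf; pose h := GRing.isLinear.Build F J J _ f lf.
pose fl : {linear J -> J} := HB.pack f h.
exists (linfun fl); have gE X : linfun fl X = f X by rewrite lfunE.
have mf X Y : f (jm X Y) = jm (f X) (f Y).
  have E (U V : J) : jm U V = 2%:R^-1 *: (jm (U + V) (U + V) - jm U U - jm V V).
    rewrite !(jmDl, jmDr) (jmC V U); jmodule_with ltac:(by field).
  have fZ (s : F) (U : J) : f (s *: U) = s *: f U by apply: linear_Z.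
  have fD (U V : J) : f (U + V) = f U + f V by apply: linear_D.
  have fN (U : J) : f (- U) = - f U by rewrite -scaleN1r fZ scaleN1r.
  by rewrite E fZ !fD !fN !sf fD -E.
split=> //; split; last by move=> X Y; rewrite !gE -!jmE mf.
apply/eqP; rewrite -subv0; apply/subvP => X; rewrite memv_ker gE memv0 => /eqP fX.
apply/eqP/jQ_nondeg => Y.
by rewrite jQE -tf mf fX jm0l jtr0.
Qed.

Ltac jaut_linear :=
  let c := fresh in let X := fresh in let Y := fresh in
  move=> c X Y; case: (jmkP X) => ? ? ? ? ? ?; case: (jmkP Y) => ? ? ? ? ? ?;
  rewrite !jmkZ !jmkD !jcaseE !jmkZ !jmkD; apply: jmk_eq;
  rewrite ?(cdmulDl, cdmulDr, cdmulZl, cdmulZr, cdconjD, cdconjZ, cddotDr, cddotZr);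
  try ring.

Lemma cyc_jaut : exists g : 'End(J), jaut g /\ forall d1 d2 d3 x1 x2 x3,
  g (jmk d1 d2 d3 x1 x2 x3) = jmk d2 d3 d1 x2 x3 x1.
Proof.
have [||X|g [ag gE]] := @mk_jaut (jcase (fun d1 d2 d3 x1 x2 x3 => jmk d2 d3 d1 x2 x3 x1)).
- by jaut_linear.
- move=> X; case: (jmkP X) => d1 d2 d3 x1 x2 x3.
  by rewrite jm_jmk !jcaseE jm_jmk; apply: jmk_eq; first [ring|cdmodule].
- by case: (jmkP X) => *; rewrite jcaseE !jtr_jmk; ring.
- by exists g; split=> // *; rewrite gE jcaseE.
Qed.

(** Conjugation by the permutation matrix that exchanges the indices 1 and 3: the entry at (2,3)
    becomes the one at (2,1), which is [cj x3]. *)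
Lemma transpose_jaut : exists g : 'End(J), jaut g /\ forall d1 d2 d3 x1 x2 x3,
  g (jmk d1 d2 d3 x1 x2 x3) = jmk d3 d2 d1 (cj x3) (cj x2) (cj x1).
Proof.
have [||X|g [ag gE]] :=
  @mk_jaut (jcase (fun d1 d2 d3 x1 x2 x3 => jmk d3 d2 d1 (cj x3) (cj x2) (cj x1))).
- by jaut_linear.
- move=> X; case: (jmkP X) => d1 d2 d3 x1 x2 x3.
  rewrite jm_jmk !jcaseE jm_jmk !cddot_conj; apply: jmk_eq; try ring;
  by rewrite cdconjZ !cdconjD !cdconjZ !cdconjM !cdconjK; cdmodule.
- by case: (jmkP X) => *; rewrite jcaseE !jtr_jmk; ring.
- by exists g; split=> // *; rewrite gE jcaseE.
Qed.

(** Triality for a unit: right multiplication, sandwich by the conjugate, left multiplication. The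
    compatibility of each product of two entries with the third entry is one of the three Moufang
    identities. *)
Lemma trial_jaut c : cdq c = 1 ->
  exists g : 'End(J), jaut g /\ forall d1 d2 d3 x1 x2 x3,
  g (jmk d1 d2 d3 x1 x2 x3) = jmk d1 d2 d3 (x1 ** c) (cj c ** (x2 ** cj c)) (c ** x3).
Proof.
move=> qc; have [||X|g [ag gE]] := @mk_jaut (jcase (fun d1 d2 d3 x1 x2 x3 =>
    jmk d1 d2 d3 (x1 ** c) (cj c ** (x2 ** cj c)) (c ** x3))).
- by jaut_linear.
- move=> X; case: (jmkP X) => d1 d2 d3 x1 x2 x3.
  rewrite jm_sq !jcaseE jm_sq !(cdqM k3) cdq_conj qc !(mul1r, mulr1).
  apply: jmk_eq => //.
  + rewrite (moufang_l k3) (cdmulKl k3) qc scale1r !cdconjM cdconjK.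
    by rewrite !(cdmulDl, cdmulZl); cdmodule.
  + rewrite (moufang_mid k3) !(cdconjM, cdmulDl, cdmulDr, cdmulZl, cdmulZr).
    by rewrite -!(cd_flex k3); cdmodule.
  + rewrite (moufang_r k3) (cdmulKr k3) qc scale1r !cdconjM cdconjK.
    by rewrite !(cdmulDr, cdmulZr); cdmodule.
- by case: (jmkP X) => *; rewrite jcaseE !jtr_jmk; ring.
- by exists g; split=> // *; rewrite gE jcaseE.
Qed.

(** The exponential of a nilpotent derivation attached to the position (1,2). As [c] is isotropic,
    the only term beyond first order is - 2 (c, x3) c in the last entry. *)
Lemma tau_jaut c : cdq c = 0 ->
  exists g : 'End(J), jaut g /\ forall d1 d2 d3 x1 x2 x3,
  g (jmk d1 d2 d3 x1 x2 x3) =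
  jmk (d1 + 2%:R * cddot c x3) (d2 - 2%:R * cddot c x3) d3
      (x1 - cj (x2 ** c)) (x2 + cj (c ** x1))
      (x3 + (d2 - d1 - 2%:R * cddot c x3) *: c).
Proof.
move=> qc; have [||X|g [ag gE]] := @mk_jaut (jcase (fun d1 d2 d3 x1 x2 x3 =>
  jmk (d1 + 2%:R * cddot c x3) (d2 - 2%:R * cddot c x3) d3
      (x1 - cj (x2 ** c)) (x2 + cj (c ** x1))
      (x3 + (d2 - d1 - 2%:R * cddot c x3) *: c))).
- by jaut_linear; cdmodule.
- move=> X; case: (jmkP X) => d1 d2 d3 x1 x2 x3.
  rewrite jm_sq !jcaseE jm_sq.
  have pE1 : cddot x2 (cj (c ** x1)) = cddot c (cj (x1 ** x2)).
    by rewrite -!cdre_mul cdre_cycle.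
  have pE2 : cddot x1 (cj (x2 ** c)) = cddot c (cj (x1 ** x2)).
    by rewrite -!cdre_mul -cdre_cycle.
  rewrite !(cddotDr, cddotZr) !(cdqD, cdqN, cdqZ, cdq_conj, cdqM k3) qc.
  rewrite !(cddotZr, cddotNr) (cddotC x3 c) pE1 pE2; set p := cddot c (cj _); set t := cddot c x3.
  have L1 : cj x3 ** (c ** x1) = (2%:R * t) *: x1 - cj c ** (x3 ** x1).
    by rewrite -(cdmul_lin k3) addrC addKr.
  have L2 : x2 ** c ** cj x3 = (2%:R * t) *: x2 - (x2 ** x3) ** cj c.
    by rewrite -(cdmul_linr k3) addrC addKr.
  have L3 : c ** x1 ** (x2 ** c) = (2%:R * p) *: c.
    by rewrite (moufang_mid k3) cd_sandwich qc scale0r subr0.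
  apply: jmk_eq; try ring;
    rewrite !(cdmulDl, cdmulDr, cdmulNl, cdmulNr, cdmulZl, cdmulZr, cdconjD, cdconjN,
      cdconjZ, cdconjM, cdconjK) ?L1 ?L2 ?L3 ?(cdmulKl k3) ?(cdmulKr k3) ?qc.
  + by cdmodule.
  + by cdmodule.
  + by cdmodule.
- by case: (jmkP X) => *; rewrite jcaseE !jtr_jmk; ring.
- by exists g; split=> // *; rewrite gE jcaseE.
Qed.

(** Infinitesimal triality for the rotation defined by [a] and [b]: the two half-spin actions, on x1
    and on x2, induce the vector action on the conjugate of x1 x2. *)
Lemma sigma_mul a b x1 x2 : cddot a b = 0 ->
  x1 ** ((x2 ** b) ** cj a) + (cj a ** (b ** x1)) ** x2 =
  (2%:R * cddot b (cj (x1 ** x2))) *: cj a - (2%:R * cddot a (cj (x1 ** x2))) *: cj b.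
Proof.
move=> ab; apply: cddot_inj => z; rewrite cddotDl cddotBl !cddotZl.
have -> : cddot (x1 ** ((x2 ** b) ** cj a)) z = - cddot (cj x1 ** z ** b) (x2 ** a).
  rewrite cddot_mull cddot_mulr cdconjK; apply/eqP; rewrite -addr_eq0.
  by rewrite (cddot_exch k3) (cddotC b) ab mulr0.
have -> : cddot (cj a ** (b ** x1) ** x2) z =
    2%:R * cddot b (cj (x1 ** x2)) * cddot (cj a) z -
    cddot (cj x1 ** cj b ** cj z) (x2 ** a).
  have := cddot_exch k3 (cj a) (b ** x1) z (cj x2).
  rewrite -cddot_mulr (cddot_mulr b) => E.
  rewrite -(cddot_conj _ (x2 ** a)) !cdconjM !cdconjK.
  by rewrite -mulrA (mulrC _ (cddot (cj a) z)) mulrA -E addrK.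
have := cdmul_linr k3 (cj b) z (cj x1); rewrite cdconjK => H.
have -> : 2%:R * cddot a (cj (x1 ** x2)) * cddot (cj b) z =
    cddot (cj x1 ** z ** b) (x2 ** a) + cddot (cj x1 ** cj b ** cj z) (x2 ** a).
  have aE : cddot a (cj (x1 ** x2)) = cddot (cj x1) (x2 ** a).
    by rewrite -(cddotJr x1) -!cdre_mul cdre_cycle.
  by rewrite -cddotDl H cddotZl aE; ring.
by ring.
Qed.

(** The exponential of the derivation behind [sigma_mul], which kills the diagonal. It stops at
    first order because [a] and [b] span a totally isotropic subspace, so that the square of each of
    the three actions is 0. *)
Lemma sigma_jaut a b : cdq a = 0 -> cdq b = 0 -> cddot a b = 0 ->
  exists g : 'End(J), jaut g /\ forall d1 d2 d3 x1 x2 x3,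
  g (jmk d1 d2 d3 x1 x2 x3) =
  jmk d1 d2 d3 (x1 - cj a ** (b ** x1)) (x2 - x2 ** b ** cj a)
      (x3 + (2%:R * cddot a x3) *: b - (2%:R * cddot b x3) *: a).
Proof.
move=> qa qb ab; have [||X|g [ag gE]] := @mk_jaut (jcase (fun d1 d2 d3 x1 x2 x3 =>
  jmk d1 d2 d3 (x1 - cj a ** (b ** x1)) (x2 - x2 ** b ** cj a)
      (x3 + (2%:R * cddot a x3) *: b - (2%:R * cddot b x3) *: a))).
- by jaut_linear; cdmodule.
- move=> X; case: (jmkP X) => d1 d2 d3 x1 x2 x3.
  have aba u : b ** (cj a ** (b ** u)) = 0.
    have := cdmul_lin k3 (cj b) (cj a) (b ** u).
    by rewrite !cdconjK cddot_conj (cddotC b) ab mulr0 scale0r (cdmulKl k3) qb scale0r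
      cdmul0r addr0.
  have bab u : u ** b ** cj a ** b = 0.
    have := cdmul_linr k3 (cj b) (cj a) (u ** b).
    by rewrite !cdconjK cddot_conj (cddotC b) ab mulr0 scale0r (cdmulKr k3) qb scale0r
      cdmul0l addr0.
  have x1E : cdq (x1 - cj a ** (b ** x1)) = cdq x1.
    rewrite cdqB !(cdqM k3) cdq_conj qa mul0r -cddot_mull.
    have := cddot_exch k3 a x1 b x1; rewrite (cddotC (b ** x1)) ab mulr0 mul0r => E.
    by rewrite (_ : 2%:R * _ = 0); [ring|rewrite -[RHS]E; ring].
  have x2E : cdq (x2 - x2 ** b ** cj a) = cdq x2.
    rewrite cdqB !(cdqM k3) cdq_conj qa mulr0 -cddot_mulr.
    have := cddot_exch k3 x2 a x2 b; rewrite ab mulr0 => E.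
    by rewrite (_ : 2%:R * _ = 0); [ring|rewrite -[RHS]E; ring].
  have x3E : cdq (x3 + (2%:R * cddot a x3) *: b - (2%:R * cddot b x3) *: a) = cdq x3.
    rewrite cdqB cdqD !cdqZ cddotDl !cddotZl !cddotZr qa qb (cddotC b a) ab.
    by rewrite (cddotC x3 b) (cddotC x3 a); ring.
  rewrite jm_sq !jcaseE jm_sq x1E x2E x3E {x1E x2E x3E}.
  set x1' := x1 - cj a ** (b ** x1); set x2' := x2 - _ ** cj a.
  set x3' := x3 + _ - _ *: a.
  have H1 : x2' ** x3' = x2 ** x3 - x2 ** x3 ** cj b ** a.
    rewrite /x2' /x3' !(cdmulDl, cdmulDr, cdmulNl, cdmulNr, cdmulZl, cdmulZr).
    rewrite bab (cdmulVr k3) qa scale0r.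
    have := cdmul_linr k3 (cj x3) (cj a) (x2 ** b).
    rewrite !cdconjK cddot_conj (cddotC x3 a) => E1.
    have := congr1 (fun u => u ** a) (cdmul_linr k3 x3 b x2).
    rewrite /= cdmulDl cdmulZl (cddotC x3 b) => E2.
    have E := f_equal2 (fun u v => u - v) E2 E1.
    by apply: (eq_from (c := 1) E); cdmodule.
  have H2 : x3' ** x1' = x3 ** x1 - a ** (cj b ** (x3 ** x1)).
    rewrite /x1' /x3' !(cdmulDl, cdmulDr, cdmulNl, cdmulNr, cdmulZl, cdmulZr).
    rewrite aba (cdmulVl k3) qa scale0r.
    have := cdmul_lin k3 (cj x3) (cj a) (b ** x1).
    rewrite !cdconjK cddot_conj (cddotC x3 a) => E1.
    have := congr1 (fun u => a ** u) (cdmul_lin k3 x3 b x1).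
    rewrite /= cdmulDr cdmulZr (cddotC x3 b) => E2.
    have E := f_equal2 (fun u v => u - v) E2 E1.
    by apply: (eq_from (c := 1) E); cdmodule.
  have H3 : x1' ** x2' = x1 ** x2 - (2%:R * cddot b (cj (x1 ** x2))) *: cj a +
      (2%:R * cddot a (cj (x1 ** x2))) *: cj b.
    rewrite /x1' /x2' !(cdmulDl, cdmulDr, cdmulNl, cdmulNr).
    rewrite (moufang_mid k3) (moufang_mid k3 b) (cd_sandwich b) qb scale0r subr0 cdmulZl.
    rewrite cdmulZr (cd_sandwich (cj a)) cdq_conj qa cddot_conj ab mulr0 !scale0r subr0 scaler0.
    have E := sigma_mul x1 x2 ab.
    by apply: (eq_from (c := -1) E); cdmodule.
  rewrite H1 H2 H3.
  apply: jmk_eq => //; rewrite ?/x1' ?/x2' ?/x3' ?(cddotDr, cddotZr)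
    ?(cdmulDl, cdmulDr, cdmulNl, cdmulNr, cdmulZl, cdmulZr, cdconjD, cdconjN,
      cdconjZ, cdconjM, cdconjK); cdmodule.
- by case: (jmkP X) => *; rewrite jcaseE !jtr_jmk; ring.
- by exists g; split=> // *; rewrite gE jcaseE.
Qed.

End Automorphisms.

(** * Bivectors orthogonal to the closed orbit *)

Section ScalarBasis.
Variable F : fieldType.

(** An orthonormal basis; it serves to take a trace over the whole algebra in [never_polar_star]. *)
Fixpoint cdbasis k : seq (CD F k) :=
  if k is k'.+1 return seq (CD F k) then
    [seq ((x, 0) : CD F k'.+1) | x <- cdbasis k'] ++
    [seq ((0, x) : CD F k'.+1) | x <- cdbasis k']
  else [:: (1 : F^o)].

Lemma cdbasis_sum k (W : lmodType F) (f : {linear CD F k -> W}) x :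
  \sum_(m <- cdbasis k) cddot x m *: f m = f x.
Proof.
elim: k W f x => [|k IHk] W f x.
  rewrite big_seq1 -linearZ; congr (f _).
  by rewrite /cddot /= /GRing.scale /= !mulr1.
rewrite big_cat !big_map.
pose f1 : CD F k -> W := fun y => f (y, 0); pose f2 : CD F k -> W := fun y => f (0, y).
have l1 : linear f1.
  by move=> c y z; rewrite /f1 -linearP; congr (f _); congr pair; rewrite /= scaler0 addr0.
have l2 : linear f2.
  by move=> c y z; rewrite /f2 -linearP; congr (f _); congr pair; rewrite /= scaler0 addr0.
pose h1 := GRing.isLinear.Build F (CD F k) W _ f1 l1.
pose g1 : {linear CD F k -> W} := HB.pack f1 h1.
pose h2 := GRing.isLinear.Build F (CD F k) W _ f2 l2.
pose g2 : {linear CD F k -> W} := HB.pack f2 h2.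
have E1 := IHk W g1 x.1; have E2 := IHk W g2 x.2.
have -> : f x = f1 x.1 + f2 x.2.
  rewrite /f1 /f2 -linearD; congr (f _); rewrite [LHS]surjective_pairing.
  by congr pair; rewrite /= ?addr0 ?add0r.
rewrite -[f1 _]E1 -[f2 _]E2; congr (_ + _); apply: eq_bigr => m _;
  by rewrite cddot_pair /= cddot0r ?addr0 ?add0r.
Qed.

Lemma cdbasis_q k m : m \in cdbasis k -> cdq m = 1.
Proof.
elim: k m => [|k IHk] m; first by rewrite inE => /eqP ->; rewrite /cdq /cddot /= mulr1.
by rewrite mem_cat => /orP[] /mapP[x /IHk qx ->];
  rewrite /cdq cddot_pair /= cddot0l ?addr0 ?add0r.
Qed.

Lemma size_cdbasis k : size (cdbasis k) = (2 ^ k)%N.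
Proof. by elim: k => //= k IHk; rewrite size_cat !size_map IHk expnS mul2n addnn. Qed.

End ScalarBasis.

Section BarSwap.
Variables (F : numClosedFieldType) (k : nat).
Local Notation A := (CD F k.+1).
Local Notation J := (J3 F k.+1).

(** The grading automorphism of the last doubling, not the conjugation. It exchanges [eps] with its
    conjugate, and so the two Peirce spaces of [eps]. *)
Definition bar (x : A) : A := (x.1, - x.2).

Lemma bar_linear : linear bar.
Proof. by move=> c x y; congr pair; rewrite /= opprD scalerN. Qed.
Lemma barM x y : bar (x ** y) = bar x ** bar y.
Proof.
case: x y => [x1 x2] [y1 y2]; rewrite /bar /=; congr pair.
  by rewrite cdconjN cdmulNl cdmulNr opprK.
by rewrite !cdmulNl opprD.
Qed.
Lemma bar_conj x : bar (cj x) = cj (bar x). Proof. by []. Qed.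
Lemma bar_dot x y : cddot (bar x) (bar y) = cddot x y.
Proof. by rewrite !cddot_pair /= cddotNl cddotNr opprK. Qed.

Lemma bar_jaut : exists g : 'End(J), jaut g /\ forall d1 d2 d3 x1 x2 x3,
  g (jmk d1 d2 d3 x1 x2 x3) = jmk d1 d2 d3 (bar x1) (bar x2) (bar x3).
Proof.
have bD x y : bar (x + y) = bar x + bar y by exact: linear_D bar_linear.
have bZ c x : bar (c *: x) = c *: bar x by exact: linear_Z bar_linear.
have [||X|g [ag gE]] := @mk_jaut F k.+1 (jcase (fun d1 d2 d3 x1 x2 x3 =>
  jmk d1 d2 d3 (bar x1) (bar x2) (bar x3))).
- move=> c X Y; case: (jmkP X) => ? ? ? ? ? ?; case: (jmkP Y) => ? ? ? ? ? ?.
  by rewrite !jmkZ !jmkD !jcaseE !jmkZ !jmkD !bD !bZ.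
- move=> X; case: (jmkP X) => d1 d2 d3 x1 x2 x3.
  rewrite jm_sq !jcaseE jm_sq /cdq !bar_dot.
  by apply: jmk_eq; rewrite // bD bZ bar_conj barM.
- by case: (jmkP X) => *; rewrite jcaseE !jtr_jmk.
- by exists g; split=> // *; rewrite gE jcaseE.
Qed.

(** Half of 1 + i j, where j is the new unit of the last doubling and i a scalar with i^2 = -1. As
    j^2 = -1 too, this is an isotropic idempotent. *)
Definition eps : A := (cdscal k 2%:R^-1, cdscal k ('i / 2%:R)).

Lemma bar_eps : bar eps = cj eps.
Proof. by rewrite /bar /eps /= cdconj_scal. Qed.
Lemma eps_re : cdre eps = 2%:R^-1.
Proof. exact: cdscalK. Qed.
Lemma eps_q : cdq eps = 0.
Proof.
rewrite /cdq cddot_pair /= (cdscalE k 2%:R^-1) (cdscalE k ('i / 2%:R)).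
rewrite !cddotZl !cddotZr -/(cdq cd1) cdq1.
have i2 : 'i * 'i = -1 :> F by rewrite -expr2 sqrCi.
by rewrite !mulr1 mulrACA i2; field.
Qed.

End BarSwap.

HB.lock Definition im_eps (F : numClosedFieldType) k : CD F k.+1 :=
  eps F k - 2%:R^-1 *: cd1.

Lemma im_epsE (F : numClosedFieldType) k :
  im_eps F k = eps F k - 2%:R^-1 *: cd1.
Proof. by rewrite unlock. Qed.

(** * Relations between the entries at (1,2) and (3,1) of a bivector orthogonal to the orbit *)

Section Polar.
Variables (F : numClosedFieldType) (k' : nat).
Local Notation k := k'.+1.
Hypothesis k3 : (k <= 3)%N.
Local Notation A := (CD F k).
Local Notation J := (J3 F k).
Local Notation eps := (eps F k').
Local Notation p1 x := (jmk 0 0 0 x 0 0).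
Local Notation p2 x := (jmk 0 0 0 0 x 0).
Local Notation p3 x := (jmk 0 0 0 0 0 x).
Implicit Types (B C X Y : J) (c e m n u v w x y : A) (g : 'End(J)).

(* The value of B /\ C on X /\ Y. *)
Definition jw B C X Y : F := jQ B X * jQ C Y - jQ C X * jQ B Y.

Lemma jw_jaut g B C X Y : jaut g -> jw (g B) (g C) (g X) (g Y) = jw B C X Y.
Proof. by move=> ag; rewrite /jw !jaut_jQ. Qed.
Lemma jwC B C X Y : jw B C X Y = - jw B C Y X.
Proof.
rewrite /jw; move: (jQ B X) (jQ C Y) (jQ C X) (jQ B Y) => a b c d.
by ring.
Qed.
Lemma jwDr B C X Y Z : jw B C X (Y + Z) = jw B C X Y + jw B C X Z.
Proof.
rewrite /jw !jQDr; move: (jQ B X) (jQ C Y) (jQ C X) (jQ B Y) (jQ B Z) (jQ C Z).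
by move=> a b c d e f; ring.
Qed.
Lemma jwDl B C X Y Z : jw B C (Y + Z) X = jw B C Y X + jw B C Z X.
Proof.
rewrite /jw !jQDr; move: (jQ B X) (jQ C Y) (jQ C X) (jQ B Y) (jQ B Z) (jQ C Z).
by move=> a b c d e f; ring.
Qed.
Lemma jwZr B C X a Y : jw B C X (a *: Y) = a * jw B C X Y.
Proof.
rewrite /jw !jQZr; move: (jQ B X) (jQ C Y) (jQ C X) (jQ B Y) => b c d e.
by ring.
Qed.
Lemma jwZl B C X a Y : jw B C (a *: Y) X = a * jw B C Y X.
Proof.
rewrite /jw !jQZr; move: (jQ B X) (jQ C Y) (jQ C X) (jQ B Y) => b c d e.
by ring.
Qed.

Lemma p1D x y : p1 (x + y) = p1 x + p1 y. Proof. by rewrite jmkD !addr0. Qed.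
Lemma p2D x y : p2 (x + y) = p2 x + p2 y. Proof. by rewrite jmkD !addr0. Qed.
Lemma p3D x y : p3 (x + y) = p3 x + p3 y. Proof. by rewrite jmkD !addr0. Qed.
Lemma p2Z a x : p2 (a *: x) = a *: p2 x. Proof. by rewrite jmkZ !mulr0 !scaler0. Qed.
Lemma p3Z a x : p3 (a *: x) = a *: p3 x. Proof. by rewrite jmkZ !mulr0 !scaler0. Qed.

(** The situation refuted in [polar_exists], in a form stable under automorphisms. The orthogonality
    relations are linear in the bivector; commutation supplies the further information that
    [never_polar_star] needs. *)
Definition never_polar B C :=
  [/\ forall Z, jm B (jm C Z) = jm C (jm B Z), jtr B = 0, jtr C = 0 &
      forall g, jaut g -> jw (g B) (g C) (p3 eps) (p2 (cj eps)) = 0].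

Lemma never_polar_jaut g B C : jaut g -> never_polar B C -> never_polar (g B) (g C).
Proof.
move=> ag [com tB tC np]; have [h [ah hK gK]] := jaut_inv ag.
split; rewrite ?jaut_tr //.
  by move=> Z; rewrite -[Z]gK -!(jaut_m _ _ ag) com.
move=> g' ag'.
rewrite -(comp_lfunE g' g B) -(comp_lfunE g' g C).
exact/np/jaut_comp.
Qed.

(** Never polar pairs are stable under automorphisms, so a relation valid for all of them may be
    transported to other vectors. Every new vanishing below is obtained in this way from an earlier
    one. *)
Lemma never_polar_ind (P : (J -> J -> F) -> Prop) g : jaut g ->
  (forall B C, never_polar B C -> P (jw B C)) ->
  forall B C, never_polar B C -> P (fun X Y => jw B C (g X) (g Y)).
Proof.
move=> ag H B C np; have [h [ah hK gK]] := jaut_inv ag.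
have := H _ _ (never_polar_jaut ah np).
have -> // : jw (h B) (h C) = fun X Y => jw B C (g X) (g Y).
by apply/funext => X; apply/funext => Y; rewrite -[in RHS](gK B) -[in RHS](gK C) jw_jaut.
Qed.

(* (2, 3)-bivectors orthogonal to all never polar ones. *)
Definition Kvec n m := forall B C, never_polar B C -> jw B C (p3 n) (p2 m) = 0.

Lemma Kvec_jaut g n m n' m' : jaut g -> g (p3 n) = p3 n' -> g (p2 m) = p2 m' ->
  Kvec n m -> Kvec n' m'.
Proof.
move=> ag gn gm H B C np; rewrite -gn -gm.
apply: (never_polar_ind (P := fun w : J -> J -> F => w (p3 n) (p2 m) = 0) ag _ np).
by move=> B' C'; exact: H.
Qed.

Lemma Kvec_eps : Kvec eps (cj eps).
Proof.
move=> B C [_ _ _ np]; have [g [ag gE]] := @trial_jaut F k k3 cd1 (cdq1 F k).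
have gid X : g X = X.
  by case: (jmkP X) => *; rewrite gE cdconj1 !cdmul1l !cdmul1r.
by have := np g ag; rewrite !gid.
Qed.

Lemma Kvec_bar n m : Kvec n m -> Kvec (bar n) (bar m).
Proof.
have [g [ag gE]] := bar_jaut F k'.
have b0 : bar 0 = 0 :> A by exact: linear_0 (@bar_linear F k').
by apply: (Kvec_jaut ag); rewrite gE b0.
Qed.

Lemma Kvec_mull c n m : cdq c = 1 -> Kvec n m ->
  Kvec (c ** n) (cj c ** (m ** cj c)).
Proof.
move=> qc; have [g [ag gE]] := trial_jaut k3 qc.
by apply: (Kvec_jaut ag); rewrite gE !cd_zero.
Qed.

(** The triality automorphism is conjugated by the cyclic one, so that the entry at (1,2) is the one
    multiplied on the right and the entry at (3,1) the one multiplied on the left. *)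
Lemma Kvec_mulr c n m : cdq c = 1 -> Kvec n m -> Kvec (n ** c) (c ** m).
Proof.
move=> qc; have [g [ag gE]] := trial_jaut k3 qc.
have [r [ar rE]] := cyc_jaut F k.
apply: (Kvec_jaut (jaut_comp ar (jaut_comp ag (jaut_comp ar ar)))).
  by rewrite !comp_lfunE !rE gE rE !cd_zero.
by rewrite !comp_lfunE !rE gE rE !cd_zero.
Qed.

(* Conjugation by a cube root of unity. *)
Lemma Kvec_conj c n m : cdq c = 1 -> cj c ** cj c = c -> Kvec n m ->
  Kvec (c ** n ** cj c) (c ** m ** cj c).
Proof.
move=> qc c3 /(Kvec_mull qc) /(Kvec_mulr (c := cj c)).
rewrite cdq_conj => /(_ qc); rewrite (cd_altl k3) c3.
suff -> : c ** (m ** cj c) = c ** m ** cj c by [].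
by rewrite cdconjE !(cdmulBr, cdmulZr, cdmul1r) (cd_flex k3).
Qed.

(* Kvec contains e (x) conj e for the isotropic e = 1/2 + u and 1/2 - u. *)
Definition Kiso u := Kvec (2%:R^-1 *: cd1 + u) (2%:R^-1 *: cd1 - u) /\
                     Kvec (2%:R^-1 *: cd1 - u) (2%:R^-1 *: cd1 + u).

Local Notation u0 := (im_eps F k').

Lemma im_eps_re : cdre u0 = 0.
Proof. by rewrite im_epsE cdreB cdreZ cdre1 eps_re mulr1 subrr. Qed.
Lemma im_eps_q : cdq u0 = - 4%:R^-1.
Proof.
rewrite im_epsE cdqB cdqZ cdq1 eps_q cddotZr cddot1r eps_re; by field.
Qed.
Lemma imag_conj u : cdre u = 0 -> cj u = - u.
Proof. by move=> ru; rewrite cdconjE ru mulr0 scale0r sub0r. Qed.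
Lemma imag_sq u : cdre u = 0 -> u ** u = - cdq u *: cd1.
Proof.
by move=> ru; rewrite scaleNr -cdmul_conj (imag_conj ru) cdmulNr opprK.
Qed.

Lemma im_eps_sq : u0 ** u0 = 4%:R^-1 *: cd1.
Proof. by rewrite (imag_sq im_eps_re) im_eps_q opprK. Qed.

Lemma Kiso_eps : Kiso u0.
Proof.
have E : 2%:R^-1 *: cd1 + u0 = eps by rewrite im_epsE addrC subrK.
have E' : 2%:R^-1 *: cd1 - u0 = cj eps.
  rewrite im_epsE; move: (eps) (eps_re F k') => z zr.
  by rewrite cdconjE zr; cdmodule_with ltac:(by field).
rewrite /Kiso E E'.
split; first exact: Kvec_eps.
have := Kvec_bar Kvec_eps; rewrite bar_conj bar_eps cdconjK.
by [].
Qed.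

Lemma Kiso_rot v : cdre v = 0 -> cddot v u0 = 0 -> cdq v = 3%:R / 4%:R ->
  Kiso (- 2%:R^-1 *: u0 - v ** u0).
Proof.
(* Norm 1 and real part -1/2 make [c] a primitive cube root of unity, as [Kvec_conj] requires. Since
   v anticommutes with [im_eps], conjugation by [c] multiplies [im_eps] on the left by c^2, the
   conjugate of c. *)
move=> rv vu qv; pose c := - 2%:R^-1 *: cd1 + v.
have cE : cj c = - 2%:R^-1 *: cd1 - v.
  by rewrite /c cdconjD cdconjZ cdconj1 imag_conj.
have qc : cdq c = 1 by rewrite /c cdqD cdqZ cdq1 qv cddotZl cddot1l rv; field.
have c3 : cj c ** cj c = c.
  rewrite cE !(cdmulDl, cdmulDr, cdmulZl, cdmulZr, cdmulNl, cdmulNr, cdmul1l, cdmul1r).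
  by rewrite (imag_sq rv) qv /c; cdmodule_with ltac:(by field).
have uv : u0 ** v = - (v ** u0).
  have := cdmul_conj (v + u0).
  rewrite cdconjD (imag_conj rv) (imag_conj im_eps_re) cdqD vu mulr0 addr0.
  rewrite !(cdmulDl, cdmulDr, cdmulNr) (imag_sq rv) (imag_sq im_eps_re) => E.
  by apply: (eq_from (c := - 1) E); cdmodule.
have cuc : c ** u0 ** cj c = - 2%:R^-1 *: u0 - v ** u0.
  rewrite cE /c !(cdmulDl, cdmulDr, cdmulZl, cdmulZr, cdmulNl, cdmulNr, cdmul1l, cdmul1r).
  have -> : v ** u0 ** v = cdq v *: u0.
    rewrite -[v ** u0]opprK -uv cdmulNl (cd_altr k3) (imag_sq rv) cdmulZr cdmul1r.
    by rewrite scaleNr opprK.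
  by rewrite uv qv; cdmodule_with ltac:(by field).
have c1c : c ** cd1 ** cj c = cd1 by rewrite cdmul1r cdmul_conj qc scale1r.
have [K1 K2] := Kiso_eps; clearbody c.
by split; [move: (Kvec_conj qc c3 K1)|move: (Kvec_conj qc c3 K2)];
  rewrite !(cdmulDl, cdmulDr, cdmulZl, cdmulZr, cdmulNl, cdmulNr) c1c cuc.
Qed.

(** Along the line w + t 1 the norm is a monic quadratic polynomial in t, hence not identically 0,
    and f vanishes wherever it is nonzero. *)
Lemma q_dense (f : A -> F) : polyfun f -> (forall w, cdq w != 0 -> f w = 0) ->
  forall w, f w = 0.
Proof.
move=> pf H w; pose l (t : F^o) : A := w + t *: cd1.
have pl : polymap l.
  apply: polymapD; first exact: polymap_cst.
  by apply: polymap_lin => c x y; rewrite scalerDl scalerA.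
pose p (t : F^o) : F := cdq w + 2%:R * t * cdre w + t * t.
have pp : polyfun p.
  have pt : polyfun (fun t : F^o => t : F) by apply: polyfun_lin.
  apply: polyfunD; last exact: polyfunM.
  apply: polyfunD; first exact: polyfun_cst.
  by apply: polyfunM (polyfun_cst _ _); apply: polyfunM pt; exact: polyfun_cst.
have pE t : p t = cdq (l t).
  by rewrite /l cdqD cdqZ cdq1 cddotZr cddot1r /p; ring.
have pn : exists t, p t != 0.
  case: (eqVneq (cdq w) 0) => q0; last first.
    by exists 0; rewrite /p !(mulr0, mul0r, addr0).
  case: (eqVneq (p 1) 0) => h1; last by exists 1.
  case: (eqVneq (p (-1)) 0) => h2; last by exists (-1).
  have : p 1 + p (-1) = 2%:R by rewrite /p q0; ring.
  by rewrite h1 h2 addr0 => /esym/eqP; rewrite (negbTE (two_neq0 F)).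
have := polyfun_eq0 (polyfun_comp pf pl) pp pn _ 0.
rewrite /= /l scale0r addr0; apply => t; rewrite pE; exact: H.
Qed.

End Polar.

Section PolarForm.
Variables (F : numClosedFieldType) (k' : nat).
Local Notation k := k'.+1.
Hypothesis k3 : (k <= 3)%N.
Local Notation A := (CD F k).
Local Notation J := (J3 F k).
Local Notation u0 := (im_eps F k').
Local Notation p2 x := (jmk 0 0 0 0 x 0).
Local Notation p3 x := (jmk 0 0 0 0 0 x).
Implicit Types (m n u v w x y z : A).
Variables (B C : J).
Hypothesis np : never_polar B C.

Let b n m : F := jw B C (p3 n) (p2 m).

Let bDl x y z : b (x + y) z = b x z + b y z.
Proof. by rewrite /b p3D jwDl. Qed.
Let bDr x y z : b z (x + y) = b z x + b z y.
Proof. by rewrite /b p2D jwDr. Qed.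
Let bZl a x z : b (a *: x) z = a * b x z.
Proof. by rewrite /b p3Z jwZl. Qed.
Let bZr a x z : b z (a *: x) = a * b z x.
Proof. by rewrite /b p2Z jwZr. Qed.
Let bNl x z : b (- x) z = - b x z.
Proof. by rewrite -scaleN1r bZl mulN1r. Qed.
Let bNr x z : b z (- x) = - b z x.
Proof. by rewrite -scaleN1r bZr mulN1r. Qed.

Let b0l z : b 0 z = 0.
Proof. by rewrite -(scale0r 0) bZl mul0r. Qed.
Let b0r z : b z 0 = 0.
Proof. by rewrite -(scale0r 0) bZr mul0r. Qed.

Let b_poly (f g : A -> A) : linear f -> linear g -> polyfun (fun w => b (f w) (g w)).
Proof.
move=> hf hg; have l3 X : lform (fun w => jQ X (p3 (f w))).
  by move=> c x y; rewrite hf p3D p3Z jQDr jQZr.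
have l2 X : lform (fun w => jQ X (p2 (g w))).
  by move=> c x y; rewrite hg p2D p2Z jQDr jQZr.
by apply: polyfunB; apply: polyfunM; apply: polyfun_lin.
Qed.

(** [Kvec_mulr] for the unit obtained by dividing by a square root of the norm; the scalar drops out
    by bilinearity and [q_dense] covers isotropic w. *)
Let Kvec_mul n m w : Kvec n m -> b (n ** w) (w ** m) = 0.
Proof.
move=> K; apply: (q_dense (f := fun w => b (n ** w) (w ** m))) => [|x qx].
  apply: b_poly => c x y; first by rewrite cdmulDr cdmulZr.
  by rewrite cdmulDl cdmulZl.
pose s := sqrtC (cdq x); have s0 : s != 0 by rewrite sqrtC_eq0.
have /(@Kvec_mulr _ _ k3 (s^-1 *: x)) : Kvec n m by [].
rewrite cdqZ -{1}(sqrtCK (cdq x)) -exprMn mulVf // expr1n => /(_ erefl) /(_ _ _ np).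
rewrite -/(b _ _) cdmulZr cdmulZl bZl bZr mulrA => /eqP.
by rewrite mulf_eq0 mulf_eq0 invr_eq0 (negbTE s0) => /eqP.
Qed.

(** The part odd in u of the relations for 1/2 + u and 1/2 - u. Unlike [Kiso], it is linear in u, so
    it extends from special elements to their span. *)
Let lin u := forall w, b (u ** w) w = b w (w ** u).

Let Kiso_lin u : Kiso u -> lin u /\ b u u = 4%:R^-1 * b cd1 cd1.
Proof.
case=> K1 K2.
have E1 w := Kvec_mul w K1; have E2 w := Kvec_mul w K2.
have H w : (b (u ** w) w = b w (w ** u)) /\ b (u ** w) (w ** u) = 4%:R^-1 * b w w.
  have := E1 w; have := E2 w.
  rewrite !(cdmulDl, cdmulDr, cdmulZl, cdmulZr, cdmulNl, cdmulNr, cdmul1l, cdmul1r).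
  rewrite !(bDl, bDr, bZl, bZr, bNl, bNr).
  move: (b w w) (b (u ** w) w) (b w (w ** u)) (b (u ** w) (w ** u)) => p q r s h1 h2.
  split; first by apply: (lincomb2 (c := -1) (d := 1) h1 h2); field.
  by apply: (lincomb2 (c := - 2%:R^-1 : F) (d := - 2%:R^-1 : F) h1 h2); field.
by split=> [w|]; [case: (H w)|case: (H cd1); rewrite cdmul1r cdmul1l].
Qed.

Let linD x y : lin x -> lin y -> lin (x + y).
Proof. by move=> hx hy w; rewrite cdmulDl cdmulDr bDl bDr hx hy. Qed.
Let linZ a x : lin x -> lin (a *: x).
Proof. by move=> hx w; rewrite cdmulZl cdmulZr bZl bZr hx. Qed.

Let T y := [/\ lin y, b y y = - cdq y * b cd1 cd1 & b u0 y + b y u0 = 0].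

Let V y := cdre y = 0 /\ cddot y u0 = 0.

Let T_aniso y : V y -> cdq y != 0 -> T y.
Proof.
(* The scale s is chosen so that v = 4 s y u0 has norm 3/4, the value in [Kiso_rot]; then v u0 = s y
   because u0^2 = 1/4. Using both v and - v isolates y. *)
move=> [ry yu] qy; pose s := sqrtC (- 3%:R / 16%:R / cdq y).
have s2 : s ^+ 2 * cdq y = - 3%:R / 16%:R by rewrite sqrtCK divfK.
have s0 : s != 0.
  apply/eqP => s0; move: s2; rewrite s0 expr0n mul0r => /esym/eqP.
  by rewrite mulf_eq0 invr_eq0 oppr_eq0 !pnatr_eq0.
pose v := (4%:R * s) *: (y ** u0).
have u0c : cj u0 = - u0 by rewrite cdconjE im_eps_re mulr0 scale0r sub0r.
have rv : cdre v = 0 by rewrite /v cdreZ cdre_mul u0c cddotNr yu oppr0 mulr0.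
have vu : cddot v u0 = 0.
  by rewrite /v cddotZl cddot_mulr cdmul_conj cddotZr cddot1r ry !mulr0.
have qv : cdq v = 3%:R / 4%:R.
  rewrite /v cdqZ (cdqM k3) im_eps_q.
  transitivity (- 4%:R * (s ^+ 2 * cdq y)); first by field.
  by rewrite s2; field.
have vE : v ** u0 = s *: y.
  rewrite /v cdmulZl (cd_altr k3) im_eps_sq cdmulZr cdmul1r.
  by cdmodule_with ltac:(by field).
have NE : (- v) ** u0 = - (s *: y) by rewrite cdmulNl vE.
have /Kiso_lin[L1 Q1] := Kiso_rot k3 rv vu qv.
have /Kiso_lin[L2 Q2] : Kiso (- 2%:R^-1 *: u0 - (- v) ** u0).
  by apply: Kiso_rot; rewrite // ?cdreN ?cddotNl ?cdqN ?rv ?vu ?oppr0.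
have /Kiso_lin[L0 Q0] := Kiso_eps F k3.
rewrite vE in L1 Q1; rewrite NE opprK in L2 Q2.
split.
- have -> : y = (2%:R * s)^-1 *: ((- 2%:R^-1 *: u0 + s *: y) +
      (-1) *: (- 2%:R^-1 *: u0 - s *: y)).
    by cdmodule_with ltac:(by field).
  by apply: linZ; apply: linD; [exact: L2|apply: linZ; exact: L1].
- move: Q1 Q2; rewrite !(bDl, bDr, bZl, bZr, bNl, bNr) Q0.
  move: (b cd1 cd1) (b u0 y) (b y u0) (b y y) => p q r t h1 h2.
  have e : cdq y = (- 3%:R / 16%:R) / s ^+ 2 by rewrite -s2; field.
  rewrite e; apply: (lincomb2 (c := 2%:R^-1 / s ^+ 2 : F) (d := 2%:R^-1 / s ^+ 2 : F) h1 h2).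
  by field.
- move: Q1 Q2; rewrite !(bDl, bDr, bZl, bZr, bNl, bNr) Q0.
  move: (b cd1 cd1) (b u0 y) (b y u0) (b y y) => p q r t h1 h2.
  by apply: (lincomb2 (c := s^-1) (d := - s^-1) h1 h2); field.
Qed.

Let VZD a x y : V x -> V y -> V (x + a *: y).
Proof.
by case=> rx xu [ry yu]; split; rewrite ?cdreD ?cdreZ ?cddotDl ?cddotZl
  ?rx ?ry ?xu ?yu mulr0 addr0.
Qed.

(** An isotropic y is the midpoint of y + t z and y - t z, both anisotropic for a suitable t when
    some z in [V] is anisotropic. The average of their quadratic relations is the one for y up to a
    term in z, which is known. *)
Let T_V y : V y -> T y.
Proof.
move=> Vy; case: (eqVneq (cdq y) 0) => [qy|]; last exact: T_aniso.
case: (pselect (exists2 z, V z & cdq z != 0)) => [[z Vz qz]|noz].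
  have [t t0 [ht hs]] : exists2 t : F, t != 0 &
      cdq (y + t *: z) != 0 /\ cdq (y + (- t) *: z) != 0.
    have E t : cdq (y + t *: z) = t * (2%:R * cddot y z + t * cdq z).
      by rewrite cdqD cdqZ cddotZr qy; ring.
    have key (d q : F) : q != 0 ->
        exists t : F, [/\ t != 0, d + t * q != 0 & d - t * q != 0].
      move=> q0; case: (eqVneq (d + q) 0) => d1.
        have -> : d = - q by apply/eqP; rewrite -addr_eq0 d1.
        exists 2%:R; split; first exact: two_neq0.
          by rewrite (_ : - q + 2%:R * q = q) //; ring.
        rewrite (_ : - q - 2%:R * q = - (3%:R * q)); last by ring.
        by rewrite oppr_eq0 mulf_neq0 ?three_neq0.
      case: (eqVneq (d - q) 0) => d2.
        have -> : d = q by apply/subr0_eq.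
        exists 2%:R; split; first exact: two_neq0.
          rewrite (_ : q + 2%:R * q = 3%:R * q); last by ring.
          by rewrite mulf_neq0 ?three_neq0.
        by rewrite (_ : q - 2%:R * q = - q) ?oppr_eq0 //; ring.
      by exists 1; rewrite mul1r oner_eq0.
    have [t [t0 h1 h2]] := key (2%:R * cddot y z) (cdq z) qz.
    exists t => //; rewrite !E; split; first exact: mulf_neq0.
    by rewrite mulNr mulNr oppr_eq0; apply: mulf_neq0.
  have [L1 Q1 C1] := T_aniso (VZD t Vy Vz) ht.
  have [L2 Q2 C2] := T_aniso (VZD (- t) Vy Vz) hs.
  have [_ Qz _] := T_aniso Vz qz.
  split.
  - have -> : y = 2%:R^-1 *: ((y + t *: z) + (y + (- t) *: z)).
      by cdmodule_with ltac:(by field).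
    by apply: linZ; apply: linD; [exact: L1|exact: L2].
  - move: Q1 Q2; rewrite !(bDl, bDr, bZl, bZr) Qz !cdqD !cdqZ qy !cddotZr.
    move: (b cd1 cd1) (b y y) (b y z) (b z y) (cdq z) (cddot y z).
    move=> p r1 r2 r3 r4 r5 h1 h2.
    by apply: (lincomb2 (c := 2%:R^-1 : F) (d := 2%:R^-1 : F) h1 h2); field.
  - move: C1 C2; rewrite !(bDl, bDr, bZl, bZr).
    move: (b u0 y) (b u0 z) (b y u0) (b z u0) => r1 r2 r3 r4 h1 h2.
    by apply: (lincomb2 (c := 2%:R^-1 : F) (d := 2%:R^-1 : F) h1 h2); field.
(* If [V] is totally isotropic then it is 0, because the norm is nondegenerate on the orthogonal of
   1 and [im_eps]. This happens for a = 2. *)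
have iso x : V x -> cdq x = 0.
  by move=> Vx; apply/eqP/negPn/negP => qx; apply: noz; exists x.
suff -> : y = 0.
  split; [move=> w | by rewrite cdq0 b0l oppr0 mul0r | by rewrite b0l b0r addr0].
  by rewrite cdmul0l cdmul0r b0l b0r.
apply: cddot_nondeg => x.
pose z := x - cdre x *: cd1 + (4%:R * cddot x u0) *: u0.
have Vz : V z.
  split; first by rewrite /z cdreD cdreB !cdreZ cdre1 im_eps_re; ring.
  rewrite /z cddotDl cddotBl !cddotZl cddot1l im_eps_re -/(cdq u0) im_eps_q.
  by field.
have -> : cddot y x = cddot y z.
  rewrite /z cddotDr cddotBr !cddotZr cddot1r; case: Vy => -> ->; ring.
have := iso _ (VZD 1 Vy Vz); rewrite cdqD cdqZ (iso y) // (iso z) // scale1r.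
by rewrite mulr0 !add0r => /eqP; rewrite mulf_eq0 (negbTE (two_neq0 F)) => /eqP.
Qed.

Let imag_T u : cdre u = 0 -> lin u /\ b u u = - cdq u * b cd1 cd1.
Proof.
move=> ru; pose a := - 4%:R * cddot u u0; pose y := u + (- a) *: u0.
have [y_re y_u] : V y.
  split; first by rewrite /y cdreD cdreZ ru im_eps_re; ring.
  by rewrite /y cddotDl cddotZl -/(cdq u0) im_eps_q /a; field.
have [Ly Qy Cy] : T y by apply: T_V.
have [L0 Q0] := Kiso_lin (Kiso_eps F k3).
have uE : u = a *: u0 + y by rewrite /y scaleNr addrC subrK.
rewrite {}uE; clearbody y; split; first by apply: linD; [apply: linZ|].
rewrite !(bDl, bDr, bZl, bZr) Q0 Qy cdqD cdqZ im_eps_q cddotZl (cddotC u0) y_u.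
move: Cy; move: (b cd1 cd1) (b u0 y) (b y u0) => p q r h.
by apply: (lincomb1 (c := a) h); field.
Qed.

Let dec n : exists s u, cdre u = 0 /\ n = s *: cd1 + u.
Proof.
exists (cdre n), (n - cdre n *: cd1); split; last by rewrite addrC subrK.
by rewrite cdreB cdreZ cdre1 mulr1 subrr.
Qed.

(* B is determined by the products m n: its skew part by the polarisation of
   [lin], its symmetric part by the values b u u. *)
Let b_prod n m : b n m = b cd1 (m ** n).
Proof.
have b1 x : b x cd1 = b cd1 x.
  have [s [u [ru ->]]] := dec x; have [L _] := imag_T ru.
  by have := L cd1; rewrite cdmul1l cdmul1r !(bDl, bDr, bZl, bZr) => ->.
have skew x y : b x y - b y x = b cd1 (y ** x) - b cd1 (x ** y).
  have [s [u [ru ->]]] := dec x; have [L _] := imag_T ru.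
  have h := L (y + cd1); have h1 := L y; have h2 := L cd1.
  rewrite !(cdmulDl, cdmulDr, cdmul1l, cdmul1r, cdmulZl, cdmulZr) !(bDl, bDr, bZl, bZr).
  move: h h1 h2; rewrite !(cdmulDl, cdmulDr, cdmul1l, cdmul1r) !(bDl, bDr) !b1.
  move: (b (u ** y) y) (b y (y ** u)) (b cd1 (u ** y)) (b u y) (b cd1 u) (b y u)
    (b cd1 (y ** u)) (b cd1 y) => r1 r2 r3 r4 r5 r6 r7 r8 h h1 h2.
  by apply: (lincomb2 (c := 1) (d := -1) h h1); ring.
have sq x : b x x = b cd1 (x ** x).
  have [s [u [ru ->]]] := dec x; have [_ Q] := imag_T ru.
  rewrite !(cdmulDl, cdmulDr, cdmul1l, cdmul1r, cdmulZl, cdmulZr) (imag_sq ru).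
  rewrite !(bDl, bDr, bZl, bZr) b1 Q.
  by move: (b cd1 cd1) (b cd1 u) (cdq u) => *; ring.
have h1 := sq (n + m); have h2 := sq n; have h3 := sq m; have h4 := skew n m.
move: h1; rewrite !(cdmulDl, cdmulDr) !(bDl, bDr) h2 h3 => h1.
move: h1 h4; move: (b n m) (b m n) (b cd1 (n ** n)) (b cd1 (m ** m))
  (b cd1 (n ** m)) (b cd1 (m ** n)) => r1 r2 r3 r4 r5 r6 h1 h4.
by apply: (lincomb2 (c := 2%:R^-1 : F) (d := 2%:R^-1 : F) h1 h4); field.
Qed.

(* The product of the components of B /\ C at (2, 3), by commutation. *)
Lemma never_polar_star n m : (2 ^ k)%:R * jw B C (p3 n) (p2 m) +
  2%:R * jw B C (jmk 0 1 (-1) 0 0 0) (jmk 0 0 0 (cj (m ** n)) 0 0) = 0.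
Proof.
have [com _ _ _] := np; have := com (jmk 0 0 1 0 0 0); have := b_prod.
rewrite /b /jw; case: (jmkP B) (jmkP C) => b1 b2 b3 x1 x2 x3 [c1 c2 c3 y1 y2 y3].
rewrite !jm_jmk !cd_zero => H /jmk_inj[_ [R1 _ _]].
have qE (d1 d2 d3 e1 e2 e3 : F) (z1 z2 z3 t1 t2 t3 : A) :
    jQ (jmk d1 d2 d3 z1 z2 z3) (jmk e1 e2 e3 t1 t2 t3) =
    d1 * e1 + d2 * e2 + d3 * e3 + 2%:R * (cddot z1 t1 + cddot z2 t2 + cddot z3 t3).
  exact: jQ_jmk.
rewrite !qE !cd_zero; pose v := cdre x3 *: y2 - cdre y3 *: x2.
have Hv n' m' : cddot x3 n' * cddot y2 m' - cddot y3 n' * cddot x2 m' =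
    cddot v (m' ** n').
  have := H n' m'; rewrite !qE !cd_zero !cddot1r /v cddotBl !cddotZl.
  move: (cddot x3 n') (cddot y2 m') (cddot y3 n') (cddot x2 m') (cdre x3) (cdre y3)
    (cddot y2 _) (cddot x2 _) => r1 r2 r3 r4 r5 r6 r7 r8 h.
  by apply: (lincomb1 (c := 4%:R^-1 : F) h); field.
have Hm m' : cddot y2 m' *: (m' ** x3) - cddot x2 m' *: (m' ** y3) = cdq m' *: v.
  rewrite -!cdmulZr -cdmulBr -(cdmulVl k3); congr (_ ** _).
  apply: cddot_inj => z; rewrite cddot_mull cdconjK -Hv cddotBl !cddotZl.
  by rewrite (mulrC (cddot x3 z)) (mulrC (cddot y3 z)).
have prodE (z : A) (t : A) :
    \sum_(m' <- cdbasis F k) cddot t m' *: (m' ** z) = t ** z.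
  have lz : linear (fun y : A => y ** z) by move=> c x y; rewrite cdmulDl cdmulZl.
  pose h := GRing.isLinear.Build F A A _ _ lz.
  pose f : {linear A -> A} := HB.pack (fun y : A => y ** z) h.
  exact: (cdbasis_sum f t).
(* [Hm] is summed over an orthonormal basis of m'. The left side is a basis expansion, and the right
   side is one copy of v for each basis vector: this is where the dimension 2^k comes from. *)
have R2 : y2 ** x3 - x2 ** y3 = (2 ^ k)%:R *: v.
  rewrite -!prodE -sumrB (eq_big_seq (fun=> v)); last first.
    by move=> m' /cdbasis_q qm; rewrite Hm qm scale1r.
  rewrite big_const_seq count_predT size_cdbasis iter_addr_0.
  by rewrite scaler_nat.
have R3 : (b2 - b3) *: y1 - (c2 - c3) *: x1 = - (2 ^ k)%:R *: cj v.
  rewrite scaleNr -cdconjZ -R2 cdconjB.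
  rewrite !(cdmulZl, cdmulZr, cdconjZ) in R1.
  by apply: (eq_from (c := 4%:R) R1); cdmodule_with ltac:(by field).
have := congr1 (fun z => cddot z (cj (m ** n))) R3; cbv beta.
rewrite cddotBl !cddotZl cddot_conj -Hv.
move: (cddot x3 n) (cddot y2 m) (cddot y3 n) (cddot x2 m) (cddot y1 _) (cddot x1 _).
move: ((2 ^ k)%:R : F) => r0 r1 r2 r3 r4 r5 r6 h.
by apply: (lincomb1 (c := 4%:R) h); ring.
Qed.

End PolarForm.


(** * A never polar bivector has no nonzero component *)

Section PolarExists.
Variables (F : numClosedFieldType) (k' : nat).
Local Notation k := k'.+1.
Hypothesis k3 : (k <= 3)%N.
Local Notation A := (CD F k).
Local Notation J := (J3 F k).
Local Notation eps := (eps F k').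
Local Notation p1 x := (jmk 0 0 0 x 0 0).
Local Notation p2 x := (jmk 0 0 0 0 x 0).
Local Notation p3 x := (jmk 0 0 0 0 0 x).
Local Notation dg a b c := (@jmk F k a b c 0 0 0).
Local Notation a := ((2 ^ k)%:R : F).
Implicit Types (B C X Y : J) (c m n u v x y : A).

Let tau_dg (t : F) c d1 d2 d3 (g : 'End(J)) :
  (forall d1 d2 d3 x1 x2 x3, g (jmk d1 d2 d3 x1 x2 x3) =
    jmk (d1 + 2%:R * cddot (t *: c) x3) (d2 - 2%:R * cddot (t *: c) x3) d3
      (x1 - cj (x2 ** (t *: c))) (x2 + cj ((t *: c) ** x1))
      (x3 + (d2 - d1 - 2%:R * cddot (t *: c) x3) *: (t *: c))) ->
  [/\ g (dg d1 d2 d3) = dg d1 d2 d3 + (t * (d2 - d1)) *: p3 c,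
      forall n, g (p3 n) = p3 n + (t * (2%:R * cddot c n)) *: dg 1 (-1) 0 +
         (- t ^+ 2 * (2%:R * cddot c n)) *: p3 c,
      forall m, g (p2 m) = p2 m + (- t) *: p1 (cj (m ** c)) &
      forall x, g (p1 x) = p1 x + t *: p2 (cj (c ** x))].
Proof.
move=> gE; split=> [|n|m|x]; rewrite gE !jmkZ !jmkD !cd_zero; apply: jmk_eq => //.
- by rewrite scalerA mulrC.
- by rewrite cddotZl; ring.
- by rewrite cddotZl; ring.
- by rewrite cddotZl; cdmodule.
- by rewrite cdmulZr cdconjZ scaleNr.
- by rewrite cdmulZl cdconjZ.
Qed.

Let tauP c (t : F) : cdq c = 0 -> exists g : 'End(J), [/\ jaut g,
  forall d1 d2 d3, g (dg d1 d2 d3) = dg d1 d2 d3 + (t * (d2 - d1)) *: p3 c,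
  forall n, g (p3 n) = p3 n + (t * (2%:R * cddot c n)) *: dg 1 (-1) 0 +
         (- t ^+ 2 * (2%:R * cddot c n)) *: p3 c,
  forall m, g (p2 m) = p2 m + (- t) *: p1 (cj (m ** c)) &
  forall x, g (p1 x) = p1 x + t *: p2 (cj (c ** x))].
Proof.
move=> qc; have [|g [ag gE]] := @tau_jaut F k k3 (t *: c).
  by rewrite cdqZ qc mulr0.
exists g; split=> //; first by move=> d1 d2 d3; case: (tau_dg d1 d2 d3 gE).
- by case: (tau_dg 0 0 0 gE).
- by case: (tau_dg 0 0 0 gE).
- by case: (tau_dg 0 0 0 gE).
Qed.

Let lin_coef (c0 c1 c2 c3 : F) :
  (forall t : F, c0 + t * c1 + t ^+ 2 * c2 + t ^+ 3 * c3 = 0) -> c1 = 0.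
Proof.
(* For a cubic f, the combination 8 (f(1) - f(-1)) - (f(2) - f(-2)) cancels the even and the cubic
   terms and leaves 12 times the linear coefficient. *)
move=> H; have E : 12%:R * c1 = 8%:R * (0 - 0) - (0 - 0).
  by rewrite -{1}(H 1) -{1}(H (-1)) -{1}(H 2%:R) -(H (- 2%:R)); ring.
move: E; rewrite !subrr mulr0 subr0 => /eqP.
by rewrite mulf_eq0 pnatr_eq0 => /eqP.
Qed.

(** The coefficient of t in [never_polar_star] transported by the root automorphism of t c; the
    whole expression is a cubic in t that vanishes identically. *)
Let star_lin B C c n m : never_polar B C -> cdq c = 0 ->
  a * (2%:R * cddot c n * jw B C (dg 1 (-1) 0) (p2 m) -
       jw B C (p3 n) (p1 (cj (m ** c)))) +
  2%:R * (jw B C (p3 c) (p1 (cj (m ** n))) +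
          jw B C (dg 0 1 (-1)) (p2 (cj (c ** cj (m ** n))))) = 0.
Proof.
move=> np qc; set y := cj (m ** n).
apply: (lin_coef (c0 := a * jw B C (p3 n) (p2 m) + 2%:R * jw B C (dg 0 1 (-1)) (p1 y))
 (c2 := a * (- (2%:R * cddot c n) * jw B C (dg 1 (-1) 0) (p1 (cj (m ** c))) -
   2%:R * cddot c n * jw B C (p3 c) (p2 m)) + 2%:R * jw B C (p3 c) (p2 (cj (c ** y))))
 (c3 := a * (2%:R * cddot c n * jw B C (p3 c) (p1 (cj (m ** c)))))) => t.
have [g [ag gd g3 g2 g1]] := tauP t qc.
have := never_polar_ind (P := fun f : J -> J -> F =>
  a * f (p3 n) (p2 m) + 2%:R * f (dg 0 1 (-1)) (p1 y) = 0) ag _ np.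
move=> /(_ (fun B1 C1 np1 => never_polar_star k3 np1 n m)).
rewrite g3 g2 gd g1 {g3 g2 gd g1 ag g}.
move: (p3 n) (p2 m) (p1 (cj _)) (dg 1 _ 0) (dg 0 1 _) (p1 y) (p2 (cj _)) (p3 c).
move=> P3 P2 P1 D D' P1' P2' P3'; rewrite !(jwDl, jwDr, jwZl, jwZr) => H; rewrite -[RHS]H.
move: (jw B C P3 P2) (jw B C P3 P1) (jw B C D P2) (jw B C D P1) (jw B C P3' P2)
  (jw B C P3' P1) (jw B C D' P1') (jw B C D' P2') (jw B C P3' P1') (jw B C P3' P2')
  (cddot c n) a.
by move=> *; ring.
Qed.

Let a_gt : exists2 N, a = N.+2%:R & True.
Proof.
exists ((2 ^ k).-2)%N => //; congr (_%:R); rewrite expnS.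
by case: (2 ^ k')%N (expn_gt0 2 k') => // N _; rewrite mulnS.
Qed.

Let aD_neq0 N : a + N%:R != 0.
Proof. by have [M -> _] := a_gt; rewrite -natrD pnatr_eq0. Qed.
Let a_neq0 : a != 0.
Proof. by have := aD_neq0 0; rewrite addr0. Qed.
Let a1_neq0 : a - 1 != 0.
Proof.
by have [M -> _] := a_gt; rewrite -natr1 addrK pnatr_eq0.
Qed.

Let eps_sum : eps + cj eps = cd1.
Proof. by rewrite cdconjE eps_re mulfV ?two_neq0 // scale1r addrC subrK. Qed.

(* The relation [star_lin] for c = n = 1 and its transpose determine the
   components on diagonal (x) off-diagonal. *)
Let diag_rel B C m : never_polar B C ->
  a * jw B C (dg (-1) 1 0) (p2 m) + 2%:R * jw B C (dg (-1) 0 1) (p2 m) = 0.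
Proof.
move=> np.
(* The element 1 is not isotropic, but [star_lin] is linear in c and 1 is the sum of the isotropic
   elements [eps] and its conjugate, so the two relations are added. *)
have qe := eps_q F k'; have qe' : cdq (cj eps) = 0 by rewrite cdq_conj.
have H1 := star_lin cd1 m np qe; have H2 := star_lin cd1 m np qe'.
have [r [ar rE]] := cyc_jaut F k.
have H3 : a * jw B C (p1 (cj m)) (p3 cd1) + 2%:R * jw B C (dg (-1) 0 1) (p2 m) = 0.
  have := never_polar_ind (P := fun f : J -> J -> F =>
    a * f (p3 (cj m)) (p2 cd1) + 2%:R * f (dg 0 1 (-1)) (p1 (cj (cd1 ** cj m))) = 0)
    (jaut_comp ar ar) _ np.
  move=> /(_ (fun B1 C1 np1 => never_polar_star k3 np1 (cj m) cd1)).
  by rewrite !comp_lfunE !rE cdmul1l cdconjK.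
have e1 : cddot eps cd1 + cddot (cj eps) cd1 = 1 by rewrite -cddotDl eps_sum cddot1r cdre1.
have s1 : jw B C (p3 cd1) (p1 (cj (m ** eps))) + jw B C (p3 cd1) (p1 (cj (m ** cj eps))) =
    jw B C (p3 cd1) (p1 (cj m)).
  by rewrite -jwDr -p1D -cdconjD -cdmulDr eps_sum cdmul1r.
have s2 : jw B C (p3 eps) (p1 (cj m)) + jw B C (p3 (cj eps)) (p1 (cj m)) =
    jw B C (p3 cd1) (p1 (cj m)).
  by rewrite -jwDl -p3D eps_sum.
have s3 : jw B C (dg 0 1 (-1)) (p2 (cj (eps ** cj m))) +
    jw B C (dg 0 1 (-1)) (p2 (cj (cj eps ** cj m))) = jw B C (dg 0 1 (-1)) (p2 m).
  move: eps_sum; move: (cj eps) (eps) => z' z E.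
  by rewrite -jwDr -p2D -cdconjD -cdmulDl E cdmul1l cdconjK.
have d1 : jw B C (dg 0 1 (-1)) (p2 m) =
    jw B C (dg (-1) 1 0) (p2 m) - jw B C (dg (-1) 0 1) (p2 m).
  have -> : dg 0 1 (-1) = dg (-1) 1 0 + (-1) *: dg (-1) 0 1.
    by rewrite jmkZ jmkD !cd_zero; apply: jmk_eq => //; ring.
  by rewrite jwDl jwZl mulN1r.
have d2 : jw B C (dg 1 (-1) 0) (p2 m) = - jw B C (dg (-1) 1 0) (p2 m).
  have -> : dg 1 (-1) 0 = (-1) *: dg (-1) 1 0.
    by rewrite jmkZ !cd_zero; apply: jmk_eq => //; ring.
  by rewrite jwZl mulN1r.
rewrite d1 in s3; rewrite d2 !cdmul1r in H1 H2; rewrite jwC in H3.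
move: {rE ar r d1 d2} e1 s1 s2 s3 H1 H2 H3.
move: (cddot eps cd1) (cddot (cj eps) cd1) (jw B C (p3 cd1) (p1 (cj (m ** eps))))
  (jw B C (p3 cd1) (p1 (cj (m ** cj eps)))) (jw B C (p3 eps) (p1 (cj m)))
  (jw B C (p3 (cj eps)) (p1 (cj m))) (jw B C (dg 0 1 (-1)) (p2 (cj (eps ** cj m))))
  (jw B C (dg 0 1 (-1)) (p2 (cj (cj eps ** cj m)))) (jw B C (p3 cd1) (p1 (cj m)))
  (jw B C (dg (-1) 1 0) (p2 m)) (jw B C (dg (-1) 0 1) (p2 m)).
move: a a_neq0 a1_neq0 => r r0 r1 e e' u1 u2 v1 v2 w1 w2 u X Z.
move=> /(canRL (addKr _)) -> /(canRL (addKr _)) -> /(canRL (addKr _)) ->.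
move=> /(canRL (addKr _)) -> H1 H2 H3.
have H4 : r * (- 2%:R * X - u) + 2%:R * (u + X - Z) = 0.
  by apply: (lincomb2 (c := 1) (d := 1) H1 H2); ring.
by apply: (lincomb2 (c := - r / (2%:R * (r - 1))) (d := (r - 2%:R) / (2%:R * (r - 1))) H4 H3);
  field.
Qed.

(** [diag_rel] and its image under the exchange of the indices 1 and 3 form a system of two
    equations with determinant - a (a + 4). *)
Let diag2_0 B C m : never_polar B C ->
  jw B C (dg (-1) 1 0) (p2 m) = 0 /\ jw B C (dg (-1) 0 1) (p2 m) = 0.
Proof.
move=> np; have H1 := diag_rel m np; have [t [at' tE]] := transpose_jaut F k.
have H2 : a * jw B C (dg 0 1 (-1)) (p2 m) + 2%:R * jw B C (dg 1 0 (-1)) (p2 m) = 0.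
  have := never_polar_ind (P := fun f : J -> J -> F =>
    a * f (dg (-1) 1 0) (p2 (cj m)) + 2%:R * f (dg (-1) 0 1) (p2 (cj m)) = 0) at' _ np.
  move=> /(_ (fun B1 C1 np1 => diag_rel (cj m) np1)).
  by rewrite !tE cdconjK !cdconj0.
have d1 : jw B C (dg 0 1 (-1)) (p2 m) =
    jw B C (dg (-1) 1 0) (p2 m) - jw B C (dg (-1) 0 1) (p2 m).
  have -> : dg 0 1 (-1) = dg (-1) 1 0 + (-1) *: dg (-1) 0 1.
    by rewrite jmkZ jmkD !cd_zero; apply: jmk_eq => //; ring.
  by rewrite jwDl jwZl mulN1r.
have d2 : jw B C (dg 1 0 (-1)) (p2 m) = - jw B C (dg (-1) 0 1) (p2 m).
  have -> : dg 1 0 (-1) = (-1) *: dg (-1) 0 1.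
    by rewrite jmkZ !cd_zero; apply: jmk_eq => //; ring.
  by rewrite jwZl mulN1r.
move: H1 H2; rewrite d1 d2; have a4 : a + 4%:R != 0 := aD_neq0 4.
move: (jw B C (dg (-1) 1 0) (p2 m)) (jw B C (dg (-1) 0 1) (p2 m)) a a_neq0 a4.
move=> X Z r r0 r4 H1 H2; have Z0 : Z = 0.
  by apply: (lincomb2 (c := (r + 4%:R)^-1) (d := - (r + 4%:R)^-1) H1 H2); field.
split=> //; rewrite Z0 mulr0 addr0 in H1.
by move/eqP: H1; rewrite mulf_eq0 (negbTE r0) => /eqP.
Qed.

Let one0 B C Y : never_polar B C -> jw B C (dg 1 1 1) Y = 0.
Proof. by case=> _ tB tC _; rewrite /jw -jone_jmk !jQ1r tB tC !mul0r subrr. Qed.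

Let diag2 B C d1 d2 d3 m : never_polar B C -> jw B C (dg d1 d2 d3) (p2 m) = 0.
Proof.
move=> np; have [z1 z2] := diag2_0 m np; have z3 := one0 (p2 m) np.
have -> : dg d1 d2 d3 = (3%:R^-1 * (d1 + d2 + d3)) *: dg 1 1 1 +
    (3%:R^-1 * (2%:R * d2 - d1 - d3)) *: dg (-1) 1 0 +
    (3%:R^-1 * (2%:R * d3 - d1 - d2)) *: dg (-1) 0 1.
  by rewrite !jmkZ !jmkD !cd_zero; apply: jmk_eq => //; field.
by rewrite !jwDl !jwZl z1 z2 z3 !mulr0 !addr0.
Qed.

Let diag1 B C d1 d2 d3 m : never_polar B C -> jw B C (dg d1 d2 d3) (p1 m) = 0.
Proof.
move=> np; have [r [ar rE]] := cyc_jaut F k.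
have := never_polar_ind (P := fun f : J -> J -> F => f (dg d3 d1 d2) (p2 m) = 0) ar _ np.
move=> /(_ (fun B1 C1 np1 => diag2 d3 d1 d2 m np1)).
by rewrite !rE.
Qed.

Let diag3 B C d1 d2 d3 m : never_polar B C -> jw B C (dg d1 d2 d3) (p3 m) = 0.
Proof.
move=> np; have [r [ar rE]] := cyc_jaut F k.
have := never_polar_ind (P := fun f : J -> J -> F => f (dg d3 d1 d2) (p1 m) = 0) ar _ np.
move=> /(_ (fun B1 C1 np1 => diag1 d3 d1 d2 m np1)).
by rewrite !rE.
Qed.

Let off32 B C n m : never_polar B C -> jw B C (p3 n) (p2 m) = 0.
Proof.
move=> np; have := never_polar_star k3 np n m.
rewrite diag1 // mulr0 addr0 => /eqP.
by rewrite mulf_eq0 (negbTE a_neq0) => /eqP.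
Qed.

Let off21 B C n m : never_polar B C -> jw B C (p2 n) (p1 m) = 0.
Proof.
move=> np; have [r [ar rE]] := cyc_jaut F k.
have := never_polar_ind (P := fun f : J -> J -> F => f (p3 n) (p2 m) = 0) ar _ np.
move=> /(_ (fun B1 C1 np1 => off32 n m np1)).
by rewrite !rE.
Qed.

Let off13 B C n m : never_polar B C -> jw B C (p1 n) (p3 m) = 0.
Proof.
move=> np; have [r [ar rE]] := cyc_jaut F k.
have := never_polar_ind (P := fun f : J -> J -> F => f (p2 n) (p1 m) = 0) ar _ np.
move=> /(_ (fun B1 C1 np1 => off21 n m np1)).
by rewrite !rE.
Qed.

(** The root automorphism of [eps] fixes E3 and moves an off-diagonal vector by a multiple of E1 -
    E2, so the mixed components, already 0, control this diagonal one. *)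
Let dd3 B C : never_polar B C -> jw B C (dg 0 0 1) (dg 1 (-1) 0) = 0.
Proof.
move=> np; have [g [ag gd g3 _ _]] := tauP 1 (eps_q F k').
have := never_polar_ind (P := fun f : J -> J -> F => f (dg 0 0 1) (p3 cd1) = 0) ag _ np.
move=> /(_ (fun B1 C1 np1 => diag3 0 0 1 cd1 np1)).
rewrite gd g3 subrr mulr0 scale0r addr0 !jwDr !jwZr !diag3 // mulr0 addr0 add0r.
rewrite cddot1r eps_re mulfV ?two_neq0 // !mul1r.
by [].
Qed.

Let dd B C d1 d2 d3 e1 e2 e3 : never_polar B C ->
  jw B C (dg d1 d2 d3) (dg e1 e2 e3) = 0.
Proof.
move=> np; have [r [ar rE]] := cyc_jaut F k.
have z1 := dd3 np.
have z2 : jw B C (dg 0 1 0) (dg (-1) 0 1) = 0.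
  have := never_polar_ind (P := fun f : J -> J -> F => f (dg 0 0 1) (dg 1 (-1) 0) = 0) ar _ np.
  move=> /(_ (fun B1 C1 np1 => dd3 np1)).
  by rewrite !rE.
have z3 := one0 (dg 1 (-1) 0) np; have z4 := one0 (dg (-1) 0 1) np.
have jw0 X : jw B C X X = 0 by rewrite /jw mulrC subrr.
have dgE f1 f2 f3 : dg f1 f2 f3 = f1 *: dg 1 0 0 + f2 *: dg 0 1 0 + f3 *: dg 0 0 1.
  by rewrite !jmkZ !jmkD !cd_zero !mulr1.
move: z1 z2 z4; rewrite (dgE 1 (-1) 0) (dgE (-1) 0 1) (dgE 1 1 1).
rewrite (dgE d1 d2 d3) (dgE e1 e2 e3).
move: {dgE z3 rE} (dg 1 0 0) (dg 0 1 0) (dg 0 0 1) => D1 D2 D3.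
rewrite !(jwDl, jwDr, jwZl, jwZr) !jw0 (jwC _ _ D2 D1) (jwC _ _ D3 D2) (jwC _ _ D1 D3).
move: (jw B C D1 D2) (jw B C D2 D3) (jw B C D3 D1) => p q s h1 h2 h3.
have s0 : s = 0 by apply: (lincomb2 (c := - 2%:R^-1 : F) (d := 2%:R^-1 : F) h3 h2); field.
have q0 : q = 0 by apply: (lincomb2 (c := 1) (d := -1) h1 s0); ring.
have p0 : p = 0 by apply: (lincomb2 (c := 1) (d := -1) h2 q0); ring.
by rewrite s0 q0 p0; ring.
Qed.

(** For isotropic c the root automorphism sends E1 to E1 - c at (1,2), which reduces the claim to
    components with a diagonal factor. Every n is a sum of two isotropic elements, [eps] n and its
    companion. *)
Let off33 B C n m : never_polar B C -> jw B C (p3 n) (p3 m) = 0.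
Proof.
move=> np; have iso c : cdq c = 0 -> jw B C (p3 c) (p3 m) = 0.
  move=> qc; have [g [ag gd g3 _ _]] := tauP 1 qc.
  have := never_polar_ind (P := fun f : J -> J -> F => f (dg 1 0 0) (p3 m) = 0) ag _ np.
  move=> /(_ (fun B1 C1 np1 => diag3 1 0 0 m np1)).
  rewrite gd g3 !(jwDl, jwDr, jwZl, jwZr) !diag3 // !dd // (jwC _ _ (p3 c) (dg _ _ _)).
  have -> : jw B C (p3 c) (p3 c) = 0 by rewrite /jw mulrC subrr.
  rewrite diag3 // => H; apply: (lincomb1 (c := -1) H).
  by move: (jw B C _ _) (cddot c m) => *; ring.
rewrite -[n]cdmul1l -eps_sum cdmulDl p3D jwDl !iso ?addr0 //.
  by rewrite (cdqM k3) cdq_conj eps_q mul0r.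
by rewrite (cdqM k3) eps_q mul0r.
Qed.

Let off22 B C n m : never_polar B C -> jw B C (p2 n) (p2 m) = 0.
Proof.
move=> np; have [r [ar rE]] := cyc_jaut F k.
have := never_polar_ind (P := fun f : J -> J -> F => f (p3 n) (p3 m) = 0) ar _ np.
move=> /(_ (fun B1 C1 np1 => off33 n m np1)).
by rewrite !rE.
Qed.

Let off11 B C n m : never_polar B C -> jw B C (p1 n) (p1 m) = 0.
Proof.
move=> np; have [r [ar rE]] := cyc_jaut F k.
have := never_polar_ind (P := fun f : J -> J -> F => f (p2 n) (p2 m) = 0) ar _ np.
move=> /(_ (fun B1 C1 np1 => off22 n m np1)).
by rewrite !rE.
Qed.

Lemma never_polar_jw0 B C X Y : never_polar B C -> jw B C X Y = 0.
Proof.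
move=> np; case: (jmkP X) => d1 d2 d3 x1 x2 x3; case: (jmkP Y) => e1 e2 e3 y1 y2 y3.
have dec f1 f2 f3 (z1 z2 z3 : A) : jmk f1 f2 f3 z1 z2 z3 =
    dg f1 f2 f3 + p1 z1 + p2 z2 + p3 z3.
  by rewrite !jmkD !cd_zero.
rewrite (dec d1) (dec e1) !(jwDl, jwDr).
rewrite (jwC _ _ (p1 _) (dg _ _ _)) (jwC _ _ (p2 _) (dg _ _ _)) (jwC _ _ (p3 _) (dg _ _ _)).
rewrite (jwC _ _ (p1 _) (p2 _)) (jwC _ _ (p2 _) (p3 _)) (jwC _ _ (p3 _) (p1 _)).
rewrite dd // !diag1 // !diag2 // !diag3 // off11 // off22 // off33 // !off32 // !off21 //.
by rewrite !off13 // !(oppr0, addr0, subr0).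
Qed.

Lemma polar_exists B C : wedge B C != 0 -> jtr B = 0 -> jtr C = 0 ->
  (forall Z, jm B (jm C Z) = jm C (jm B Z)) ->
  exists2 g : 'End(J), jaut g & jw (g B) (g C) (p3 eps) (p2 (cj eps)) != 0.
Proof.
move=> w0 tB tC com; apply: contrapT => H.
have np : never_polar B C.
  split=> // g ag; apply/eqP/negPn/negP => h; apply: H; by exists g.
have [X BX] : exists X, jQ B X != 0.
  apply: contrapT => HX; move: w0; suff -> : B = 0.
    by rewrite wedgeC linear0 oppr0 eqxx.
  apply: jQ_nondeg => Y; apply/eqP/negPn/negP => h; apply: HX; by exists Y.
(* As all values of the bivector vanish, C is proportional to B, against the independence of the
   two. *)
have CE : C = (jQ C X / jQ B X) *: B.
  apply/subr0_eq/jQ_nondeg => Y; have := never_polar_jw0 X Y np.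
  rewrite /jw jQBl jQZl; move: (jQ B X) BX (jQ C X) (jQ B Y) (jQ C Y) => r r0 s t u h.
  by apply: (lincomb1 (c := r^-1) h); field.
by move: w0; rewrite CE linearZ /= wedgevv scaler0 eqxx.
Qed.

End PolarExists.

(** * The Peirce decomposition *)

HB.lock Definition pm (F : fieldType) k (e e' x : CD F k) : CD F k := e ** (x ** e').

Section Peirce.
Variables (F : numClosedFieldType) (k : nat).
Hypothesis k3 : (k <= 3)%N.
Local Notation A := (CD F k).
Implicit Types (e u v w x y z : A) (c : F).

(** Real part 1/2 and norm 0 amount to e being an idempotent whose conjugate is the complementary
    one; see [psum] and [pmul]. The map [pm e e'] is then the projection to the Peirce space e A
    e'. *)
Definition peirce e e' := [/\ cj e = e', cdre e = 2%:R^-1 & cdq e = 0].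

Lemma peirceC e e' : peirce e e' -> peirce e' e.
Proof. by case=> <- re qe; split; rewrite ?cdconjK ?cdre_conj ?cdq_conj. Qed.

Lemma pmE e e' x : pm e e' x = e ** (x ** e'). Proof. by rewrite unlock. Qed.

Variables (e e' : A).
Hypothesis pe : peirce e e'.

Lemma pmD x y : pm e e' (x + y) = pm e e' x + pm e e' y.
Proof. by rewrite !pmE cdmulDl cdmulDr. Qed.
Lemma pmZ c x : pm e e' (c *: x) = c *: pm e e' x.
Proof. by rewrite !pmE cdmulZl cdmulZr. Qed.
Lemma pmN x : pm e e' (- x) = - pm e e' x.
Proof. by rewrite !pmE cdmulNl cdmulNr. Qed.
Lemma pm0 : pm e e' 0 = 0.
Proof. by rewrite !pmE cdmul0l cdmul0r. Qed.

Lemma pcj : cj e = e'. Proof. by case: pe. Qed.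
Lemma pcj' : cj e' = e. Proof. by rewrite -pcj cdconjK. Qed.
Lemma psum : e + e' = cd1.
Proof.
by have [<- re _] := pe; rewrite cdconjE re mulfV ?two_neq0 // scale1r addrC subrK.
Qed.
Lemma pmul0 : e ** e' = 0.
Proof. by have [<- _ qe] := pe; rewrite cdmul_conj qe scale0r. Qed.
Lemma pmul : e ** e = e.
Proof. by rewrite -{3}[e]cdmul1r -psum cdmulDr pmul0 addr0. Qed.
Lemma pdot : cddot e e = 0. Proof. by case: pe. Qed.
Lemma pdot' : cddot e e' = 2%:R^-1.
Proof. by have [<- re _] := pe; rewrite -cdre_mul pmul re. Qed.

Let pM u := e ** u = u /\ cdre u = 0.

Let pm_pM x : pM (pm e e' x).
Proof.
rewrite pmE; split; first by rewrite (cd_altl k3) pmul.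
rewrite cdre_mulC -cdre_mulA.
by have [<- re qe] := pe; rewrite cdconj_mul qe scale0r cdmul0r cdre0.
Qed.

Lemma pm_conj x : cj (pm e e' x) = - pm e e' x.
Proof. by case: (pm_pM x) => _ re; rewrite cdconjE re mulr0 scale0r sub0r. Qed.
Lemma pm_mull x : e ** pm e e' x = pm e e' x. Proof. by case: (pm_pM x). Qed.
Lemma pm_mull0 x : e' ** pm e e' x = 0.
Proof. by rewrite -pm_mull -pcj (cdmulKl k3) /cdq pdot scale0r. Qed.
Lemma pm_mulr x : pm e e' x ** e' = pm e e' x.
Proof.
apply: (can_inj (@cdconjK _ _)).
by rewrite cdconjM pcj' pm_conj cdmulNr pm_mull.
Qed.
Lemma pm_mulr0 x : pm e e' x ** e = 0.
Proof.
apply: (can_inj (@cdconjK _ _)).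
by rewrite cdconjM pcj pm_conj cdmulNr pm_mull0 oppr0 cdconj0.
Qed.
Lemma pm_re x : cdre (pm e e' x) = 0. Proof. by case: (pm_pM x). Qed.
Lemma pm_dot x : cddot e (pm e e' x) = 0.
Proof. by rewrite /cddot pm_conj cdmulNr pm_mull cdreN pm_re oppr0. Qed.
Lemma pm_dot' x : cddot e' (pm e e' x) = 0.
Proof. by rewrite /cddot pm_conj cdmulNr pm_mull0 oppr0 cdre0. Qed.
Lemma pm_dot0 x y : cddot (pm e e' x) (pm e e' y) = 0.
Proof. by rewrite -pm_mull cddot_mull pcj pm_mull0 cddot0r. Qed.
Lemma pm_q x : cdq (pm e e' x) = 0. Proof. exact: pm_dot0. Qed.

Lemma pmM_re x y : cdre (pm e e' x ** pm e e' y) = 0.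
Proof. by rewrite cdre_mul pm_conj cddotNr pm_dot0 oppr0. Qed.
(** The product of two elements of e A e' would be 0 in an associative algebra; here it may be
    nonzero, and it lies in the opposite space e' A e. *)
Lemma pmM_mull x y : e' ** (pm e e' x ** pm e e' y) = pm e e' x ** pm e e' y.
Proof.
have := cdmul_lin k3 e (pm e e' x) (pm e e' y).
rewrite pm_conj pcj pm_mull pm_dot mulr0 scale0r cdmulNl => /eqP.
by rewrite subr_eq0 => /eqP.
Qed.
Lemma pmM_mull0 x y : e ** (pm e e' x ** pm e e' y) = 0.
Proof. by rewrite -pmM_mull -pcj (cdmulVl k3) /cdq pdot scale0r. Qed.
Lemma pmM_mulr x y : (pm e e' x ** pm e e' y) ** e = pm e e' x ** pm e e' y.
Proof.
apply: (can_inj (@cdconjK _ _)).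
by rewrite cdconjM cdconjM pcj !pm_conj !(cdmulNl, cdmulNr) !opprK pmM_mull.
Qed.
Lemma pmM_mulr0 x y : (pm e e' x ** pm e e' y) ** e' = 0.
Proof.
apply: (can_inj (@cdconjK _ _)).
by rewrite cdconjM cdconjM pcj' !pm_conj !(cdmulNl, cdmulNr) !opprK pmM_mull0 cdconj0.
Qed.
Lemma pmM_dot x y : cddot e (pm e e' x ** pm e e' y) = 0.
Proof.
rewrite /cddot cdconjM !pm_conj !(cdmulNl, cdmulNr) !opprK.
by rewrite pmM_mull0 cdre0.
Qed.
Lemma pmM_dot' x y : cddot e' (pm e e' x ** pm e e' y) = 0.
Proof.
rewrite /cddot cdconjM !pm_conj !(cdmulNl, cdmulNr) !opprK.
by rewrite pmM_mull pmM_re.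
Qed.

Lemma pm_pm x : pm e e' (pm e e' x) = pm e e' x.
Proof. by rewrite {1}pmE pm_mulr pm_mull. Qed.
Lemma pm_e : pm e e' e = 0. Proof. by rewrite pmE pmul0 cdmul0r. Qed.

Lemma pdecomp x : x = (2%:R * cddot e' x) *: e + (2%:R * cddot e x) *: e' +
  pm e e' x + pm e' e x.
Proof.
have := cd_sandwich k3 e x; have := cd_sandwich k3 e' x.
have -> : cdq e = 0 by exact: pdot.
have -> : cdq e' = 0 by rewrite -pcj cdq_conj; exact: pdot.
rewrite !scale0r !subr0 !cddotJr pcj pcj' => <- <-; rewrite !pmE.
have E : x = (e + e') ** (x ** (e + e')) by rewrite psum cdmul1r cdmul1l.
by rewrite {1}E !(cdmulDl, cdmulDr); cdmodule.
Qed.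

End Peirce.

Section PeircePair.
Variables (F : numClosedFieldType) (k : nat).
Hypothesis k3 : (k <= 3)%N.
Local Notation A := (CD F k).
Variables (e e' : A).
Hypothesis pe : peirce e e'.

Lemma pm_pm' x : pm e e' (pm e' e x) = 0.
Proof. by rewrite {1}pmE (pm_mulr0 k3 (peirceC pe)) cdmul0r. Qed.
Lemma pm_e' : pm e e' e' = 0.
Proof. by rewrite pmE (pmul (peirceC pe)) (pmul0 pe). Qed.

Lemma pmMN x y : pm e e' x ** pm e' e y = - (2%:R * cddot (pm e e' x) (pm e' e y)) *: e.
Proof.
have pe' := peirceC pe.
set u := pm e e' x; set w := pm e' e y.
have eu : e ** (u ** w) = u ** w.
  have := cdmul_lin k3 e' u w; rewrite (pcj' pe) (pm_conj k3 pe).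
  rewrite (pm_mull k3 pe') (pm_dot' k3 pe) mulr0 scale0r cdmulNl => /eqP.
  by rewrite subr_eq0 => /eqP.
have ew : (u ** w) ** e = u ** w.
  have := cdmul_linr k3 e' w u; rewrite (pcj' pe) (pm_conj k3 pe').
  rewrite (pm_mulr k3 pe) (pm_dot k3 pe') mulr0 scale0r cdmulNr => /eqP.
  by rewrite subr_eq0 => /eqP.
have := cd_sandwich k3 e (u ** w).
have -> : cdq e = 0 by exact: pdot pe.
rewrite scale0r subr0 ew eu => ->; congr (_ *: _).
by rewrite -cdre_mul eu cdre_mul (pm_conj k3 pe') cddotNr mulrN.
Qed.

Lemma pmMM_e x y : pm e' e (pm e e' x ** pm e e' y) = pm e e' x ** pm e e' y.
Proof. by rewrite {1}pmE (pmM_mulr k3 pe) (pmM_mull k3 pe). Qed.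
Lemma pmMM_e' x y : pm e e' (pm e e' x ** pm e e' y) = 0.
Proof. by rewrite {1}pmE (pmM_mulr0 k3 pe) cdmul0r. Qed.

(* x = pc e' x e + pc e x e' + pm e e' x + pm e' e x. *)
Definition pc (e x : A) : F := 2%:R * cddot e x.

Lemma pcD x y : pc e (x + y) = pc e x + pc e y.
Proof. by rewrite /pc cddotDr mulrDr. Qed.
Lemma pcN x : pc e (- x) = - pc e x.
Proof. by rewrite /pc cddotNr mulrN. Qed.
Lemma pcZ c x : pc e (c *: x) = c * pc e x.
Proof. by rewrite /pc cddotZr mulrCA. Qed.
Lemma pc_pm x : pc e (pm e e' x) = 0. Proof. by rewrite /pc (pm_dot k3 pe) mulr0. Qed.
Lemma pc_pm' x : pc e (pm e' e x) = 0.
Proof. by rewrite /pc (pm_dot' k3 (peirceC pe)) mulr0. Qed.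
Lemma pc_e : pc e e = 0. Proof. by rewrite /pc (pdot pe) mulr0. Qed.
Lemma pc_e' : pc e e' = 1. Proof. by rewrite /pc (pdot' pe) mulfV ?two_neq0. Qed.
Lemma pc_conj x : pc e (cj x) = pc e' x. Proof. by rewrite /pc cddotJr (pcj pe). Qed.
Lemma pc_pmM x y : pc e (pm e e' x ** pm e e' y) = 0.
Proof. by rewrite /pc (pmM_dot k3 pe) mulr0. Qed.
Lemma pc_pmM' x y : pc e (pm e' e x ** pm e' e y) = 0.
Proof. by rewrite /pc (pmM_dot' k3 (peirceC pe)) mulr0. Qed.

End PeircePair.

Section PeirceProduct.
Variables (F : numClosedFieldType) (k : nat).
Hypothesis k3 : (k <= 3)%N.
Local Notation A := (CD F k).
Implicit Types (x y : A).
Variables (e e' : A).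
Hypothesis pe : peirce e e'.
Let pe' := peirceC pe.

(** Zorn's vector-matrix multiplication: scalars on the diagonal, the two Peirce spaces off it, with
    the pairing between them as scalar product and their inner products as cross products. *)
Let prod x y : x ** y =
  (pc e' x * pc e' y - 2%:R * cddot (pm e e' x) (pm e' e y)) *: e +
  (pc e x * pc e y - 2%:R * cddot (pm e' e x) (pm e e' y)) *: e' +
  (pc e' x *: pm e e' y + pc e y *: pm e e' x + pm e' e x ** pm e' e y) +
  (pc e x *: pm e' e y + pc e' y *: pm e' e x + pm e e' x ** pm e e' y).
Proof.
rewrite {1}(pdecomp k3 pe x) {1}(pdecomp k3 pe y) -!/(pc e _) -!/(pc e' _).
rewrite !(cdmulDl, cdmulDr, cdmulZl, cdmulZr) (pmul pe) (pmul pe') (pmul0 pe) (pmul0 pe').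
rewrite !(pm_mull k3 pe, pm_mull0 k3 pe, pm_mulr k3 pe, pm_mulr0 k3 pe).
rewrite !(pm_mull k3 pe', pm_mull0 k3 pe', pm_mulr k3 pe', pm_mulr0 k3 pe').
rewrite (pmMN k3 pe) (pmMN k3 pe').
by move: (pm e e' x ** pm e e' y) (pm e' e x ** pm e' e y) (pm _ _ _) (pm _ _ _) => *; cdmodule.
Qed.

Lemma pcM x y :
  pc e (x ** y) = pc e x * pc e y - 2%:R * cddot (pm e' e x) (pm e e' y).
Proof.
rewrite prod !(pcD, pcN, pcZ) (pc_e pe) (pc_e' pe).
rewrite !(pc_pm k3 pe, pc_pm' k3 pe, pc_pmM k3 pe, pc_pmM' k3 pe); ring.
Qed.

Lemma pmM x y : pm e e' (x ** y) =
  pc e' x *: pm e e' y + pc e y *: pm e e' x + pm e' e x ** pm e' e y.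
Proof.
rewrite prod !(pmD, pmZ) (pm_e pe) (pm_e' pe) !(pm_pm k3 pe, pm_pm' k3 pe).
rewrite (pmMM_e k3 pe') (pmMM_e' k3 pe).
by move: (pm e' e x ** pm e' e y) => *; cdmodule.
Qed.

Lemma pm_cj x : pm e e' (cj x) = - pm e e' x.
Proof.
rewrite {1}(pdecomp k3 pe x) !(cdconjD, cdconjZ) (pcj pe) (pcj' pe) !(pm_conj k3 pe).
rewrite !(pm_conj k3 pe') !(pmD, pmZ, pmN) (pm_e pe) (pm_e' pe).
by rewrite (pm_pm k3 pe) (pm_pm' k3 pe) !cd_zero.
Qed.

Lemma pdecompE x : x = pc e' x *: e + pc e x *: e' + pm e e' x + pm e' e x.
Proof. exact: pdecomp. Qed.

End PeirceProduct.

(** * The closed orbit contains a standard line *)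

Section Entries.
Variables (F : fieldType) (k : nat).
Local Notation A := (CD F k).
Local Notation J := (J3 F k).
Implicit Type X : J.

Definition jd1 X : F := X.1.1.1.
Definition jd2 X : F := X.1.1.2.
Definition jd3 X : F := X.1.2.
Definition jx1 X : A := X.2.1.1.
Definition jx2 X : A := X.2.1.2.
Definition jx3 X : A := X.2.2.

Lemma jd1E d1 d2 d3 (x1 x2 x3 : A) : jd1 (jmk d1 d2 d3 x1 x2 x3) = d1.
Proof. by rewrite unlock. Qed.
Lemma jd2E d1 d2 d3 (x1 x2 x3 : A) : jd2 (jmk d1 d2 d3 x1 x2 x3) = d2.
Proof. by rewrite unlock. Qed.
Lemma jd3E d1 d2 d3 (x1 x2 x3 : A) : jd3 (jmk d1 d2 d3 x1 x2 x3) = d3.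
Proof. by rewrite unlock. Qed.
Lemma jx1E d1 d2 d3 (x1 x2 x3 : A) : jx1 (jmk d1 d2 d3 x1 x2 x3) = x1.
Proof. by rewrite unlock. Qed.
Lemma jx2E d1 d2 d3 (x1 x2 x3 : A) : jx2 (jmk d1 d2 d3 x1 x2 x3) = x2.
Proof. by rewrite unlock. Qed.
Lemma jx3E d1 d2 d3 (x1 x2 x3 : A) : jx3 (jmk d1 d2 d3 x1 x2 x3) = x3.
Proof. by rewrite unlock. Qed.
Definition jcE := (jd1E, jd2E, jd3E, jx1E, jx2E, jx3E).

End Entries.

Section PolynomialCoordinates.
Variables (F : fieldType) (V : vectType F) (k : nat).
Local Notation A := (CD F k).
Implicit Types (f g : V -> A) (d : V -> F).

Lemma polymap_mul f g : polymap f -> polymap g -> polymap (fun v => f v ** g v).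
Proof.
move=> hf hg; apply: polymap_bilin => // w c x y; first exact: linearP.
by rewrite cdmulDl cdmulZl.
Qed.
Lemma polymap_conj f : polymap f -> polymap (fun v => cj (f v)).
Proof.
move=> hf; apply: (polymap_comp (f := cj) _ hf).
by apply: polymap_lin => c x y; exact: linearP.
Qed.
Lemma polymap_polyfun d : polymap (d : V -> F^o) -> polyfun d.
Proof. by move=> h; apply: (h id) => c x y. Qed.
Lemma polyfun_polymap d : polyfun d -> polymap (d : V -> F^o).
Proof.
move=> h l hl; apply: (eq_polyfun _ (polyfunM h (polyfun_cst V (l 1)))) => v /=.
by rewrite -lformZ // /GRing.scale /= mulr1.
Qed.
Lemma polyfun_dot f g : polymap f -> polymap g -> polyfun (fun v => cddot (f v) (g v)).
Proof.
move=> hf hg; apply: polymap_polyfun; apply: polymap_bilin => // w c x y.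
  by rewrite cddotDr cddotZr.
by rewrite cddotDl cddotZl.
Qed.
Lemma polymap_jmk d1 d2 d3 f1 f2 f3 :
  polyfun d1 -> polyfun d2 -> polyfun d3 -> polymap f1 -> polymap f2 -> polymap f3 ->
  polymap (fun v => jmk (d1 v) (d2 v) (d3 v) (f1 v) (f2 v) (f3 v)).
Proof.
move=> h1 h2 h3 g1 g2 g3; rewrite unlock; apply: polymap_pair.
  apply: polymap_pair; last exact: polyfun_polymap.
  by apply: polymap_pair; exact: polyfun_polymap.
by apply: polymap_pair => //; exact: polymap_pair.
Qed.

End PolynomialCoordinates.

Section PolynomialEntries.
Variables (F : fieldType) (V : vectType F) (k : nat) (f : V -> J3 F k).
Hypothesis pf : polymap f.

Lemma polyfun_jd1 : polyfun (fun v => jd1 (f v)).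
Proof. exact: (polymap_polyfun (polymap_fst (polymap_fst (polymap_fst pf)))). Qed.
Lemma polyfun_jd2 : polyfun (fun v => jd2 (f v)).
Proof. exact: (polymap_polyfun (polymap_snd (polymap_fst (polymap_fst pf)))). Qed.
Lemma polyfun_jd3 : polyfun (fun v => jd3 (f v)).
Proof. exact: (polymap_polyfun (polymap_snd (polymap_fst pf))). Qed.
Lemma polymap_jx1 : polymap (fun v => jx1 (f v)).
Proof. exact: (polymap_fst (polymap_fst (polymap_snd pf))). Qed.
Lemma polymap_jx2 : polymap (fun v => jx2 (f v)).
Proof. exact: (polymap_snd (polymap_fst (polymap_snd pf))). Qed.
Lemma polymap_jx3 : polymap (fun v => jx3 (f v)).
Proof. exact: (polymap_snd (polymap_snd pf)). Qed.

End PolynomialEntries.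

Ltac polysolve :=
  lazymatch goal with
  | |- polyfun (fun _ => ?c) => exact: polyfun_cst
  | |- polyfun (fun v => @?f v + @?g v) => apply: (@polyfunD _ _ f g); polysolve
  | |- polyfun (fun v => - @?f v) => apply: (@polyfunN _ _ f); polysolve
  | |- polyfun (fun v => @?f v * @?g v) => apply: (@polyfunM _ _ f g); polysolve
  | |- polyfun (fun v => @?f v ^+ ?n) => apply: (@polyfunX _ _ f n); polysolve
  | |- polyfun (fun v => cddot (@?f v) (@?g v)) =>
      apply: (@polyfun_dot _ _ _ f g); polysolve
  | |- polyfun (fun v => v) => apply: polyfun_lin => ? ? ?; reflexivity
  | |- polymap (fun _ => ?c) => exact: polymap_cst
  | |- polymap (fun v => v) => apply: polymap_lin => ? ? ?; reflexivity
  | |- polymap (fun v => @?f v + @?g v) => apply: (@polymapD _ _ _ f g); polysolve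
  | |- polymap (fun v => - @?f v) => apply: (@polymapN _ _ _ f); polysolve
  | |- polymap (fun v => @?f v *: @?g v) => apply: (@polymapZ _ _ _ f g); polysolve
  | |- polymap (fun v => cdmul (@?f v) (@?g v)) =>
      apply: (@polymap_mul _ _ _ f g); polysolve
  | |- polymap (fun v => cdconj (@?f v)) => apply: (@polymap_conj _ _ _ f); polysolve
  | |- polymap (fun v => wedge (@?f v) (@?g v)) =>
      apply: (@polymap_wedge _ _ _ f g); polysolve
  | |- polymap (fun v => (@?f v, @?g v)) => apply: (@polymap_pair _ _ _ _ f g); polysolve
  | |- polyfun (fun v => jd1 (@?f v)) =>
      apply: (@polyfun_jd1 _ _ _ f); polysolve
  | |- polyfun (fun v => jd2 (@?f v)) =>
      apply: (@polyfun_jd2 _ _ _ f); polysolve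
  | |- polyfun (fun v => jd3 (@?f v)) =>
      apply: (@polyfun_jd3 _ _ _ f); polysolve
  | |- polymap (fun v => jx1 (@?f v)) =>
      apply: (@polymap_jx1 _ _ _ f); polysolve
  | |- polymap (fun v => jx2 (@?f v)) =>
      apply: (@polymap_jx2 _ _ _ f); polysolve
  | |- polymap (fun v => jx3 (@?f v)) =>
      apply: (@polymap_jx3 _ _ _ f); polysolve
  | |- polymap (fun v => (@?f v).1) => apply: (@polymap_fst _ _ _ _ f); polysolve
  | |- polymap (fun v => (@?f v).2) => apply: (@polymap_snd _ _ _ _ f); polysolve
  | |- polymap (fun v => jmk (@?d1 v) (@?d2 v) (@?d3 v) (@?x1 v) (@?x2 v) (@?x3 v)) =>
      apply: (@polymap_jmk _ _ _ d1 d2 d3 x1 x2 x3); polysolve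
  | |- _ => assumption
  end.

Section Contraction.
Variables (F : numClosedFieldType) (k' : nat).
Local Notation k := k'.+1.
Hypothesis k3 : (k <= 3)%N.
Local Notation A := (CD F k).
Local Notation J := (J3 F k).
Local Notation eps := (eps F k').
Local Notation p2 x := (jmk 0 0 0 0 x 0).
Local Notation p3 x := (jmk 0 0 0 0 0 x).
Implicit Types (B C X Y : J) (c m n u v x y : A).

(** A torus automorphism multiplied by t^3. This clears the denominators of the unit c / t, so the
    expression is polynomial in t and still makes sense at t = 0. *)
Let lam (u : F) c d1 d2 d3 x1 x2 x3 : J := jmk (u ^+ 3 * d1) (u ^+ 3 * d2) (u ^+ 3 * d3)
  (u *: ((cj c ** x1) ** c)) (cj c ** ((x2 ** cj c) ** cj c)) (c ** (c ** (x3 ** c))).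

Let lam_jaut (t : F) c : t != 0 -> cdq c = t ^+ 2 -> exists2 g : 'End(J), jaut g &
  forall d1 d2 d3 x1 x2 x3,
  lam t c d1 d2 d3 x1 x2 x3 = t ^+ 3 *: g (jmk d1 d2 d3 x1 x2 x3).
Proof.
move=> t0 qc; have [r [ar rE]] := cyc_jaut F k.
pose e := t^-1 *: c; have qe : cdq e = 1 by rewrite cdqZ qc -exprMn mulVf ?expr1n.
have [g1 [a1 g1E]] := trial_jaut k3 qe.
have qe' : cdq (cj e) = 1 by rewrite cdq_conj.
have [g2 [a2 g2E]] := trial_jaut k3 qe'.
exists (g1 \o (r \o (r \o (g2 \o r))))%VF; 
  first exact: (jaut_comp a1 (jaut_comp ar (jaut_comp ar (jaut_comp a2 ar)))).
move=> d1 d2 d3 x1 x2 x3; rewrite !comp_lfunE !rE g2E !rE g1E cdconjK.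
have -> : c = t *: e by rewrite /e scalerA mulfV // scale1r.
rewrite jmkZ /lam !(cdconjZ, cdmulZl, cdmulZr) !scalerA.
by apply: jmk_eq => //; congr (_ *: _); ring.
Qed.

Let eps2 : eps ** eps = eps.
Proof.
have := cdmul_conj eps; rewrite eps_q scale0r cdconjE eps_re mulfV ?two_neq0 //.
by rewrite scale1r cdmulBr cdmul1r => /subr0_eq.
Qed.

Let dot_eps : cddot eps (cj eps) = 2%:R^-1.
Proof. by rewrite -cdre_mul eps2 eps_re. Qed.

Lemma orbit_standard (O : set {vspace J}) (x : {vspace J}) :
  O `<=` @reductions F k -> O = [set (g @: x)%VS | g in @jaut F k] ->
  pclosed [set ext2 L | L in O] -> O x ->
  exists2 g : 'End(J), jaut g & (g @: x)%VS = (<[p3 eps]> + <[p2 (cj eps)]>)%VS.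
Proof.
move=> OY OE Ocl Ox; have OJ (g : 'End(J)) L : jaut g -> O L -> O (g @: L)%VS.
  rewrite OE => ag [h ah <-]; exists (g \o h)%VF; first exact: jaut_comp.
  by rewrite limg_comp.
(* The contraction ends at the conjugate of the standard line; the automorphism induced by [bar]
   exchanges the two. *)
suff : O (<[p3 (cj eps)]> + <[p2 eps]>)%VS.
  have [b [ab bE]] := bar_jaut F k'; move=> /(OJ _ _ ab).
  rewrite limg_pair !bE !(linear_0 (@bar_linear F k')) !bar_conj !bar_eps.
  by rewrite cdconjK OE => -[g ag gE]; exists g.
have [B [C [xE w0 _ tB tC]]] := reductions_plane (OY _ Ox).
have [|h ah] := polar_exists k3 w0 tB tC.
  by move=> Z; apply: (reductions_commute k3); rewrite -xE; exact: OY.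
have := OJ _ _ ah Ox; rewrite xE limg_pair.
move: {B C xE w0 tB tC} (h B) (h C) => B C.
case: (jmkP B) => b1 b2 b3 y1 y2 y3; case: (jmkP C) => c1 c2 c3 z1 z2 z3 OBC f0.
(* The norm of c(t) is t^2, as [lam_jaut] requires, and c(0) is the isotropic element conjugate to
   [eps]. *)
pose c (t : F^o) : A := t ^+ 2 *: eps + cj eps.
pose w (t : F^o) : 'M[F]_(\dim {:J}) :=
  wedge (lam t (c t) b1 b2 b3 y1 y2 y3) (lam t (c t) c1 c2 c3 z1 z2 z3).
(* At t = 0 the sandwich by an isotropic element leaves only one coordinate at (1,2) and one at
   (3,1). The factor is the pairing with the standard line, nonzero by the choice of the
   translate. *)
have w00 : exists2 s : F, s != 0 & w 0 = s *: wedge (p3 (cj eps)) (p2 eps).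
  exists (jw (jmk b1 b2 b3 y1 y2 y3) (jmk c1 c2 c3 z1 z2 z3) (p3 eps) (p2 (cj eps))) => //.
  have c0 : c 0 = cj eps by rewrite /c expr0n scale0r add0r.
  have E (d1 d2 d3 : F) x1 x2 x3 : lam 0 (c 0) d1 d2 d3 x1 x2 x3 =
      (2%:R * cddot eps x3) *: p3 (cj eps) + (2%:R * cddot (cj eps) x2) *: p2 eps.
    rewrite /lam c0 cdconjK !expr0n !scale0r !mul0r !jmkZ !jmkD !cd_zero.
    apply: jmk_eq => //.
      by rewrite (cd_altr k3) eps2 (cd_sandwich k3) eps_q scale0r subr0 cddotJr.
    rewrite (cd_altl k3) -cdconjM eps2 (cd_sandwich k3) cdq_conj eps_q scale0r subr0.
    by rewrite cddot_conj.
  rewrite /w !E /jw !jQ_jmk !cd_zero !(cddotC y3, cddotC y2, cddotC z3, cddotC z2).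
  move: (p3 _) (p2 eps) => P Q.
  rewrite wedge_comb.
  congr (_ *: _). ring.
have [s s0 ws] := w00.
have w0 : wedge (p3 (cj eps)) (p2 eps) != 0.
  apply/eqP => E.
  have hl : lform (jQ (p3 eps)) by move=> t X Y; rewrite jQDr jQZr.
  have := contr_wedge (p3 (cj eps)) (p2 eps) hl.
  rewrite E (linear_0 (contr_linear _)) !jQ_jmk !cd_zero dot_eps mulfV ?two_neq0 //.
  rewrite scale1r => /(congr1 (jQ (p2 (cj eps)))).
  rewrite jQ0r jQ_jmk !cd_zero cddotC dot_eps mulfV ?two_neq0 // => /esym/eqP.
  by rewrite oner_eq0.
have [M OM] : exists2 M, O M & ext2 M = <[wedge (p3 (cj eps)) (p2 eps)]>%VS.
  suff : [set ext2 L | L in O] <[w (0%R : F^o)]>%VS.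
    by move=> [M OM ME]; exists M => //; rewrite ME ws vlineZ.
  apply: (pclosed_curve (p := fun t : F^o => t) Ocl).
  - by rewrite /w /lam /c; polysolve.
  - by apply: polyfun_lin => ? ? ?.
  - by exists 1; exact: oner_neq0.
  - move=> t t0; have [|g ag gE] := @lam_jaut t (c t) t0.
      rewrite /c cdqD cdqZ cdq_conj eps_q cddotZl dot_eps mulr0 !add0r mulrCA mulfV ?two_neq0 //.
      by rewrite mulr1.
    rewrite /w !gE wedgeZ vlineZ ?mulf_neq0 ?expf_neq0 // -ext2_line -limg_pair.
    by exists (g @: (<[jmk b1 b2 b3 y1 y2 y3]> + <[jmk c1 c2 c3 z1 z2 z3]>))%VS => //; exact: OJ.
  - by rewrite ws scaler_eq0 negb_or s0.
have [X [Y [ME wE]]] : exists X Y, M = (<[X]> + <[Y]>)%VS /\ wedge X Y != 0.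
  by have [X [Y [-> wXY _ _ _]]] := reductions_plane (OY _ OM); exists X, Y.
rewrite ME ext2_line => /esym E; have [r r0 rE] := vline_eqP w0 E.
suff <- : M = (<[p3 (cj eps)]> + <[p2 eps]>)%VS by [].
rewrite -(vlineZ (p3 (cj eps)) r0) ME; apply: wedge_inj => //.
by rewrite rE -[p2 eps]scale1r wedgeZ mulr1 scale1r.
Qed.

End Contraction.

(** * Regular semisimple pairs of matrices *)

Section ThreeByThree.
Variable F : fieldType.

Definition mx3 (a b c d e f g h i : F) : 'M[F]_3 :=
  \matrix_(i0, j0) nth 0 (nth [::] [:: [:: a; b; c]; [:: d; e; f]; [:: g; h; i]] i0) j0.

Lemma sum3 (V : nmodType) (f : 'I_3 -> V) : \sum_i f i = f 0 + f 1 + f (2 : 'I_3).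
Proof.
rewrite !big_ord_recl big_ord0 addr0 addrA; congr (_ + f _ + f _); exact: val_inj.
Qed.

Lemma mx3P (M : 'M[F]_3) : exists a b c d e f g h i, M = mx3 a b c d e f g h i.
Proof.
exists (M 0 0), (M 0 1), (M 0 2%R), (M 1 0), (M 1 1), (M 1 2%R), (M 2%R 0), (M 2%R 1),
  (M 2%R 2%R).
apply/matrixP => i j; rewrite mxE.
by case: i => [[|[|[|//]]] p]; case: j => [[|[|[|//]]] q]; congr (M _ _); exact: val_inj.
Qed.

Lemma mx3D a b c d e f g h i a' b' c' d' e' f' g' h' i' :
  mx3 a b c d e f g h i + mx3 a' b' c' d' e' f' g' h' i' =
  mx3 (a + a') (b + b') (c + c') (d + d') (e + e') (f + f') (g + g') (h + h') (i + i').
Proof.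
apply/matrixP => m n; rewrite !mxE.
by case: m => [[|[|[|//]]] p]; case: n => [[|[|[|//]]] q].
Qed.

Lemma mx3Z t a b c d e f g h i : t *: mx3 a b c d e f g h i =
  mx3 (t * a) (t * b) (t * c) (t * d) (t * e) (t * f) (t * g) (t * h) (t * i).
Proof.
apply/matrixP => m n; rewrite !mxE.
by case: m => [[|[|[|//]]] p]; case: n => [[|[|[|//]]] q].
Qed.

Lemma mx3M a b c d e f g h i a' b' c' d' e' f' g' h' i' :
  mx3 a b c d e f g h i * mx3 a' b' c' d' e' f' g' h' i' =
  mx3 (a * a' + b * d' + c * g') (a * b' + b * e' + c * h') (a * c' + b * f' + c * i')
      (d * a' + e * d' + f * g') (d * b' + e * e' + f * h') (d * c' + e * f' + f * i')
      (g * a' + h * d' + i * g') (g * b' + h * e' + i * h') (g * c' + h * f' + i * i').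
Proof.
apply/matrixP => m n; rewrite !mxE sum3 !mxE.
by case: m => [[|[|[|//]]] p]; case: n => [[|[|[|//]]] q].
Qed.

Lemma mx3_scalar t : t%:M = mx3 t 0 0 0 t 0 0 0 t.
Proof.
apply/matrixP => m n; rewrite !mxE.
by case: m => [[|[|[|//]]] p]; case: n => [[|[|[|//]]] q].
Qed.

Lemma mx3_0 : mx3 0 0 0 0 0 0 0 0 0 = 0 :> 'M[F]_3.
Proof.
apply/matrixP => m n; rewrite !mxE.
by case: m => [[|[|[|//]]] p]; case: n => [[|[|[|//]]] q].
Qed.

Lemma mx3_tr a b c d e f g h i : \tr (mx3 a b c d e f g h i) = a + e + i.
Proof. by rewrite /mxtrace sum3 !mxE. Qed.

End ThreeByThree.

Section MatrixSlice.
Variables (F : numClosedFieldType) (k : nat).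
Hypothesis k3 : (k <= 3)%N.
Local Notation A := (CD F k).
Local Notation J := (J3 F k).
Variables (e e' : A).
Hypothesis pe : peirce e e'.

(** The span of e and e' is the split algebra F x F, and Hermitian matrices over it are ordinary
    matrices: the e-parts and e'-parts hold opposite off-diagonal entries. Conjugation exchanges the
    two. *)
Definition io (M : 'M[F]_3) : J := jmk (M 0 0) (M 1 1) (M (2 : 'I_3) (2 : 'I_3))
  (M 1 (2 : 'I_3) *: e + M (2 : 'I_3) 1 *: e') (M (2 : 'I_3) 0 *: e + M 0 (2 : 'I_3) *: e')
  (M 0 1 *: e + M 1 0 *: e').

Lemma io_mx3 a b c d f g h i j : io (mx3 a b c d f g h i j) =
  jmk a f j (g *: e + i *: e') (h *: e + c *: e') (b *: e + d *: e').
Proof. by rewrite /io !mxE. Qed.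

Lemma io_linear : linear io.
Proof.
move=> t M N; rewrite /io !mxE jmkZ jmkD.
by apply: jmk_eq => //; cdmodule.
Qed.

Lemma io1 : io 1 = jone F k.
Proof.
rewrite -[1]/(1%:M) mx3_scalar io_mx3 jone_jmk.
by apply: jmk_eq; rewrite ?scale0r ?addr0.
Qed.

Lemma jtr_io M : jtr (io M) = \tr M.
Proof. by rewrite /io jtr_jmk /mxtrace sum3. Qed.

Lemma ee_mul a b c d : (a *: e + b *: e') ** (c *: e + d *: e') = (a * c) *: e + (b * d) *: e'.
Proof.
rewrite !(cdmulDl, cdmulDr, cdmulZl, cdmulZr) (pmul pe) (pmul0 pe) (pmul (peirceC pe)).
by rewrite (pmul0 (peirceC pe)); cdmodule.
Qed.
Lemma ee_conj a b : cj (a *: e + b *: e') = b *: e + a *: e'.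
Proof. by rewrite cdconjD !cdconjZ (pcj pe) (pcj' pe) addrC. Qed.
Lemma ee_dot a b c d :
  cddot (a *: e + b *: e') (c *: e + d *: e') = 2%:R^-1 * (a * d + b * c).
Proof.
rewrite !(cddotDl, cddotDr, cddotZl, cddotZr) (pdot pe) (pdot' pe) (pdot (peirceC pe)).
by rewrite cddotC (pdot' pe); ring.
Qed.

Lemma jm_io M N : jm (io M) (io N) = 2%:R^-1 *: io (M * N + N * M).
Proof.
have [a [b [c [d [f [g [h [i [j ->]]]]]]]]] := mx3P M.
have [a' [b' [c' [d' [f' [g' [h' [i' [j' ->]]]]]]]]] := mx3P N.
rewrite !mx3M mx3D !io_mx3 jm_jmk jmkZ !(ee_mul, ee_conj, ee_dot).
by apply: jmk_eq; (first [field | cdmodule_with ltac:(by field)]).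
Qed.

Lemma jm_horner M p q :
  jm (io (horner_mx M p)) (io (horner_mx M q)) = io (horner_mx M (p * q)).
Proof.
rewrite jm_io -!rmorphM [q * p]mulrC -mulr2n.
by rewrite -scaler_nat (linear_Z _ _ io_linear) scalerA mulVf ?two_neq0 // scale1r.
Qed.

Lemma cubic_roots (a b c : F) : exists x y z : F,
  [/\ a = x + y + z, b = x * y + y * z + z * x & c = x * y * z].
Proof.
have [|x xE] := @solve_monicpoly F 3 (fun i => nth 0 [:: c; - b; a] i); first by [].
pose s := sqrtC ((a - x) ^+ 2 - 4%:R * (b - x * (a - x))).
have sE : s ^+ 2 = (a - x) ^+ 2 - 4%:R * (b - x * (a - x)) by rewrite sqrtCK.
move: s sE => s sE; exists x, ((a - x + s) / 2%:R), ((a - x - s) / 2%:R).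
have yz : (a - x + s) / 2%:R * ((a - x - s) / 2%:R) = b - x * (a - x).
  apply: (lincomb1 (c := - 4%:R^-1 : F) sE); by field.
split; first by field.
  by rewrite [X in _ + X + _]yz; field.
rewrite -mulrA yz; move: xE; rewrite sum3 /= => xE.
by apply: (lincomb1 (c := -1 : F) xE); ring.
Qed.

Variables (M : 'M[F]_3) (x y z : F).
Hypothesis trM : \tr M = x + y + z.
Hypothesis trM2 : \tr (M * M) = x ^+ 2 + y ^+ 2 + z ^+ 2.
Hypothesis M0 : horner_mx M (('X - x%:P) * ('X - y%:P) * ('X - z%:P)) = 0.
Hypotheses (xy : x != y) (yz : y != z) (zx : z != x).

(** The Lagrange basis at three nodes. Modulo the polynomial that annihilates M these are orthogonal
    idempotents of sum 1, so [idem] gives the spectral projections. *)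
Let lag (u v w : F) : {poly F} := ((u - v) * (u - w))^-1 *: (('X - v%:P) * ('X - w%:P)).
Let idem u v w := io (horner_mx M (lag u v w)).

Let lagC p q r : lag p q r = lag p r q.
Proof. by rewrite /lag mulrC [X in _ *: X]mulrC. Qed.

Let horner_io0 (q : {poly F}) :
  io (horner_mx M (q * (('X - x%:P) * ('X - y%:P) * ('X - z%:P)))) = 0.
Proof. by rewrite rmorphM /= M0 mulr0 (linear_0 io_linear). Qed.

Let lag_idem u v w : u != v -> u != w -> exists q,
  lag u v w * lag u v w = lag u v w + q * (('X - u%:P) * ('X - v%:P) * ('X - w%:P)).
Proof.
move=> uv uw; have c0 : (u - v) * (u - w) != 0 by rewrite mulf_neq0 ?subr_eq0.
pose c := ((u - v) * (u - w))^-1; exists (c ^+ 2 *: ('X + (u - v - w)%:P)).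
have cE : c * ((u - v) * (u - w)) = 1 by rewrite mulVf.
rewrite /lag -/c -!mul_polyC !rmorphXn !rmorphD !rmorphN /=.
have : c%:P * ((u%:P - v%:P) * (u%:P - w%:P)) = 1 :> {poly F}.
  by rewrite -!rmorphB -!rmorphM cE.
move: c%:P u%:P v%:P w%:P 'X => C U V W T E.
by apply: (lincomb1 (c := C * (T - V) * (T - W)) E); ring.
Qed.

Let lag_orth u v w : exists q,
  lag u v w * lag v u w = q * (('X - u%:P) * ('X - v%:P) * ('X - w%:P)).
Proof.
exists ((((u - v) * (u - w))^-1 * ((v - u) * (v - w))^-1) *: ('X - w%:P)).
rewrite /lag -!mul_polyC polyCM.
by move: (_^-1)%:P (_^-1)%:P u%:P v%:P w%:P 'X => C D U V W T; ring.
Qed.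

Let idem_m u v w : u != v -> u != w ->
  ('X - u%:P) * ('X - v%:P) * ('X - w%:P) = ('X - x%:P) * ('X - y%:P) * ('X - z%:P) ->
  jm (idem u v w) (idem u v w) = idem u v w.
Proof.
move=> uv uw E; have [q qE] := lag_idem uv uw.
by rewrite /idem jm_horner qE E raddfD (linear_D _ _ io_linear) horner_io0 addr0.
Qed.

Let idem_m0 u v w :
  ('X - u%:P) * ('X - v%:P) * ('X - w%:P) = ('X - x%:P) * ('X - y%:P) * ('X - z%:P) ->
  jm (idem u v w) (idem v u w) = 0.
Proof.
by move=> E; have [q qE] := lag_orth u v w; rewrite /idem jm_horner qE E horner_io0.
Qed.

Let io_poly (c0 c1 c2 : F) : {poly F} := c2 *: ('X * 'X) + c1 *: 'X + c0 *: 1.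

Let lagE u v w : let d := ((u - v) * (u - w))^-1 in
  lag u v w = io_poly (d * (v * w)) (- (d * (v + w))) d.
Proof.
rewrite /lag /io_poly /= -!mul_polyC !(rmorphN, rmorphM, rmorphD) /=.
by move: (_^-1)%:P v%:P w%:P 'X => C V W T; ring.
Qed.

Let horner_poly c0 c1 c2 :
  horner_mx M (io_poly c0 c1 c2) = c2 *: (M * M) + c1 *: M + c0 *: 1.
Proof. by rewrite !raddfD /= !linearZ /= rmorphM /= horner_mx_X rmorph1. Qed.

Let idem_tr u v w : u != v -> u != w -> u + v + w = x + y + z ->
  u ^+ 2 + v ^+ 2 + w ^+ 2 = x ^+ 2 + y ^+ 2 + z ^+ 2 -> jtr (idem u v w) = 1.
Proof.
move=> uv uw E1 E2; rewrite /idem jtr_io lagE horner_poly !raddfD /= !mxtraceZ trM2 trM.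
rewrite -E1 -E2 mxtrace1; field.
by rewrite !subr_eq0 uv uw.
Qed.

Lemma lagrange_interp c0 c1 c2 : let p t := c0 + c1 * t + c2 * t ^+ 2 in
  c2 *: (M * M) + c1 *: M + c0 *: 1 = p x *: horner_mx M (lag x y z) +
    p y *: horner_mx M (lag y z x) + p z *: horner_mx M (lag z x y).
Proof.
rewrite /= !lagE !horner_poly.
have zy : z != y by rewrite eq_sym.
have xz : x != z by rewrite eq_sym.
move: (M * M) (1 : 'M[F]_3) => M2 M1.
lmodule_over F ('M[F]_3) ltac:(by field; rewrite !subr_eq0 xy yz zx zy xz ?[y == x]eq_sym ?xy).
Qed.

Let idemC u v w : idem u v w = idem u w v. Proof. by rewrite /idem lagC. Qed.

Lemma lagrange_frame : frame (idem x y z) (idem y z x) (idem z x y).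
Proof.
have yx : y != x by rewrite eq_sym.
have zy : z != y by rewrite eq_sym.
have xz : x != z by rewrite eq_sym.
split.
- by split; apply: idem_m => //; ring.
- split.
  + by rewrite (idemC y); apply: idem_m0; ring.
  + by rewrite (idemC x); apply: idem_m0; ring.
  + by rewrite (idemC z); apply: idem_m0; ring.
- by split; apply: idem_tr => //; ring.
have /= := lagrange_interp 1 0 0.
rewrite !(scale0r, mul0r, add0r, addr0, scale1r) -io1 => {1}->.
by rewrite !(linear_D _ _ io_linear).
Qed.

(** By interpolation, polynomials in M of degree at most 2 are combinations of the three spectral
    idempotents, hence of two of them modulo the identity. Equality of the lines follows from
    dimensions. *)
Lemma lagrange_secant X Y c0 c1 c2 d0 d1 d2 :
  X = jproj (io (c2 *: (M * M) + c1 *: M + c0 *: 1)) ->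
  Y = jproj (io (d2 *: (M * M) + d1 *: M + d0 *: 1)) ->
  wedge X Y != 0 -> secant_lines (<[X]> + <[Y]>)%VS.
Proof.
move=> XE YE w0; have fr := lagrange_frame.
apply/(secant_linesP _ k3); exists (idem x y z), (idem y z x), (idem z x y); split=> //.
have [_ _ _ one] := fr.
have j3 : jproj (idem z x y) = - jproj (idem x y z) - jproj (idem y z x).
  have : jproj (jone F k) = 0.
    by rewrite /jproj jtr1 mulVf ?three_neq0 // scale1r subrr.
  rewrite -one !(linear_D _ _ (@jproj_linear F k)).
  by move: (jproj _) (jproj _) (jproj _) => a b c E; apply: (eq_from (c := 1) E); jmodule.
have mem c0' c1' c2' : jproj (io (c2' *: (M * M) + c1' *: M + c0' *: 1)) \in
    (<[jproj (idem x y z)]> + <[jproj (idem y z x)]>)%VS.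
  rewrite lagrange_interp !(linear_D _ _ io_linear) !(linear_Z _ _ io_linear).
  rewrite !(linear_D _ _ (@jproj_linear F k)) !(linear_Z _ _ (@jproj_linear F k)) j3.
  move: (jproj (idem x y z)) (jproj (idem y z x)) => a b.
  have m1 : a \in (<[a]> + <[b]>)%VS by rewrite (subvP (addvSl _ _)) ?memv_line.
  have m2 : b \in (<[a]> + <[b]>)%VS by rewrite (subvP (addvSr _ _)) ?memv_line.
  by rewrite !memvD // ?memvZ // memvB ?memvN.
apply/eqP; rewrite eqEdim; apply/andP; split.
  by rewrite subv_add -!memvE XE YE; apply/andP; split; exact: mem.
have -> : \dim (<[X]> + <[Y]>)%VS = 2%N by apply/wedge_dim2.
rewrite (@secant_lines_dim2 F k) //.
by apply/(secant_linesP _ k3); exists (idem x y z), (idem y z x), (idem z x y).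
Qed.

End MatrixSlice.

Section Slice.
Variables (F : numClosedFieldType) (k : nat).
Hypothesis k3 : (k <= 3)%N.
Local Notation A := (CD F k).
Local Notation J := (J3 F k).
Variables (e e' : A).
Hypothesis pe : peirce e e'.

(* Two commuting matrices with first columns (0, 1, 0) and (0, 0, 1) are
   determined by their lower right blocks. *)
Definition slice1 (a b c d f g : F) : J :=
  let s := c * b + d ^+ 2 - a * d - b * g in
  let t := b * f - c * d in
  jproj (jmk 0 a d (c *: e + b *: e') (t *: e') (s *: e + 1 *: e')).

Definition slice2 (a b c d f g : F) : J :=
  let t := b * f - c * d in
  let u := c ^+ 2 + d * f - f * a - g * c in
  jproj (jmk 0 c g (f *: e + d *: e') (1 *: e + u *: e') (t *: e)).

Let M1 a b c d f g : 'M[F]_3 := mx3 0 (c * b + d ^+ 2 - a * d - b * g) (b * f - c * d) 1 a c 0 b d.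
Let M2 a b c d f g : 'M[F]_3 := mx3 0 (b * f - c * d) (c ^+ 2 + d * f - f * a - g * c) 0 c f 1 d g.

Let slice1E a b c d f g : slice1 a b c d f g = jproj (io e e' (M1 a b c d f g)).
Proof. by rewrite io_mx3 scale0r add0r. Qed.
Let slice2E a b c d f g : slice2 a b c d f g = jproj (io e e' (M2 a b c d f g)).
Proof. by rewrite io_mx3 scale0r addr0. Qed.

Lemma jproj_jmk d1 d2 d3 (x1 x2 x3 : A) : let t := 3%:R^-1 * (d1 + d2 + d3) in
  jproj (jmk d1 d2 d3 x1 x2 x3) = jmk (d1 - t) (d2 - t) (d3 - t) x1 x2 x3.
Proof.
rewrite /jproj jtr_jmk jone_jmk jmkZ jmkB !cd_zero.
by apply: jmk_eq => //; rewrite mulr1.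
Qed.

Lemma slice_wedge a b c d f g : wedge (slice1 a b c d f g) (slice2 a b c d f g) != 0.
Proof.
apply/eqP => E; have hl : lform (jQ (jmk 0 0 0 0 0 e)) by move=> t X Y; rewrite jQDr jQZr.
have := contr_wedge (slice1 a b c d f g) (slice2 a b c d f g) hl.
rewrite E (linear_0 (contr_linear _)) /slice1 /slice2 !jproj_jmk !jQ_jmk !cd_zero.
rewrite !(cddotDr, cddotZr) (pdot pe) (pdot' pe) !cd_zero mul1r mulfV ?two_neq0 // scale1r.
move=> /(congr1 (jQ (jmk 0 0 0 0 e' 0))).
rewrite jQ0r jQ_jmk !cd_zero !(cddotDr, cddotZr) cddotC (pdot' pe) (pdot (peirceC pe)).
by rewrite !cd_zero mul1r mulfV ?two_neq0 // => /esym/eqP; rewrite oner_eq0.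
Qed.

(** The discriminant of the monic cubic with elementary symmetric functions s1, s2, s3 of its roots;
    [D] is that of the characteristic polynomial of [M1]. *)
Let disc (s1 s2 s3 : F) := s1 ^+ 2 * s2 ^+ 2 - 4%:R * s2 ^+ 3 - 4%:R * s1 ^+ 3 * s3 +
  18%:R * s1 * s2 * s3 - 27%:R * s3 ^+ 2.

Let D a b c d f g := let s := c * b + d ^+ 2 - a * d - b * g in
  let t := b * f - c * d in disc (a + d) (a * d - b * c - s) (b * t - d * s).

Lemma slice_secant a b c d f g : b != 0 -> D a b c d f g != 0 ->
  secant_lines (<[slice1 a b c d f g]> + <[slice2 a b c d f g]>)%VS.
Proof.
move=> b0; rewrite /D.
set s := c * b + d ^+ 2 - a * d - b * g; set t := b * f - c * d => D0.
have [x [y [z [s1 s2 s3]]]] := cubic_roots (a + d) (a * d - b * c - s) (b * t - d * s).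
have DE : disc (a + d) (a * d - b * c - s) (b * t - d * s) =
    ((x - y) * (y - z) * (z - x)) ^+ 2.
  by rewrite s1 s2 s3 /disc; ring.
move: D0; rewrite DE expf_eq0 /= !mulf_eq0 !subr_eq0 !negb_or -andbA => /and3P[xy yz zx].
have H := @lagrange_secant F k k3 e e' pe (M1 a b c d f g) x y z.
have E1 : slice1 a b c d f g = jproj (io e e' (0 *: (M1 a b c d f g * M1 a b c d f g) +
   1 *: M1 a b c d f g + 0 *: 1)).
  by rewrite slice1E !scale0r add0r addr0 scale1r.
(* The first basis vector is cyclic for [M1] when b is nonzero: it goes to the second, whose image
   is s, a, b in coordinates. Solving for the third basis vector, to which [M2] sends the first,
   gives [M2] as a polynomial in [M1]. *)
have E2 : slice2 a b c d f g = jproj (io e e' (b^-1 *: (M1 a b c d f g * M1 a b c d f g) +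
   (- a / b) *: M1 a b c d f g + (- s / b) *: 1)).
  rewrite slice2E -[1]/(1%:M) mx3_scalar mx3M !mx3Z !mx3D; congr (jproj (io _ _ _)).
  by congr (mx3 _ _ _ _ _ _ _ _ _); rewrite /s /t; field.
apply: (H _ _ _ xy yz zx _ _ _ _ _ _ _ _ E1 E2 (slice_wedge a b c d f g)) => {E1 E2 H}.
- by rewrite mx3_tr -s1 add0r.
- have -> : x ^+ 2 + y ^+ 2 + z ^+ 2 = (x + y + z) ^+ 2 - 2%:R * (x * y + y * z + z * x) by ring.
  by rewrite -s1 -s2 mx3M mx3_tr /s; ring.
- have -> : ('X - x%:P) * ('X - y%:P) * ('X - z%:P) =
      'X * 'X * 'X - (x + y + z) *: ('X * 'X) + (x * y + y * z + z * x) *: 'X -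
      (x * y * z) *: 1 :> {poly F}.
    rewrite -!mul_polyC !(rmorphN, rmorphM, rmorphD) /=.
    by move: x%:P y%:P z%:P 'X => U V W T; ring.
  rewrite -s1 -s2 -s3 !(rmorphB, rmorphD) /= !linearZ /= !rmorphM /= rmorph1 !horner_mx_X.
  rewrite -[1]/(1%:M) mx3_scalar !scalerN -!scaleNr /M1 !mx3M !mx3Z !mx3D -mx3_0.
  by congr (mx3 _ _ _ _ _ _ _ _ _); rewrite /s /t; ring.
Qed.

Lemma slice_reductions a b c d f g :
  reductions (<[slice1 a b c d f g]> + <[slice2 a b c d f g]>)%VS.
Proof.
have w0 := slice_wedge a b c d f g; split.
  split; first exact/wedge_dim2.
  by rewrite subv_add -!memvE !memJ30 /slice1 /slice2 !jproj_jmk !jtr_jmk; apply/andP; split;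
    apply/eqP; field.
rewrite ext2_line => Z Zcl Zsec.
(* A segment of parameters ending at the given ones. It starts at b = f = 1 and all others 0, where
   the characteristic polynomial is T^3 - 1, of discriminant -27, so generic points of the segment
   give secant lines. *)
pose h (x y : F) (t : F^o) : F := x + t * (y - x).
pose P (t : F^o) := wedge
  (slice1 (h 0 a t) (h 1 b t) (h 0 c t) (h 0 d t) (h 1 f t) (h 0 g t))
  (slice2 (h 0 a t) (h 1 b t) (h 0 c t) (h 0 d t) (h 1 f t) (h 0 g t)).
pose p (t : F^o) := h 1 b t *
  D (h 0 a t) (h 1 b t) (h 0 c t) (h 0 d t) (h 1 f t) (h 0 g t).
have P1 : P 1 = wedge (slice1 a b c d f g) (slice2 a b c d f g).
  by rewrite /P /h !mul1r !(addrC _ (_ - _)) !subrK.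
rewrite -P1; apply: (pclosed_curve (p := p) Zcl).
- have pj u : polymap u -> polymap (fun t : F^o => @jproj F k (u t)).
    by apply: polymap_comp; apply: polymap_lin; exact: jproj_linear.
  by rewrite /P /slice1 /slice2 /h; apply: polymap_wedge; apply: pj; polysolve.
- by rewrite /p /D /disc /h /=; polysolve.
- exists 0; rewrite /p /D /disc /h !mul0r !addr0 !mulr1; apply/eqP => E.
  have : 27%:R = 0 :> F by apply: (lincomb1 (c := -1) E); ring.
  by apply/eqP; rewrite pnatr_eq0.
- move=> t; rewrite /p mulf_eq0 negb_or => /andP[b0 D0].
  rewrite -ext2_line; apply: Zsec; eexists; last reflexivity.
  exact: slice_secant.
by rewrite P1.
Qed.

End Slice.

(** * The cell of lines in general position with the standard one *)

Section CommutingPairs.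
Variables (F : numClosedFieldType) (k : nat).
Local Notation A := (CD F k).
Local Notation J := (J3 F k).
Implicit Types (n x y : A).

Definition commuting (X Y : J) := forall Z, jm X (jm Y Z) = jm Y (jm X Z).

Variables (a1 a2 a3 b1 b2 b3 : F) (x1 x2 x3 y1 y2 y3 : A).
Hypothesis com : commuting (jmk a1 a2 a3 x1 x2 x3) (jmk b1 b2 b3 y1 y2 y3).

(** Commutation evaluated at the diagonal idempotents; the next two lemmas evaluate it at
    off-diagonal vectors. *)
Lemma commuting_diag :
  [/\ (a2 - a3) *: y1 - (b2 - b3) *: x1 = cj (x2 ** y3) - cj (y2 ** x3),
      (a3 - a1) *: y2 - (b3 - b1) *: x2 = cj (x3 ** y1) - cj (y3 ** x1) &
      (a1 - a2) *: y3 - (b1 - b2) *: x3 = cj (x1 ** y2) - cj (y1 ** x2)].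
Proof.
have := com (jmk 1 0 0 0 0 0); rewrite !jm_jmk !cd_zero => /jmk_inj[_ [_ h2 h3]].
have := com (jmk 0 1 0 0 0 0); rewrite !jm_jmk !cd_zero => /jmk_inj[_ [h1 _ _]].
move: h1 h2 h3; rewrite !(cdmulZl, cdmulZr, cdconjZ) => h1 h2 h3; split.
- by apply: (eq_from (c := - 4%:R) h1); cdmodule_with ltac:(by field).
- by apply: (eq_from (c := 4%:R) h2); cdmodule_with ltac:(by field).
- by apply: (eq_from (c := - 4%:R) h3); cdmodule_with ltac:(by field).
Qed.

Lemma commuting_off3 n :
  (4%:R * cddot y3 n) *: x3 - (4%:R * cddot x3 n) *: y3 =
  (n ** x1) ** cj y1 - (n ** y1) ** cj x1 + cj y2 ** (x2 ** n) - cj x2 ** (y2 ** n).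
Proof.
have := com (jmk 0 0 0 0 0 n); rewrite !jm_jmk !cd_zero => /jmk_inj[_ [_ _ h3]].
move: h3; rewrite !(cdmulZl, cdmulZr, cdmulDl, cdmulDr, cdconjZ, cdconjD, cdconjM, cdconjK) => h3.
by apply: (eq_from (c := 4%:R) h3); cdmodule_with ltac:(by field).
Qed.

Lemma commuting_off2 n :
  (4%:R * cddot y2 n) *: x2 - (4%:R * cddot x2 n) *: y2 =
  (n ** x3) ** cj y3 - (n ** y3) ** cj x3 + cj y1 ** (x1 ** n) - cj x1 ** (y1 ** n).
Proof.
have := com (jmk 0 0 0 0 n 0); rewrite !jm_jmk !cd_zero => /jmk_inj[_ [_ h3 _]].
move: h3; rewrite !(cdmulZl, cdmulZr, cdmulDl, cdmulDr, cdconjZ, cdconjD, cdconjM, cdconjK) => h3.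
by apply: (eq_from (c := 4%:R) h3); cdmodule_with ltac:(by field).
Qed.

End CommutingPairs.

Section Elementary.
Variables (F : numClosedFieldType) (k : nat).
Hypothesis k3 : (k <= 3)%N.
Local Notation A := (CD F k).
Local Notation J := (J3 F k).
Implicit Types (a b c : A) (X Y : J).

(** The automorphisms again, now as explicit functions of the entries: the change of coordinates
    must be polynomial in the parameter c, which a bare existence statement for each c does not
    provide. *)
Definition jrot X := jmk (jd2 X) (jd3 X) (jd1 X) (jx2 X) (jx3 X) (jx1 X).

Definition jtau c X :=
  jmk (jd1 X + 2%:R * cddot c (jx3 X)) (jd2 X - 2%:R * cddot c (jx3 X)) (jd3 X)
      (jx1 X - cj (jx2 X ** c)) (jx2 X + cj (c ** jx1 X))
      (jx3 X + (jd2 X - jd1 X - 2%:R * cddot c (jx3 X)) *: c).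

Definition jsigma a b X := jmk (jd1 X) (jd2 X) (jd3 X)
  (jx1 X - cj a ** (b ** jx1 X)) (jx2 X - jx2 X ** b ** cj a)
  (jx3 X + (2%:R * cddot a (jx3 X)) *: b - (2%:R * cddot b (jx3 X)) *: a).

Definition jaut_fun (f : J -> J) := exists2 g : 'End(J), jaut g & f =1 g.

Lemma jaut_fun_comp f g : jaut_fun f -> jaut_fun g -> jaut_fun (f \o g).
Proof.
move=> [f' af fE] [g' ag gE]; exists (f' \o g')%VF; first exact: jaut_comp.
by move=> X; rewrite comp_lfunE /= gE fE.
Qed.

Lemma jrot_jaut : jaut_fun jrot.
Proof.
have [g [ag gE]] := cyc_jaut F k; exists g => // X.
by case: (jmkP X) => *; rewrite gE /jrot !jcE.
Qed.

Lemma jtau_jaut c : cdq c = 0 -> jaut_fun (jtau c).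
Proof.
move=> qc; have [g [ag gE]] := tau_jaut k3 qc; exists g => // X.
by case: (jmkP X) => *; rewrite gE /jtau !jcE.
Qed.

Lemma jsigma_jaut a b : cdq a = 0 -> cdq b = 0 -> cddot a b = 0 -> jaut_fun (jsigma a b).
Proof.
move=> qa qb ab; have [g [ag gE]] := sigma_jaut k3 qa qb ab; exists g => // X.
by case: (jmkP X) => *; rewrite gE /jsigma !jcE.
Qed.

Lemma jrotK X : jrot (jrot (jrot X)) = X.
Proof. by case: (jmkP X) => *; rewrite /jrot !jcE. Qed.

Lemma jtauK c X : cdq c = 0 -> jtau (- c) (jtau c X) = X.
Proof.
move=> qc; case: (jmkP X) => d1 d2 d3 x1 x2 x3; rewrite /jtau !jcE.
have c0 : cddot c c = 0 by [].
rewrite !(cddotNl, cddotDr, cddotZr) c0 mulr0 addr0.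
rewrite !(cdmulNr, cdmulNl, cdmulDl, cdmulDr, cdconjN, cdconjD, cdconjM, cdconjK).
rewrite (cdmulKl k3) (cdmulKr k3) qc !scale0r.
by apply: jmk_eq; (first [ring | cdmodule]).
Qed.

Lemma jsigmaK a b X : cdq a = 0 -> cdq b = 0 -> cddot a b = 0 ->
  jsigma a (- b) (jsigma a b X) = X.
Proof.
move=> qa qb ab; case: (jmkP X) => d1 d2 d3 x1 x2 x3; rewrite /jsigma !jcE.
have aba : cj a ** (b ** cj a) = 0.
  by rewrite (cd_sandwich k3) cddot_conj ab mulr0 scale0r cdq_conj qa scale0r subrr.
have aa : cddot a a = 0 by []. have bb : cddot b b = 0 by [].
rewrite !(cddotNl, cddotBr, cddotDr, cddotZr) aa bb ab (cddotC b a) ab !mulr0.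
rewrite !(cdmulNr, cdmulNl, cdmulBl, cdmulBr) -(moufang_l k3) -(moufang_r k3) aba !cd_zero.
by apply: jmk_eq; (first [ring | cdmodule]).
Qed.

End Elementary.

Section Cells.
Variable F : fieldType.
Implicit Types T W V : vectType F.

(** The inverse is required to be the restriction of a polynomial map on the whole of W, so the
    definition makes sense for a set that is neither open nor closed, and it is what the chart
    needs. *)
Definition cell T W (S : set W) := exists (Ps : T -> W) (Th : W -> T),
  [/\ polymap Ps, polymap Th, (forall t, S (Ps t)), cancel Ps Th &
      forall w, S w -> Ps (Th w) = w].

(* [S] is the product of [V] and the slice [z = 0] when a polynomial family of
   bijections of [S] translates [z]. *)
Lemma cell_shift T W V (S S0 : set W) (z : W -> V) (a : V -> W -> W) :
  polymap z -> polymap (fun u : (V * W)%type => a u.1 u.2) ->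
  (forall w, S0 w <-> S w /\ z w = 0) ->
  (forall v w, S w -> [/\ S (a v w), z (a v w) = z w + v & a (- v) (a v w) = w]) ->
  cell T S0 -> cell (V * T)%type S.
Proof.
move=> pz pa S0E aE [Ps [Th [pPs pTh SPs PsK ThK]]].
exists (fun t => a t.1 (Ps t.2)), (fun w => (z w, Th (a (- z w) w))); split.
- apply: (polymap_comp (f := fun u : (V * W)%type => a u.1 u.2)
    (g := fun t : (V * T)%type => (t.1, Ps t.2)) pa).
  apply: polymap_pair; first by apply: polymap_lin => c u v.
  by apply: (polymap_comp pPs); apply: polymap_lin => c u v.
- apply: polymap_pair => //; apply: (polymap_comp pTh).
  apply: (polymap_comp (f := fun u : (V * W)%type => a u.1 u.2)
    (g := fun w : W => (- z w, w)) pa).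
  by apply: polymap_pair; [exact: polymapN | apply: polymap_lin => c u v].
- by move=> t; have [] := aE t.1 (Ps t.2) (proj1 ((S0E _).1 (SPs _))).
- move=> [v t] /=; have [Sw zw] := (S0E _).1 (SPs t).
  by have [_ -> aK] := aE v _ Sw; rewrite zw add0r aK PsK.
move=> w Sw /=; have [Saw zaw aK] := aE (- z w) _ Sw.
rewrite ThK; last by apply/S0E; split=> //; rewrite zaw subrr.
by rewrite opprK in aK; rewrite aK.
Qed.

End Cells.

Section PeirceShifts.
Variables (F : numClosedFieldType) (k : nat).
Hypothesis k3 : (k <= 3)%N.
Local Notation A := (CD F k).
Local Notation J := (J3 F k).
Variables (e e' : A).
Hypothesis pe : peirce e e'.
Let pe' := peirceC pe.
Implicit Types (X : J) (c x y : A).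

Let pE := (pcM k3 pe, pcM k3 pe', pmM k3 pe, pmM k3 pe', @pcD F k, @pcN F k, @pcZ F k,
  @pmD F k, @pmN F k, @pmZ F k).
Let pV := (pc_conj pe, pc_conj pe', pm_cj k3 pe, pm_cj k3 pe', pc_e pe, pc_e pe',
  pc_e' pe, pc_e' pe', pm_e pe, pm_e pe', pm_e' pe, pm_e' pe', pc_pm k3 pe, pc_pm k3 pe',
  pc_pm' k3 pe, pc_pm' k3 pe', pm_pm k3 pe, pm_pm k3 pe', pm_pm' k3 pe, pm_pm' k3 pe').

Definition jtau1 c X := jrot (jrot (jtau c (jrot X))).
Definition jtau2 c X := jrot (jtau c (jrot (jrot X))).
Definition jsigma2 a b X := jrot (jsigma a b (jrot (jrot X))).

(** The pattern of the six shifts: both pairings with the standard line are kept, and one Peirce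
    component is translated by the parameter times one of these pairings. On a normalised basis that
    pairing is 1 in one vector and 0 in the other, so a single component moves. *)
Lemma shift_tau3 c0 X : let c := pm e e' c0 in let Y := jtau c X in
  [/\ pc e (jx3 Y) = pc e (jx3 X), pc e' (jx2 Y) = pc e' (jx2 X) &
      pm e e' (jx1 Y) = pm e e' (jx1 X) + pc e' (jx2 X) *: c].
Proof.
rewrite /= /jtau !jcE !(pE, pV, cd_zero); by rewrite ?opprK; split.
Qed.

Lemma shift_tau2 c0 X : let c := pm e e' c0 in let Y := jtau2 c X in
  [/\ pc e (jx3 Y) = pc e (jx3 X), pc e' (jx2 Y) = pc e' (jx2 X) &
      pm e e' (jx1 Y) = pm e e' (jx1 X) - pc e (jx3 X) *: c].
Proof.
rewrite /= /jtau2 /jrot /jtau !jcE !(pE, pV, cd_zero); by rewrite ?opprK; split.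
Qed.

Lemma shift_sigma3' c0 X : let c := pm e' e c0 in let Y := jsigma e c X in
  [/\ pc e (jx3 Y) = pc e (jx3 X), pc e' (jx2 Y) = pc e' (jx2 X),
      pm e e' (jx1 Y) = pm e e' (jx1 X) &
      pm e' e (jx3 Y) = pm e' e (jx3 X) + pc e (jx3 X) *: c].
Proof.
rewrite /= /jsigma !jcE !(pcj pe) !(pE, pV, cd_zero); by rewrite ?opprK; split.
Qed.

Lemma shift_sigma2 c0 X : let c := pm e' e c0 in let Y := jsigma2 e' c X in
  [/\ pc e (jx3 Y) = pc e (jx3 X), pc e' (jx2 Y) = pc e' (jx2 X),
      pm e e' (jx1 Y) = pm e e' (jx1 X), pm e' e (jx3 Y) = pm e' e (jx3 X) &
      pm e' e (jx2 Y) = pm e' e (jx2 X) + pc e' (jx2 X) *: c].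
Proof.
rewrite /= /jsigma2 /jrot /jsigma !jcE !(pcj pe') !(pE, pV, cd_zero); by rewrite ?opprK; split.
Qed.

Lemma shift_tau1 c0 X : let c := pm e' e c0 in let Y := jtau1 c X in
  [/\ pc e (jx3 Y) = pc e (jx3 X), pc e' (jx2 Y) = pc e' (jx2 X),
      pm e e' (jx1 Y) = pm e e' (jx1 X),
      pm e' e (jx2 Y) = pm e' e (jx2 X) + pc e (jx3 X) *: c &
      pm e' e (jx3 Y) = pm e' e (jx3 X) - pc e' (jx2 X) *: c].
Proof.
rewrite /= /jtau1 /jrot /jtau !jcE !(pE, pV, cd_zero); by rewrite ?opprK; split.
Qed.

Lemma shift_sigma3 c0 X : let c := pm e e' c0 in let Y := jsigma e c X in
  [/\ [/\ pc e (jx3 Y) = pc e (jx3 X), pc e' (jx2 Y) = pc e' (jx2 X) &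
      pm e e' (jx1 Y) = pm e e' (jx1 X)],
      pm e' e (jx2 Y) = pm e' e (jx2 X), pm e' e (jx3 Y) = pm e' e (jx3 X) &
      pm e e' (jx3 Y) = pm e e' (jx3 X) + pc e (jx3 X) *: c].
Proof.
rewrite /= /jsigma !jcE !(pcj pe) !(pE, pV, cd_zero); by rewrite ?opprK; split.
Qed.

Lemma polymap_jrot (U : vectType F) (f : U -> J) :
  polymap f -> polymap (fun u => jrot (f u)).
Proof. by move=> pf; rewrite /jrot; polysolve. Qed.
Lemma polymap_jtau (U : vectType F) (c : U -> A) (f : U -> J) :
  polymap c -> polymap f -> polymap (fun u => jtau (c u) (f u)).
Proof. by move=> pc pf; rewrite /jtau; polysolve. Qed.
Lemma polymap_jsigma (U : vectType F) a (c : U -> A) (f : U -> J) :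
  polymap c -> polymap f -> polymap (fun u => jsigma a (c u) (f u)).
Proof. by move=> pc pf; rewrite /jsigma; polysolve. Qed.

End PeirceShifts.

Section StandardCell.
Variables (F : numClosedFieldType) (k : nat).
Hypothesis k3 : (k <= 3)%N.
Local Notation A := (CD F k).
Local Notation J := (J3 F k).
Local Notation W := (J * J)%type.
Variables (e e' : A).
Hypothesis pe : peirce e e'.
Let pe' := peirceC pe.
(** A common parameter space for the two Peirce spaces, with linear inverses defined on the whole
    algebra so that the coordinates are polynomial maps. *)
Variables (V : vectType F) (m m' : V -> A) (mi mi' : A -> V).
Hypotheses (lm : linear m) (lm' : linear m') (lmi : linear mi) (lmi' : linear mi').
Hypotheses (mM : forall v, pm e e' (m v) = m v) (mM' : forall v, pm e' e (m' v) = m' v).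
Hypotheses (mK : cancel m mi) (mK' : cancel m' mi').
Hypothesis miK : forall x, m (mi (pm e e' x)) = pm e e' x.
Hypothesis miK' : forall x, m' (mi' (pm e' e x)) = pm e' e x.
Implicit Types (X : J) (w : W) (v : V).

Definition general w := [/\ reductions (<[w.1]> + <[w.2]>)%VS,
  pc e (jx3 w.1) = 1, pc e' (jx2 w.1) = 0, pc e (jx3 w.2) = 0 & pc e' (jx2 w.2) = 1].

Definition slice w := general w /\
  [/\ pm e e' (jx1 w.2) = 0, pm e e' (jx1 w.1) = 0, pm e' e (jx3 w.1) = 0,
      pm e' e (jx2 w.2) = 0 & pm e' e (jx3 w.2) = 0 /\ pm e e' (jx3 w.1) = 0].

Let act (f : J -> J) w : W := (f w.1, f w.2).

Let general_act f w : jaut_fun f -> (forall X, pc e (jx3 (f X)) = pc e (jx3 X)) ->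
  (forall X, pc e' (jx2 (f X)) = pc e' (jx2 X)) -> general w -> general (act f w).
Proof.
move=> [g ag gE] h3 h2 [Y h1x h2x h1y h2y]; split; rewrite /= ?h3 ?h2 //.
by rewrite !gE -limg_pair; apply: (jaut_reductions k3).
Qed.

Let z1 w := mi (pm e e' (jx1 w.2)).
Let z2 w := mi (pm e e' (jx1 w.1)).
Let z3 w := mi' (pm e' e (jx3 w.1)).
Let z4 w := mi' (pm e' e (jx2 w.2)).
Let z5 w := mi' (pm e' e (jx3 w.2)).
Let z6 w := mi (pm e e' (jx3 w.1)).
Let S1 w := general w /\ z1 w = 0.
Let S2 w := S1 w /\ z2 w = 0.
Let S3 w := S2 w /\ z3 w = 0.
Let S4 w := S3 w /\ z4 w = 0.
Let S5 w := S4 w /\ z5 w = 0.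
Let S6 w := S5 w /\ z6 w = 0.

Let linear_pm a b : linear (@pm F k a b).
Proof. by move=> c x y; rewrite pmD pmZ. Qed.
Let poly_z (f : W -> A) a b (n : A -> V) : linear n -> polymap f ->
  polymap (fun w => n (pm a b (f w))).
Proof.
move=> ln pf; apply: (polymap_comp (f := n) (polymap_lin ln)).
by apply: (polymap_comp (f := pm a b) _ pf); exact: polymap_lin.
Qed.

Let mq v : cdq (m v) = 0. Proof. by rewrite -mM (pm_q k3 pe). Qed.
Let mq' v : cdq (m' v) = 0. Proof. by rewrite -mM' (pm_q k3 pe'). Qed.
Let mN v : m (- v) = - m v. Proof. by rewrite -scaleN1r (linear_Z _ _ lm) scaleN1r. Qed.
Let mN' v : m' (- v) = - m' v. Proof. by rewrite -scaleN1r (linear_Z _ _ lm') scaleN1r. Qed.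

Let q_e : cdq e = 0. Proof. exact: pdot pe. Qed.
Let q_e' : cdq e' = 0. Proof. exact: pdot pe'. Qed.
Let dot_em v : cddot e (m v) = 0. Proof. by rewrite -mM (pm_dot k3 pe). Qed.
Let dot_em' v : cddot e (m' v) = 0. Proof. by rewrite -mM' (pm_dot' k3 pe'). Qed.
Let dot_e'm' v : cddot e' (m' v) = 0. Proof. by rewrite -mM' (pm_dot k3 pe'). Qed.
Let jaut_rot f : jaut_fun f -> jaut_fun (fun X => jrot (jrot (f (jrot X)))).
Proof.
move=> af; apply: (@jaut_fun_comp F k _ (fun X => jrot (f (jrot X)))); first exact: jrot_jaut.
apply: (@jaut_fun_comp F k _ (fun X => f (jrot X))); first exact: jrot_jaut.
by apply: (@jaut_fun_comp F k f _) => //; exact: jrot_jaut.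
Qed.
Let jaut_rot2 f : jaut_fun f -> jaut_fun (fun X => jrot (f (jrot (jrot X)))).
Proof.
move=> af; apply: (@jaut_fun_comp F k _ (fun X => f (jrot (jrot X)))); first exact: jrot_jaut.
apply: (@jaut_fun_comp F k f (fun X => jrot (jrot X))) => //.
by apply: (@jaut_fun_comp F k _ (@jrot F k)); exact: jrot_jaut.
Qed.
Let actK (f g : J -> J) w : cancel f g -> act g (act f w) = w.
Proof. by move=> fK; rewrite /act /= !fK; case: w. Qed.
Let zD (n : A -> V) x y : linear n -> n (x + y) = n x + n y.
Proof. by move=> ln; rewrite (linear_D _ _ ln). Qed.
Let poly_act (f : V -> J -> J) : (forall (U : vectType F) (g : U -> V) (h : U -> J),
    polymap g -> polymap h -> polymap (fun u => f (g u) (h u))) ->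
  polymap (fun u : (V * W)%type => act (f u.1) u.2).
Proof.
move=> H; apply: polymap_pair.
  by apply: (H _ (fun u => u.1) (fun u => u.2.1)); polysolve.
by apply: (H _ (fun u => u.1) (fun u => u.2.2)); polysolve.
Qed.
Let poly_mg (U : vectType F) (g : U -> V) : polymap g -> polymap (fun u => m (g u)).
Proof. by apply: polymap_comp; exact: polymap_lin. Qed.
Let poly_mg' (U : vectType F) (g : U -> V) : polymap g -> polymap (fun u => m' (g u)).
Proof. by apply: polymap_comp; exact: polymap_lin. Qed.

Let stage1 (T : vectType F) : cell T S1 -> cell (V * T)%type general.
Proof.
apply: (cell_shift (z := z1) (a := fun v w => act (jtau (m v)) w)) => //.
- by apply: poly_z => //; polysolve.
- apply: (@poly_act (fun v => jtau (m v))) => U g h pg ph.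
  by apply: polymap_jtau => //; exact: poly_mg.
move=> v w gw; have H X := shift_tau3 k3 pe (m v) X; rewrite /= !mM in H.
have [_ _ h2x _ h2y] := gw; split.
- by apply: general_act => //; [exact: jtau_jaut | move=> X; case: (H X) | move=> X; case: (H X)].
- by have [_ _ E] := H w.2; rewrite /z1 /= E h2y scale1r zD // mK.
by apply: actK => X; rewrite mN jtauK.
Qed.

Let stage2 (T : vectType F) : cell T S2 -> cell (V * T)%type S1.
Proof.
apply: (cell_shift (z := z2) (a := fun v w => act (jtau2 (m (- v))) w)) => //.
- by apply: poly_z => //; polysolve.
- apply: (@poly_act (fun v => jtau2 (m (- v)))) => U g h pg ph.
  apply: polymap_jrot; apply: polymap_jtau.
    by apply: poly_mg; exact: polymapN.
  by do 2! apply: polymap_jrot.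
move=> v w [gw zw]; have H X := shift_tau2 k3 pe (m (- v)) X; rewrite /= !mM in H.
have [_ h3x h2x h3y h2y] := gw; split.
- split.
    apply: general_act => //; [|move=> X; by case: (H X) | move=> X; by case: (H X)].
    by apply: jaut_rot2; exact: jtau_jaut.
  by have [_ _ E] := H w.2; rewrite /z1 /= E h3y scale0r subr0.
- by have [_ _ E] := H w.1; rewrite /z2 /= E h3x scale1r mN opprK zD // mK.
by apply: actK => X; rewrite /jtau2 !jrotK (mN (- v)) jtauK // jrotK.
Qed.

Let stage3 (T : vectType F) : cell T S3 -> cell (V * T)%type S2.
Proof.
apply: (cell_shift (z := z3) (a := fun v w => act (jsigma e (m' v)) w)) => //.
- by apply: poly_z => //; polysolve.
- apply: (@poly_act (fun v => jsigma e (m' v))) => U g h pg ph.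
  by apply: polymap_jsigma => //; exact: poly_mg'.
move=> v w [[gw z1w] z2w]; have H X := shift_sigma3' k3 pe (m' v) X; rewrite /= !mM' in H.
have [_ h3x _ _ _] := gw; split.
- split; first split.
  + apply: general_act => //; [|move=> X; by case: (H X) | move=> X; by case: (H X)].
    exact: jsigma_jaut.
  + by have [_ _ E _] := H w.2; rewrite /z1 /= E.
  + by have [_ _ E _] := H w.1; rewrite /z2 /= E.
- by have [_ _ _ E] := H w.1; rewrite /z3 /= E h3x scale1r zD // mK'.
by apply: actK => X; rewrite mN' jsigmaK.
Qed.

Let stage4 (T : vectType F) : cell T S4 -> cell (V * T)%type S3.
Proof.
apply: (cell_shift (z := z4) (a := fun v w => act (jsigma2 e' (m' v)) w)) => //.
- by apply: poly_z => //; polysolve.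
- apply: (@poly_act (fun v => jsigma2 e' (m' v))) => U g h pg ph.
  apply: polymap_jrot; apply: polymap_jsigma.
    exact: poly_mg'.
  by do 2! apply: polymap_jrot.
move=> v w [[[gw z1w] z2w] z3w].
have H X := shift_sigma2 k3 pe (m' v) X; rewrite /= !mM' in H.
have [_ _ _ _ h2y] := gw; split.
- do 3?split.
  + apply: general_act => //; [|move=> X; by case: (H X) | move=> X; by case: (H X)].
    by apply: jaut_rot2; exact: jsigma_jaut.
  + by have [_ _ E _ _] := H w.2; rewrite /z1 /= E.
  + by have [_ _ E _ _] := H w.1; rewrite /z2 /= E.
  + by have [_ _ _ E _] := H w.1; rewrite /z3 /= E.
- by have [_ _ _ _ E] := H w.2; rewrite /z4 /= E h2y scale1r zD // mK'.
by apply: actK => X; rewrite /jsigma2 !jrotK mN' jsigmaK // jrotK.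
Qed.

Let stage5 (T : vectType F) : cell T S5 -> cell (V * T)%type S4.
Proof.
apply: (cell_shift (z := z5) (a := fun v w => act (jtau1 (m' (- v))) w)) => //.
- by apply: poly_z => //; polysolve.
- apply: (@poly_act (fun v => jtau1 (m' (- v)))) => U g h pg ph.
  do 2! apply: polymap_jrot; apply: polymap_jtau.
    by apply: poly_mg'; exact: polymapN.
  exact: polymap_jrot.
move=> v w [[[[gw z1w] z2w] z3w] z4w].
have H X := shift_tau1 k3 pe (m' (- v)) X; rewrite /= !mM' in H.
have [_ h3x h2x h3y h2y] := gw; split.
- do 4?split.
  + apply: general_act => //; [|move=> X; by case: (H X) | move=> X; by case: (H X)].
    by apply: jaut_rot; exact: jtau_jaut.
  + by have [_ _ E _ _] := H w.2; rewrite /z1 /= E.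
  + by have [_ _ E _ _] := H w.1; rewrite /z2 /= E.
  (* This automorphism also affects the components normalised in stages 3 and 4, but with a
     coefficient that is 0 in the vector concerned. *)
  + by have [_ _ _ _ E] := H w.1; rewrite /z3 /= E h2x scale0r subr0.
  + by have [_ _ _ E _] := H w.2; rewrite /z4 /= E h3y scale0r addr0.
- by have [_ _ _ _ E] := H w.2; rewrite /z5 /= E h2y scale1r mN' opprK zD // mK'.
by apply: actK => X; rewrite /jtau1 !jrotK (mN' (- v)) jtauK // jrotK.
Qed.

Let stage6 (T : vectType F) : cell T S6 -> cell (V * T)%type S5.
Proof.
apply: (cell_shift (z := z6) (a := fun v w => act (jsigma e (m v)) w)) => //.
- by apply: poly_z => //; polysolve.
- apply: (@poly_act (fun v => jsigma e (m v))) => U g h pg ph.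
  by apply: polymap_jsigma => //; exact: poly_mg.
move=> v w [[[[[gw z1w] z2w] z3w] z4w] z5w].
have H X := shift_sigma3 k3 pe (m v) X; rewrite /= !mM in H.
have [_ h3x _ _ _] := gw; split.
- do 5?split.
  + apply: general_act => //; [|move=> X; by case: (H X) => -[] | move=> X; by case: (H X) => -[]].
    exact: jsigma_jaut.
  + by have [[_ _ E] _ _ _] := H w.2; rewrite /z1 /= E.
  + by have [[_ _ E] _ _ _] := H w.1; rewrite /z2 /= E.
  + by have [_ _ E _] := H w.1; rewrite /z3 /= E.
  + by have [_ E _ _] := H w.2; rewrite /z4 /= E.
  + by have [_ _ E _] := H w.2; rewrite /z5 /= E.
- by have [_ _ _ E] := H w.1; rewrite /z6 /= E h3x scale1r zD // mK.
by apply: actK => X; rewrite mN jsigmaK.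
Qed.

Lemma general_cell (T : vectType F) : cell T slice ->
  cell (V * (V * (V * (V * (V * (V * T))))))%type general.
Proof.
move=> c; do [apply: stage1; apply: stage2; apply: stage3; apply: stage4; apply: stage5].
apply: stage6; suff -> : S6 = slice by [].
have i0 x : mi (pm e e' x) = 0 <-> pm e e' x = 0.
  by split=> [E | ->]; [rewrite -miK E (linear_0 lm) | rewrite (linear_0 lmi)].
have i0' x : mi' (pm e' e x) = 0 <-> pm e' e x = 0.
  by split=> [E | ->]; [rewrite -miK' E (linear_0 lm') | rewrite (linear_0 lmi')].
apply/funext => w; apply/propext; split.
  by move=> [[[[[[gw /i0 u1] /i0 u2] /i0' u3] /i0' u4] /i0' u5] /i0 u6].
by move=> [gw [/i0 u1 /i0 u2 /i0' u3 /i0' u4 [/i0' u5 /i0 u6]]].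
Qed.

End StandardCell.

Section SliceEquations.
Variables (F : numClosedFieldType) (k : nat).
Hypothesis k3 : (k <= 3)%N.
Local Notation A := (CD F k).
Variables (e e' : A).
Hypothesis pe : peirce e e'.
Let pe' := peirceC pe.
Variables (a1 a2 a3 b1 b2 b3 : F) (x1 x2 x3 y1 y2 y3 : A).
Hypothesis com : commuting (jmk a1 a2 a3 x1 x2 x3) (jmk b1 b2 b3 y1 y2 y3).
Hypotheses (h3x : pc e x3 = 1) (h2x : pc e' x2 = 0) (h3y : pc e y3 = 0) (h2y : pc e' y2 = 1).
Hypotheses (z1 : pm e e' y1 = 0) (z2 : pm e e' x1 = 0) (z3 : pm e' e x3 = 0).
Hypotheses (z4 : pm e' e y2 = 0) (z5 : pm e' e y3 = 0) (z6 : pm e e' x3 = 0).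

Let pE := (pcM k3 pe, pcM k3 pe', pmM k3 pe, pmM k3 pe', @pcD F k, @pcN F k, @pcZ F k,
  @pmD F k, @pmN F k, @pmZ F k).
Let pV := (pc_conj pe, pc_conj pe', pm_cj k3 pe, pm_cj k3 pe', pc_e pe, pc_e pe',
  pc_e' pe, pc_e' pe', pm_e pe, pm_e pe', pm_e' pe, pm_e' pe').
Let zE := (h3x, h2x, h3y, h2y, z1, z2, z3, z4, z5, z6, cd_zero).
Let dE x : 4%:R * cddot x e = 2%:R * pc e x.
Proof. by rewrite /pc cddotC; ring. Qed.
Let dE' x : 4%:R * cddot x e' = 2%:R * pc e' x.
Proof. by rewrite /pc cddotC; ring. Qed.

(** Evaluation at e and e' brings in the normalised pairings, so the remaining Peirce components
    appear with nonzero constant coefficients and vanish one after another. *)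
Let off3 := commuting_off3 com e.
Let off2 := commuting_off2 com e'.

Let n1 : pm e' e x2 = 0.
Proof.
have := congr1 (pm e' e) off3; rewrite !dE !(pE, pV, zE) !(mul1r, scale1r) opprK => E.
by apply: (eq_from (c := - 2%:R^-1) E); cdmodule_with ltac:(by field).
Qed.
Let n2 : pm e e' y3 = 0.
Proof.
have := congr1 (pm e e') off3; rewrite !dE !(pE, pV, zE) => E.
by apply: (eq_from (c := - 2%:R^-1) E); cdmodule_with ltac:(by field).
Qed.
Let n3 : pm e e' x2 = 0.
Proof.
have := congr1 (pm e e') off2; rewrite !dE' !(pE, pV, zE) => E.
by apply: (eq_from (c := 2%:R^-1) E); cdmodule_with ltac:(by field).
Qed.
Let n4 : pm e e' y2 = 0.
Proof.
have [E _ _] := commuting_diag com; have := congr1 (pm e e') E.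
rewrite !(pE, pV, n1, n2, n3, zE) !(mul1r, scale1r) => {}E.
by apply: (eq_from (c := -1) E); cdmodule.
Qed.
Let n5 : pm e' e y1 = 0.
Proof.
have [_ E _] := commuting_diag com; have := congr1 (pm e' e) E.
rewrite !(pE, pV, n1, n2, n3, n4, zE) !(mul1r, scale1r) => {}E.
by apply: (eq_from (c := 1) E); cdmodule.
Qed.
Let n6 : pm e' e x1 = 0.
Proof.
have [_ _ E] := commuting_diag com; have := congr1 (pm e' e) E.
rewrite !(pE, pV, n1, n2, n3, n4, n5, zE) !(mul1r, scale1r) => {}E.
by apply: (eq_from (c := 1) E); cdmodule.
Qed.

Let nE := (n1, n2, n3, n4, n5, n6).

Lemma slice_eq : a1 + a2 + a3 = 0 -> b1 + b2 + b3 = 0 ->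
  let a := a2 - a1 in let b := pc e x1 in let c := pc e' x1 in
  let d := a3 - a1 in let f := pc e' y1 in let g := b3 - b1 in
  jmk a1 a2 a3 x1 x2 x3 = slice1 e e' a b c d f g /\
  jmk b1 b2 b3 y1 y2 y3 = slice2 e e' a b c d f g.
Proof.
move=> ta tb a b c d f g.
have [E1 E2 E3] := commuting_diag com.
have := congr1 (pc e) E1; rewrite !(pE, pV, nE, zE) => F1.
have := congr1 (pc e') E1; rewrite !(pE, pV, nE, zE) => F1'.
have := congr1 (pc e) E2; rewrite !(pE, pV, nE, zE) => F2.
have := congr1 (pc e') E2; rewrite !(pE, pV, nE, zE) => F2'.
have := congr1 (pc e) E3; rewrite !(pE, pV, nE, zE) => F3.
(* [F4] and [F5] form a regular linear system in the entries [pc e' y3] and [pc e x2]; its solution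
   is b f - c d for both. *)
have := congr1 (pc e') off3; rewrite !dE !(pE, pV, nE, zE) => F4.
have := congr1 (pc e) off2; rewrite !dE' !(pE, pV, nE, zE) => F5.
have Y1 : pc e y1 = d by rewrite -[LHS]mul1r -F2' mulr1.
have B2 : c = b2 - b1 by rewrite -[LHS]mulr1 -F3; ring.
rewrite Y1 -/b -/c -/f in F4 F5.
have t1 : pc e' y3 = b * f - c * d.
  by apply: (lincomb2 (c := - 2%:R / 3%:R) (d := 3%:R^-1) F4 F5); field.
have t2 : pc e x2 = b * f - c * d.
  by apply: (lincomb2 (c := - 3%:R^-1) (d := 2%:R / 3%:R) F4 F5); field.
have s1 : pc e' x3 = c * b + d ^+ 2 - a * d - b * g.
  rewrite Y1 -/b in F1; apply: (lincomb1 (c := 1) F1); rewrite B2 /a /d /g; ring.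
have u1 : pc e y2 = c ^+ 2 + d * f - f * a - g * c.
  rewrite -/f -/c in F1'; apply: (lincomb1 (c := 1) F1'); rewrite B2 /a /d /g; ring.
rewrite /slice1 /slice2 !jproj_jmk (pdecompE k3 pe x1) (pdecompE k3 pe x2) (pdecompE k3 pe x3).
rewrite (pdecompE k3 pe y1) (pdecompE k3 pe y2) (pdecompE k3 pe y3) !(nE, zE)
  t1 t2 s1 u1 Y1 -/b -/c.
have A3 : a3 = - a1 - a2 by apply: (lincomb1 (c := 1) ta); ring.
have B3 : b3 = - b1 - b2 by apply: (lincomb1 (c := 1) tb); ring.
split; apply: jmk_eq; rewrite ?B2 /a /d /g ?A3 ?B3 //; (first [by field | cdmodule]).
Qed.
End SliceEquations.

Section StandardBase.
Variables (F : numClosedFieldType) (k : nat).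
Hypothesis k3 : (k <= 3)%N.
Local Notation A := (CD F k).
Local Notation J := (J3 F k).
Local Notation W := (J * J)%type.
Variables (e e' : A).
Hypothesis pe : peirce e e'.
Let pe' := peirceC pe.
Local Notation T0 := (F^o * F^o * F^o * F^o * F^o * F^o)%type.

Let rules := (jproj_jmk, @jcE F k, @pcD F k, @pcZ F k, @pmD F k, @pmZ F k, pc_e pe, pc_e pe',
  pc_e' pe, pc_e' pe', pm_e pe, pm_e pe', pm_e' pe, pm_e' pe', @pm0 F k, @cd_zero, @mulr1).

Lemma slice_cell : cell (T0 : vectType F) (slice e e' : set W).
Proof.
exists (fun t : T0 => let a := t.1.1.1.1.1 in let b := t.1.1.1.1.2 in let c := t.1.1.1.2 in
  let d := t.1.1.2 in let f := t.1.2 in let g := t.2 in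
  (slice1 e e' a b c d f g, slice2 e e' a b c d f g)).
(* Projection to trace 0 shifts the diagonal, so only differences of diagonal entries are
   meaningful; the (1,1) entries of the two matrices are 0. *)
exists (fun w => (jd2 w.1 - jd1 w.1, pc e (jx1 w.1), pc e' (jx1 w.1), jd3 w.1 - jd1 w.1,
  pc e' (jx1 w.2), jd3 w.2 - jd1 w.2)).
split.
- have pj (u : T0 -> J) : polymap u -> polymap (fun t => @jproj F k (u t)).
    by apply: polymap_comp; apply: polymap_lin; exact: jproj_linear.
  have pa : polyfun (fun t : T0 => t.1.1.1.1.1 : F) by apply: polymap_polyfun; polysolve.
  have pb : polyfun (fun t : T0 => t.1.1.1.1.2 : F) by apply: polymap_polyfun; polysolve.
  have pcc : polyfun (fun t : T0 => t.1.1.1.2 : F) by apply: polymap_polyfun; polysolve.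
  have pd : polyfun (fun t : T0 => t.1.1.2 : F) by apply: polymap_polyfun; polysolve.
  have pf : polyfun (fun t : T0 => t.1.2 : F) by apply: polymap_polyfun; polysolve.
  have pg : polyfun (fun t : T0 => t.2 : F) by apply: polymap_polyfun; polysolve.
  by rewrite /= /slice1 /slice2; apply: polymap_pair; apply: pj; polysolve.
- rewrite /pc; do 5! (apply: polymap_pair; last by apply: polyfun_polymap; polysolve).
  by apply: polyfun_polymap; polysolve.
- move=> [[[[[a b] c] d] f] g] /=; have sY := slice_reductions k3 pe a b c d f g.
  by split; [split=> // | split]; rewrite /= /slice1 /slice2 !rules.
- move=> [[[[[a b] c] d] f] g]; rewrite /= /slice1 /slice2 !rules.
  by congr (_, _, _, _, _, _); ring.
move=> [X Y] [[YL h3x h2x h3y h2y] [z1 z2 z3 z4 [z5 z6]]] /=.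
case: (jmkP X) YL h3x h2x h3y h2y z1 z2 z3 z4 z5 z6 => a1 a2 a3 x1 x2 x3.
case: (jmkP Y) => b1 b2 b3 y1 y2 y3; rewrite /= !jcE => YL h3x h2x h3y h2y z1 z2 z3 z4 z5 z6.
have com : commuting (jmk a1 a2 a3 x1 x2 x3) (jmk b1 b2 b3 y1 y2 y3).
  by move=> Z; exact: (reductions_commute k3).
have [[_ L0] _] := YL.
move: L0; rewrite subv_add -!memvE !memJ30 !jtr_jmk => /andP[/eqP ta /eqP tb].
by have [-> ->] := slice_eq k3 pe com h3x h2x h3y h2y z1 z2 z3 z4 z5 z6 ta tb.
Qed.

End StandardBase.

(** * Parameters of the cell *)

Section ImaginaryPart.
Variables (F : numClosedFieldType) (k' : nat).
Local Notation k := k'.+1.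
Hypothesis k3 : (k <= 3)%N.
Local Notation A := (CD F k).

Definition imag : {vspace CD F k'} := lker (linfun (@cdre F k' : CD F k' -> F^o)).
Local Notation V := (subvs_of imag).

Lemma mem_imag x : (x \in imag) = (cdre x == 0).
Proof. by rewrite memv_ker lfunE. Qed.

Lemma dim_imag : (\dim {:V}).+1 = (2 ^ k')%N.
Proof.
rewrite dimvf /dim /= -(dim_CD F k').
rewrite -(limg_ker_dim (linfun (@cdre F k' : CD F k' -> F^o)) fullv) capfv -/imag.
have -> : (linfun (@cdre F k' : CD F k' -> F^o) @: fullv)%VS = fullv.
  apply/eqP; rewrite eqEsubv subvf; apply/subvP => c _.
  by apply/memv_imgP; exists (cdscal k' c); rewrite ?memvf // lfunE /= cdscalK.
by rewrite (dimvf (F^o)) addn1.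
Qed.

Variables (e e' : A).
Hypothesis pe : peirce e e'.
Hypothesis be : bar e = e'.

(** Identifies e A e' with the imaginary elements of the algebra one level below. An element (v, 0)
    with v imaginary is fixed by [bar] and orthogonal to e and e', so it is the sum of its two
    Peirce components. These are exchanged by [bar] and have the same first half, whence the factor
    2 in [unhalf]. *)
Definition half (v : V) : A := pm e e' (vsval v, 0).
Definition unhalf (x : A) : V := vsproj imag (2%:R *: x.1).

Let be' : bar e' = e. Proof. by rewrite -be /bar /= opprK; case: (e). Qed.

Let bar_pm x : bar (pm e e' x) = pm e' e (bar x).
Proof. by rewrite !pmE !barM be be'. Qed.

Lemma half_linear : linear half.
Proof.
move=> c v w; rewrite /half -pmZ -pmD; congr pm; rewrite linearP /=.
by congr pair; rewrite /= scaler0 addr0.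
Qed.
Lemma unhalf_linear : linear unhalf.
Proof.
move=> c x y; rewrite /unhalf /= scalerDr scalerA mulrC -scalerA.
exact: linearP.
Qed.

Let decomp (v : CD F k') : cdre v = 0 -> ((v, 0) : A) = pm e e' (v, 0) + pm e' e (v, 0).
Proof.
move=> v0; set x : A := (v, 0).
have bx : bar x = x by rewrite /bar /x /= oppr0.
have d0 : cddot e x + cddot e' x = 0.
  by rewrite -cddotDl (psum pe) cddot1l.
have d1 : cddot e x = cddot e' x by rewrite -bar_dot be bx.
have p0 : cddot e x = 0.
  by move: d0; rewrite -d1 => d0; apply: (lincomb1 (c := 2%:R^-1) d0); field.
by rewrite {1}(pdecomp k3 pe x) -d1 p0 !cd_zero.
Qed.

Lemma halfK : cancel half unhalf.
Proof.
move=> v; rewrite /unhalf /half -[RHS]vsvalK; congr vsproj.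
have v0 : cdre (vsval v) = 0 by apply/eqP; rewrite -mem_imag subvsP.
have E1 : (pm e' e (vsval v, 0)).1 = (pm e e' (vsval v, 0)).1.
  have := congr1 fst (bar_pm (vsval v, 0)).
  by have -> : bar ((vsval v, 0) : A) = (vsval v, 0) by rewrite /bar /= oppr0.
by rewrite scaler_nat mulr2n -{2}E1; have /= <- := congr1 fst (decomp v0).
Qed.

Lemma unhalfK x : half (unhalf (pm e e' x)) = pm e e' x.
Proof.
rewrite /half /unhalf vsprojK; last first.
  rewrite mem_imag cdreZ; have := pm_re k3 pe x; rewrite /cdre -/(@cdre F k') => ->.
  by rewrite mulr0.
have -> : ((2%:R *: (pm e e' x).1, 0) : A) = pm e e' x + bar (pm e e' x).
  by rewrite /bar; case: (pm e e' x) => u v; congr pair; rewrite /= ?subrr // scaler_nat mulr2n.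
by rewrite bar_pm pmD (pm_pm k3 pe) (pm_pm' k3 pe) addr0.
Qed.

Lemma half_pm v : pm e e' (half v) = half v. Proof. exact: (pm_pm k3 pe). Qed.

End ImaginaryPart.

Section CellDimension.
Variables (F : numClosedFieldType) (k' : nat).
Local Notation k := k'.+1.
Hypothesis k3 : (k <= 3)%N.
Local Notation eps := (eps F k').

Lemma peirce_eps : peirce eps (cj eps).
Proof. by split; [by [] | exact: eps_re | exact: eps_q]. Qed.

Lemma dim_prod (V W : vectType F) : \dim {: (V * W)%type} = (\dim {:V} + \dim {:W})%N.
Proof. by rewrite !dimvf. Qed.

Lemma general_affine : exists2 T : vectType F, \dim {:T} = (3 * 2 ^ k)%N &
  cell T (general eps (cj eps)).
Proof.
have pe := peirce_eps; have pe' := peirceC pe.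
have be : bar eps = cj eps by exact: bar_eps.
have be' : bar (cj eps) = eps by rewrite bar_conj be cdconjK.
have c := slice_cell k3 pe.
have := general_cell k3 pe (half_linear eps (cj eps)) (half_linear (cj eps) eps)
  (@unhalf_linear F k') (@unhalf_linear F k') (half_pm k3 pe) (half_pm k3 pe')
  (halfK k3 pe be) (halfK k3 pe' be') (unhalfK k3 pe be) (unhalfK k3 pe' be') c.
set T := (X in cell X _) => cT; exists T => //.
rewrite /T !dim_prod !(dimvf F^o) -[X in _ = X]/(3 * (2 ^ k'.+1))%N expnS -(dim_imag F k').
have -> : dim F^o = 1%N by [].
by move: (\dim fullv) => d; ring.
Qed.

End CellDimension.

(** * The complement of a polar hyperplane *)

Section PolarComplement.
Variables (F : numClosedFieldType) (k' : nat).
Local Notation k := k'.+1.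
Hypothesis k3 : (k <= 3)%N.
Local Notation J := (J3 F k).
Local Notation N := (\dim {:J}).
Local Notation e := (eps F k').
Local Notation e' := (cj (eps F k')).
Local Notation P := (jmk 0 0 0 0 0 e : J).
Local Notation Q := (jmk 0 0 0 0 e' 0 : J).
Implicit Types (A B X Y : J).

Let ep X : F := pc e (jx3 X).
Let er X : F := pc e' (jx2 X).

Let epE X : ep X = jQ P X.
Proof. by case: (jmkP X) => *; rewrite /ep jcE jQ_jmk !cd_zero. Qed.
Let erE X : er X = jQ Q X.
Proof. by case: (jmkP X) => *; rewrite /er jcE jQ_jmk !cd_zero. Qed.
Let lform_p : lform ep.
Proof. by move=> c X Y; rewrite !epE jQDr jQZr. Qed.
Let lform_r : lform er.
Proof. by move=> c X Y; rewrite !erE jQDr jQZr. Qed.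
Let two0 : 2%:R != 0 :> F := two_neq0 F.

Variables (x : {vspace J}) (g h : 'End(J)).
Hypotheses (ag : jaut g) (ah : jaut h) (gK : cancel g h) (hK : cancel h g).
Hypothesis xE : x = (<[h P]> + <[h Q]>)%VS.

(** The form on decomposable bivectors is a determinant of values of Q; moving the automorphism to
    the other side turns these into the pairings of g A and g B with the standard line. Membership
    in [Ua] comes from [reductions_Ua]. *)
Let polarP A B : reductions (<[A]> + <[B]>)%VS ->
  polar_hyperplane x (ext2 (<[A]> + <[B]>)%VS) <->
  ep (g A) * er (g B) - er (g A) * ep (g B) = 0.
Proof.
move=> Y; have form : wedge_form (wedge (h P) (h Q)) (wedge A B) =
    ep (g A) * er (g B) - er (g A) * ep (g B).
  have jQh X Z : jQ (h X) Z = jQ X (g Z) by rewrite -(jaut_jQ _ _ ag) hK.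
  rewrite wedge_form_wedge // !jQh !epE !erE.
  by move: (jQ _ _) (jQ _ _) (jQ _ _) (jQ _ _) => *; ring.
have [[d2 _] _] := Y; have w0 : wedge A B != 0 by apply/wedge_dim2.
rewrite -form ext2_line; split=> [[_ _ H] | H].
  by apply: H; rewrite ?memv_line // xE ext2_line memv_line.
split; first by rewrite dim_vline w0.
  by move=> w wL; apply: (reductions_Ua k3 Y).
move=> z w; rewrite xE ext2_line => /vlineP[c ->] /vlineP[d ->].
have -> : c *: wedge (h P) (h Q) = wedge (c *: h P) (1 *: h Q) by rewrite wedgeZ mulr1.
have -> : d *: wedge A B = wedge (d *: A) (1 *: B) by rewrite wedgeZ mulr1.
rewrite wedge_form_wedge // !scale1r !(jQZl, jQZr); move: H; rewrite wedge_form_wedge // => H.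
apply: (lincomb1 (c := c * d) H).
by move: {H} (jQ _ _) (jQ _ _) (jQ _ _) (jQ _ _) => *; ring.
Qed.

Let span_normal A B : let d := ep A * er B - er A * ep B in d != 0 ->
  wedge A B != 0 -> exists A1 B1,
  [/\ (<[A1]> + <[B1]> = <[A]> + <[B]>)%VS, ep A1 = 1, er A1 = 0, ep B1 = 0 & er B1 = 1].
Proof.
(* Cramer's rule: the basis is multiplied by the inverse of the matrix of its pairings with the
   standard line. *)
move=> d d0 w0; pose A1 := d^-1 *: (er B *: A - er A *: B).
pose B1 := d^-1 *: (ep A *: B - ep B *: A); exists A1, B1; split.
- have E : wedge (d *: A1) B1 = wedge A B.
    rewrite /A1 /B1 !scalerBr !scalerA -!scaleNr [X in wedge _ X]addrC wedge_comb.
    rewrite -[RHS]scale1r; congr (_ *: _); rewrite -(mulfV d0) /d; field.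
    exact: d0.
  by rewrite -(vlineZ A1 d0); apply: wedge_inj; rewrite E.
- rewrite /A1 lformZ // -scaleNr lformD // !lformZ //; apply: (mulfI d0).
  by rewrite mulrA mulfV // mul1r mulr1 /d; ring.
- by rewrite /A1 lformZ // -scaleNr lformD // !lformZ //; ring.
- by rewrite /B1 lformZ // -scaleNr lformD // !lformZ //; ring.
- rewrite /B1 lformZ // -scaleNr lformD // !lformZ //; apply: (mulfI d0).
  by rewrite mulrA mulfV // mul1r mulr1 /d; ring.
Qed.

Lemma polar_complement : let Y := @reductions F k in
  let YH := [set L | Y L /\ polar_hyperplane x (ext2 L)] in
  isomorphic (quasiproj [set ext2 L | L in Y `\` YH]) (affine_space F (3 * 2 ^ k)%N).
Proof.
move=> Y YH; have [T dT [Ps [Th [pPs pTh gPs PsK ThK]]]] := @general_affine F k' k3.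
have xT : (3 * 2 ^ k)%N = \dim {:T} by rewrite dT.
rewrite [X in affine_space F X]xT {xT dT}.
pose oc (r : 'rV[F]_(\dim {:T})) : T := \sum_i r 0 i *: (vbasis {:T})`_i.
have ocK : cancel oc (@coords F T).
  move=> r; apply/rowP => i; rewrite !mxE /oc.
  by rewrite coord_sum_free // (basis_free (vbasisP _)).
have coordsK : cancel (@coords F T) oc.
  move=> t; rewrite /oc [RHS](coord_vbasis (memvf t)).
  by apply: eq_bigr => i _; rewrite mxE.
have poc : polymap oc.
  by apply: polymap_lin => c r s; rewrite /oc scaler_sumr -big_split; apply: eq_bigr => i _;
    rewrite !mxE scalerDl scalerA.
pose w (t : 'rV[F]_(\dim {:T})) := Ps (oc t).
(* For the bivector of a normalised basis, contraction with [er] gives minus the first vector and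
   contraction with [ep] the second, so the basis is a linear function of the bivector. The form [l]
   is the pairing with the standard line, equal to 1 there. *)
pose pr (u : 'M[F]_N) := (- contr er (ext2_map g u), contr ep (ext2_map g u)) : (J * J)%type.
pose l (u : 'M[F]_N) := er (contr ep (ext2_map g u)).
have wE t : general e e' (w t) by exact: gPs.
have prE A B : general e e' (A, B) -> pr (wedge (h A) (h B)) = (A, B).
  move=> [_ /= pA rA pB rB]; rewrite /pr ext2_map_wedge !hK !contr_wedge //.
  by rewrite /ep /er pA rA pB rB !scale0r !scale1r subr0 sub0r opprK.
apply: (chart_isomorphic (l := l) (Th := fun u => coords (Th (pr u)))
  (Ps := fun t => wedge (h (w t).1) (h (w t).2))).
- move=> c u v; rewrite /l (ext2_map_linear g) (contr_linear ep); exact: lform_r.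
- apply: (polymap_comp (f := @coords F T)); first by apply: polymap_lin; exact: linearP.
  apply: (polymap_comp pTh); apply: polymap_pair.
    apply: polymapN; apply: polymap_lin => c u v.
    by rewrite (ext2_map_linear g) (contr_linear er).
  by apply: polymap_lin => c u v; rewrite (ext2_map_linear g) (contr_linear ep).
- have pw : polymap w by exact: polymap_comp.
  have ph (f : 'rV[F]_(\dim {:T}) -> J) : polymap f -> polymap (fun t => h (f t)).
    by apply: polymap_comp; apply: polymap_lin => c u v; rewrite linearP.
  by apply: polymap_wedge; apply: ph; [exact: polymap_fst | exact: polymap_snd].
- move=> t; have [_ pA rA pB rB] := wE t.
  rewrite /l ext2_map_wedge !hK contr_wedge // /ep pA pB scale1r scale0r subr0.
  exact: rB.
- move=> t; have [YL pA rA pB rB] := wE t.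
  have Yh := jaut_reductions k3 ah YL; rewrite limg_pair in Yh.
  exists (<[h (w t).1]> + <[h (w t).2]>)%VS; last by rewrite ext2_line.
  split=> // -[_ /(polarP Yh)]; rewrite !hK /ep /er pA rA pB rB !mul1r mul0r subr0.
  by move/eqP; rewrite oner_eq0.
- move=> t; have -> : pr (wedge (h (w t).1) (h (w t).2)) = w t; last by rewrite /w PsK ocK.
  by rewrite [RHS]surjective_pairing; apply: prE; rewrite -surjective_pairing.
move=> _ [L [YL nL] <-].
have [A [B [LE w0 _ _ _]]] := reductions_plane YL.
have d0 : ep (g A) * er (g B) - er (g A) * ep (g B) != 0.
  apply/eqP => E; apply: nL; split=> //.
  by rewrite LE; apply/polarP; rewrite -?LE.
have wg : wedge (g A) (g B) != 0.
  apply/eqP => /(congr1 (ext2_map h)); rewrite ext2_map_wedge !gK.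
  by rewrite (linear_0 (ext2_map_linear h)); exact/eqP.
have [A1 [B1 [spanE p1 r1 p2 r2]]] := span_normal d0 wg.
have gen : general e e' (A1, B1).
  split=> //=; rewrite spanE -limg_pair -LE; exact: (jaut_reductions k3).
exists (coords (Th (A1, B1))); rewrite /w coordsK ThK // -ext2_line -limg_pair /= spanE.
by rewrite limg_pair !gK LE.
Qed.

End PolarComplement.

Theorem proposition3p23 (R : realType) (a k : nat) (ha : a \in [:: 2; 4; 8]%N)
    (hk : a = (2 ^ k)%N) (x : {vspace J3 R[i] k})
    (hx : @reductions4 R[i] k x) :
  let Y := @reductions R[i] k in
  let YH := [set L | Y L /\ polar_hyperplane x (ext2 L)] in
  isomorphic (quasiproj [set ext2 L | L in Y `\` YH])
             (affine_space R[i] (3 * a)).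
Proof.
have [O [[Ox OY] OE Ocl _]] := hx.
have k3 : (k <= 3)%N.
  rewrite -(leq_exp2l _ _ (isT : (1 < 2)%N)) -hk.
  by move: ha; rewrite !inE => /or3P[] /eqP ->.
case: k hk x hx k3 O Ox OY OE Ocl => [|k'] hk x _ k3 O Ox OY OE Ocl.
  by move: ha; rewrite hk.
have [g ag gx] := orbit_standard k3 OY OE Ocl Ox.
have [h [ah gK hK]] := jaut_inv ag.
rewrite hk; apply: (polar_complement k3 ag ah gK hK).
rewrite -limg_pair -gx -limg_comp -[LHS]lim1g; congr (_ @: _)%VS.
by apply/lfunP => X; rewrite comp_lfunE id_lfunE gK.
Qed.
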